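(* Let $h\geq 0$, $\ell\ge 1$, let $b_1,\ldots,b_h,a_1,\ldots,a_\ell$ be positive integers, let $\beta=[0;b_1,\ldots,b_h,\overline{a_1,\ldots,a_\ell}]$, and for $\varepsilon\in\mathbb{R}$ let $$P_{q_n}(\beta,\varepsilon)=\prod_{r=1}^{q_n}2\left|\sin\pi\left(r\beta+(-1)^{n+1}\frac{\varepsilon}{q_n}\right)\right|,\qquad q_n=q_n(\beta).$$ Then for each $k=1,\ldots,\ell$ the sequence of functions $\varepsilon\mapsto P_{q_{h+m\ell+k}}(\beta,\varepsilon)$ converges, as $m\to\infty$, locally uniformly to a function $G_k(\beta,\varepsilon)$. The limit function satisfies $$G_{k}(\beta,\varepsilon)=\left|1+\frac{\varepsilon}{|c_ke_k|}\right|\left(1+\frac{1}{|b|^{2}}\right)^{\frac{1}{c-2}}\frac{1}{(c!)^{1/(c-2)}}\prod_{t=1}^{\infty}\left|\left(1-\frac{\left(1+\frac{2\varepsilon}{|e_kc_k|}\right)^2}{u_k(t)^2}\right)\left(1-\frac{\left(1+\frac{2}{|b|^2}\right)^2}{u_k(t)^2}\right)^{\frac{1}{c-2}}\prod_{s=1}^{c-1}\left(1-\frac{(1+2s)^2}{u_k(t)^2}\right)^{-\frac{1}{c-2}}\right|$$ when $\ell$ is even, and $$G_{k}(\beta,\varepsilon)=\frac{\left|1+\frac{\varepsilon}{|c_ke_k|}\right|}{\prod_{s=1}^{c}|s-a|^{\frac1c}}\prod_{t=1}^{\infty}\left|\left(1-\frac{\left(1+\frac{2\varepsilon}{|e_kc_k|}\right)^2}{u_k(t)^2}\right)\prod_{s=0}^{c-1}\left(1-\frac{\left(1+2\left(s-\frac{1}{|b|}\right)\right)^2}{u_k(t)^2}\right)^{-\frac1c}\right|$$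 when $\ell$ is odd. In both cases the functions $G_k(\beta,\cdot)$, $k=1,\ldots,\ell$, are continuous, and $C^\infty$ on every interval where they are non-zero.
   Context: For an irrational $\gamma=[0;d_1,d_2,\ldots]$ with positive integer digits $d_i$, define $p_n(\gamma),q_n(\gamma)$ by $p_0=1,\ p_1=0,\ p_{n+1}=d_np_n+p_{n-1}$ and $q_0=0,\ q_1=1,\ q_{n+1}=d_nq_n+q_{n-1}$. An overline denotes the repeated block of a periodic continued fraction, and $\{x\}$ is the fractional part of $x$. The constants $a,b,c,c_k,e_k$ and the sequence $u_k(t)$ refer to the purely periodic irrational $\alpha=[0;\overline{a_1,\ldots,a_\ell}]$: $c=q_{\ell+1}(\alpha)+p_\ell(\alpha)$, $\ a=\frac{c+\sqrt{c^2+4(-1)^{\ell-1}}}{2}$, $\ b=\frac{c-\sqrt{c^2+4(-1)^{\ell-1}}}{2}$; for $k=0,1,\ldots,\ell-1$, $$c_k=\frac{q_{\ell+k}(\alpha)-b\,q_k(\alpha)}{a-b},\qquad e_k=(-1)^{k-1}\frac{|a\,q_k(\alpha)-q_{\ell+k}(\alpha)|}{q_\ell(\alpha)},$$ extended to all $k\ge 0$ periodically modulo $\ell$ (so $c_\ell=c_0$, $e_\ell=e_0$). For $k=1,\ldots,\ell$ put $\alpha_{\sigma_k}=[0;\overline{a_{k-1},\ldots,a_1,a_\ell,\ldots,a_k}]$ (with $\alpha_{\sigma_1}=[0;\overline{a_\ell,\ldots,a_1}]$) and $$u_k(t)=2\left(\frac{t}{|e_kc_k|}-\{t\alpha_{\sigma_k}\}+\frac12\right),\qquad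 t=1,2,\ldots$$ For a nonzero real $x$ and a real exponent $r$, the absolute value $|x^r|$ is understood as $|x|^r$. *)

(* Defs.v *)
From Stdlib Require Import Reals ZArith List Arith.
From Coquelicot Require Import Coquelicot.
Import ListNotations.
Open Scope R_scope.

Definition Rprod (s : list nat) (f : nat -> R) : R :=
  fold_right Rmult 1 (map f s).

(* Value of the infinite product over t = 1, 2, ... : limit of the partial
   products; the limit 0 is allowed, since single factors may vanish. *)
Definition is_infprod (f : nat -> R) (L : R) : Prop :=
  is_lim_seq (fun N : nat => Rprod (seq 1 N) f) L.

(* |x^r| = |x|^r, meaningful for x <> 0 only (Rpower 0 r is a junk value). *)
Definition abspow (x r : R) : R := Rpower (Rabs x) r.

Definition is_interval (I : R -> Prop) : Prop :=
  forall x y z : R, I x -> I y -> x <= z <= y -> I z.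

(* A digit sequence d_1, d_2, ... is a function d : nat -> nat; d 0 is never
   used.  The digits below are those of [0; pre, per, per, ...]. *)
Definition digits (pre per : list nat) (i : nat) : nat :=
  if (i <=? length pre)%nat then nth (i - 1) pre 0%nat
  else nth ((i - 1 - length pre) mod length per)%nat per 0%nat.

(* The finite continued fraction [0; d_i, ..., d_(i+n-1)]. *)
Fixpoint cf_fin (d : nat -> nat) (i n : nat) : R :=
  match n with
  | O => 0
  | S n' => / (INR (d i) + cf_fin d (S i) n')
  end.

Definition cf (d : nat -> nat) : R :=
  real (Lim_seq (fun n : nat => cf_fin d 1 n)).

(* The indexing is p_0 = 1, p_1 = 0 and q_0 = 0, q_1 = 1, so that
   [0; d_1, ..., d_n] = p_(n+1) / q_(n+1). *)
Fixpoint cf_p (d : nat -> nat) (n : nat) : nat :=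
  match n with
  | O => 1
  | S n1 =>
      match n1 with
      | O => 0
      | S n0 => d n1 * cf_p d n1 + cf_p d n0
      end
  end.

Fixpoint cf_q (d : nat -> nat) (n : nat) : nat :=
  match n with
  | O => 0
  | S n1 =>
      match n1 with
      | O => 1
      | S n0 => d n1 * cf_q d n1 + cf_q d n0
      end
  end.

(* P_{q_n}(beta, eps) for beta = cf d. *)
Definition sudler (d : nat -> nat) (n : nat) (eps : R) : R :=
  Rprod (seq 1 (cf_q d n)) (fun r : nat =>
    2 * Rabs (sin (PI * (INR r * cf d
                         + (-1) ^ (n + 1) * (eps / INR (cf_q d n)))))).

(* From here on, per = [a_1; ...; a_l] is the period of the purely periodic
   alpha, and l = length per. *)

Definition alpha_q (per : list nat) (n : nat) : R :=
  INR (cf_q (digits [] per) n).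

Definition cst_c (per : list nat) : nat :=
  (cf_q (digits [] per) (length per + 1) + cf_p (digits [] per) (length per))%nat.

Definition cst_disc (per : list nat) : R :=
  INR (cst_c per) ^ 2 + 4 * (-1) ^ (length per - 1).

Definition cst_a (per : list nat) : R :=
  (INR (cst_c per) + sqrt (cst_disc per)) / 2.

Definition cst_b (per : list nat) : R :=
  (INR (cst_c per) - sqrt (cst_disc per)) / 2.

(* The defining formulas of c_k and e_k hold for 0 <= k < l; the reduction
   of k modulo l is the periodic extension to all k. *)
Definition coef_c (per : list nat) (k : nat) : R :=
  let j := (k mod length per)%nat in
  (alpha_q per (length per + j) - cst_b per * alpha_q per j)
  / (cst_a per - cst_b per).

Definition coef_e (per : list nat) (k : nat) : R :=
  let j := (k mod length per)%nat in
  powerRZ (-1) (Z.of_nat j - 1)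
  * (Rabs (cst_a per * alpha_q per j - alpha_q per (length per + j))
     / alpha_q per (length per)).

(* |e_k c_k| *)
Definition abs_ec (per : list nat) (k : nat) : R :=
  Rabs (coef_e per k * coef_c per k).

(* alpha_{sigma_k} = [0; a_(k-1), ..., a_1, a_l, ..., a_k, ...], 1 <= k <= l. *)
Definition alpha_sigma (per : list nat) (k : nat) : R :=
  cf (digits [] (rev (firstn (k - 1) per) ++ rev (skipn (k - 1) per))).

Definition u (per : list nat) (k t : nat) : R :=
  2 * (INR t / abs_ec per k - frac_part (INR t * alpha_sigma per k) + 1 / 2).

Definition prefactor_even (per : list nat) (k : nat) (eps : R) : R :=
  let c := cst_c per in
  Rabs (1 + eps / abs_ec per k)
  * Rpower (1 + 1 / Rabs (cst_b per) ^ 2) (1 / (INR c - 2))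
  * (1 / Rpower (INR (fact c)) (1 / (INR c - 2))).

Definition factor_even (per : list nat) (k : nat) (eps : R) (t : nat) : R :=
  let c := cst_c per in
  Rabs (1 - (1 + 2 * eps / abs_ec per k) ^ 2 / u per k t ^ 2)
  * abspow (1 - (1 + 2 / Rabs (cst_b per) ^ 2) ^ 2 / u per k t ^ 2)
           (1 / (INR c - 2))
  * Rprod (seq 1 (c - 1)) (fun s : nat =>
      abspow (1 - (1 + 2 * INR s) ^ 2 / u per k t ^ 2) (- (1 / (INR c - 2)))).

Definition prefactor_odd (per : list nat) (k : nat) (eps : R) : R :=
  let c := cst_c per in
  Rabs (1 + eps / abs_ec per k)
  / Rprod (seq 1 c) (fun s : nat => abspow (INR s - cst_a per) (1 / INR c)).

Definition factor_odd (per : list nat) (k : nat) (eps : R) (t : nat) : R :=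
  let c := cst_c per in
  Rabs (1 - (1 + 2 * eps / abs_ec per k) ^ 2 / u per k t ^ 2)
  * Rprod (seq 0 c) (fun s : nat =>
      abspow (1 - (1 + 2 * (INR s - 1 / Rabs (cst_b per))) ^ 2 / u per k t ^ 2)
             (- (1 / INR c))).

(* Main.v *)
Require Import Defs.
From Stdlib Require Import Reals ZArith List Arith Lia Lra Psatz Permutation.
From Coquelicot Require Import Coquelicot.
Import ListNotations.
Open Scope R_scope.

(** Write q = q_n, delta_n = |q_n beta - p_n| and C_n = q_n delta_n. Sorting
    the factors of P_(q_n) by the distance from r p_n / q_n to the integers and
    pairing r with q - r turns P_(q_n)(eps)^2 into K_n H_n(eps): the constant K_n
    is independent of eps, and H_n(eps) is an explicit product of factors
    1 - z_n(eps) x_n(t) in which x_n(t) tends to 1 / u_k(t)^2 with the uniform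
    bound O(1 / t^2). Hence H_n converges locally uniformly to the square of an
    entire function H by dominated convergence.

    The constant K_n needs no separate analysis. The relation
    q_(n+2l) = c q_(n+l) - (-1)^l q_n between denominators yields an exact
    functional equation between P_(q_n), P_(q_(n+l)) and P_(q_(n+2l)), so
    log K_n satisfies, along n = h + m l + k, a linear recurrence with
    characteristic roots a > 1 and |b| < 1 and a convergent right-hand side.
    Since prod_(t < q) 2 sin(pi t / q) = q gives the crude bound
    log K_n = O(log q_n) = O(m), the expanding root is excluded, hence log K_n
    converges and its limit is read off the recurrence; this is the constant of
    the theorem. The factors at the special points do not vanish because
    an equality u_k(t) = 1 + 2 a^2 (or u_k(t) = 2 a - 1 - 2 s) in Q(a) is
    contradicted by its conjugate. *)

(** * Continued fractions *)

(** The functional equations hold at eps = C_n y, with y one of 0, s, a^2 or s - a, and C_n still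
    varies with n. So locally uniform convergence of H_n is needed already to find the constant, and
    y must be a point where no limiting factor vanishes, since logarithms are taken there. The
    recurrence has the characteristic polynomial X^2 - c X + (-1)^l, whose value at 1 is (1 - a)(1 -
    b). This is 2 - c for even l and - c for odd l, which is the origin of the exponents 1/(c - 2)
    and 1/c. The numbers c!, 1 + 1/|b|^2 and |s - a| are values of the linear factor 1 + y at the
    special points. The factor 1 + eps/|e_k c_k| itself comes from the index r = q_n, the only one
    without a partner q_n - r; the square of P appears because every other index is used once as r
    and once as q_n - r. To exclude the expanding root, log K_n = o(a^m) would do, so very crude
    estimates suffice. The pre-period drops out of the limit because the recurrences hold from n = h
    on and q_(n-1)/q_n forgets its early digits. *)

Definition pos_digits (d : nat -> nat) : Prop :=
  forall i : nat, (1 <= i)%nat -> (1 <= d i)%nat.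

Lemma pos_digits_INR (d : nat -> nat) (i : nat) :
  pos_digits d -> (1 <= i)%nat -> 1 <= INR (d i).
Proof.
  intros hd hi. apply (le_INR 1). apply hd; exact hi.
Qed.

(** Two digits are taken together because a single map x -> 1/(d + x) has slope -1 at x = 0 when d =
    1. For the composite, the difference of images is (x - y) divided by two denominators, each at
    least 2. *)
Lemma inv_step_contract (d e x y : R) :
  1 <= d -> 1 <= e -> 0 <= x -> 0 <= y ->
  Rabs (/ (d + / (e + x)) - / (d + / (e + y))) <= Rabs (x - y) / 4.
Proof.
  intros hd he hx hy.
  assert (h1 : 2 <= d * (e + x) + 1) by nra.
  assert (h2 : 2 <= d * (e + y) + 1) by nra.
  replace (/ (d + / (e + x)) - / (d + / (e + y)))
    with ((x - y) * / ((d * (e + x) + 1) * (d * (e + y) + 1)))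
    by (field; repeat split; nra).
  rewrite Rabs_mult. apply Rmult_le_compat_l; [apply Rabs_pos|].
  rewrite Rabs_pos_eq; [|left; apply Rinv_0_lt_compat; nra].
  apply Rinv_le_contravar; nra.
Qed.

Lemma cf_fin_range (d : nat -> nat) (n i : nat) :
  pos_digits d -> (1 <= i)%nat -> 0 <= cf_fin d i n <= 1.
Proof.
  intros hd. revert i. induction n as [|n IH]; intros i hi; simpl; [lra|].
  assert (h1 := IH (S i) ltac:(lia)). assert (h2 := pos_digits_INR d i hd hi).
  split.
  - left. apply Rinv_0_lt_compat. lra.
  - rewrite <- Rinv_1. apply Rinv_le_contravar; lra.
Qed.

Lemma cf_fin_cauchy (d : nat -> nat) (n k i : nat) :
  pos_digits d -> (1 <= i)%nat ->
  Rabs (cf_fin d i (n + k) - cf_fin d i n) <= 2 * (1 / 2) ^ n.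
Proof.
  intros hd. revert i.
  (* The contraction acts over two digits, so the claim is carried for n and n + 1 together; the
     factor 1/4 per two steps becomes 1/2 per step. *)
  assert (H : forall i, (1 <= i)%nat ->
    Rabs (cf_fin d i (n + k) - cf_fin d i n) <= 2 * (1 / 2) ^ n /\
    Rabs (cf_fin d i (S n + k) - cf_fin d i (S n)) <= 2 * (1 / 2) ^ (S n)).
  { induction n as [|n IH]; intros i hi.
    - split.
      + assert (h1 := cf_fin_range d (0 + k) i hd hi). simpl in *.
        apply Rabs_le. lra.
      + assert (h1 := cf_fin_range d (1 + k) i hd hi).
        assert (h2 := cf_fin_range d 1 i hd hi).
        rewrite pow_1. apply Rabs_le. lra.
    - split; [apply IH; exact hi|].
      assert (hc := inv_step_contract (INR (d i)) (INR (d (S i)))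
        (cf_fin d (S (S i)) (n + k)) (cf_fin d (S (S i)) n)).
      change (cf_fin d i (S (S n) + k)) with
        (/ (INR (d i) + / (INR (d (S i)) + cf_fin d (S (S i)) (n + k)))).
      change (cf_fin d i (S (S n))) with
        (/ (INR (d i) + / (INR (d (S i)) + cf_fin d (S (S i)) n))).
      eapply Rle_trans.
      + apply hc; try (apply pos_digits_INR; [exact hd|lia]).
        * apply cf_fin_range; [exact hd|lia].
        * apply cf_fin_range; [exact hd|lia].
      + destruct (IH (S (S i)) ltac:(lia)) as [h1 _]. simpl. lra. }
  intros i hi. apply H; exact hi.
Qed.

(** The tail [0; d_i, d_(i+1), ...]. By convertibility [cf d] is [cf_tail d 1], so results on tails
    reach beta through a plain [change]. *)
Definition cf_tail (d : nat -> nat) (i : nat) : R := real (Lim_seq (cf_fin d i)).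

Lemma is_lim_seq_half : is_lim_seq (fun n => 2 * (1 / 2) ^ n) 0.
Proof.
  evar_last.
  - apply is_lim_seq_scal_l. apply is_lim_seq_geom. rewrite Rabs_pos_eq; lra.
  - simpl. f_equal. ring.
Qed.

Lemma cf_tail_lim (d : nat -> nat) (i : nat) :
  pos_digits d -> (1 <= i)%nat -> is_lim_seq (cf_fin d i) (cf_tail d i).
Proof.
  intros hd hi.
  assert (ex_finite_lim_seq (cf_fin d i)) as [l hl].
  { apply ex_lim_seq_cauchy_corr. intros eps.
    assert (h := is_lim_seq_half). apply is_lim_seq_spec in h.
    destruct (h (pos_div_2 eps)) as [N hN]. exists N. intros n m hn hm.
    assert (hNN := hN N (Nat.le_refl _)).
    rewrite Rminus_0_r in hNN. apply Rabs_def2 in hNN. simpl in hNN.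
    assert (h1 := cf_fin_cauchy d N (n - N) i hd hi).
    assert (h2 := cf_fin_cauchy d N (m - N) i hd hi).
    replace (N + (n - N))%nat with n in h1 by lia.
    replace (N + (m - N))%nat with m in h2 by lia.
    apply Rabs_def1; apply Rabs_le_between in h1; apply Rabs_le_between in h2; lra. }
  unfold cf_tail. rewrite (is_lim_seq_unique _ _ hl). exact hl.
Qed.

Lemma cf_tail_range (d : nat -> nat) (i : nat) :
  pos_digits d -> (1 <= i)%nat -> 0 <= cf_tail d i <= 1.
Proof.
  intros hd hi. assert (h := cf_tail_lim d i hd hi). split.
  - apply (is_lim_seq_le (fun _ => 0) (cf_fin d i) 0 (cf_tail d i)); auto.
    + intros n. apply cf_fin_range; auto.
    + apply is_lim_seq_const.
  - apply (is_lim_seq_le (cf_fin d i) (fun _ => 1) (cf_tail d i) 1); auto.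
    + intros n. apply cf_fin_range; auto.
    + apply is_lim_seq_const.
Qed.

Lemma cf_tail_step (d : nat -> nat) (i : nat) :
  pos_digits d -> (1 <= i)%nat ->
  cf_tail d i = / (INR (d i) + cf_tail d (S i)).
Proof.
  intros hd hi.
  assert (h := cf_tail_lim d i hd hi).
  assert (h' := cf_tail_lim d (S i) hd ltac:(lia)).
  apply is_lim_seq_incr_1 in h.
  assert (hr := cf_tail_range d (S i) hd ltac:(lia)).
  assert (hp := pos_digits_INR d i hd hi).
  assert (h2 : is_lim_seq (fun n => / (INR (d i) + cf_fin d (S i) n))
                 (/ (INR (d i) + cf_tail d (S i)))).
  { apply (is_lim_seq_inv _ (INR (d i) + cf_tail d (S i))).
    - apply (is_lim_seq_plus' (fun _ => INR (d i))); [apply is_lim_seq_const|exact h'].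
    - intros H. injection H. lra. }
  apply is_lim_seq_unique in h. apply is_lim_seq_unique in h2.
  simpl in h. rewrite h in h2. injection h2. auto.
Qed.

Lemma cf_tail_pos (d : nat -> nat) (i : nat) :
  pos_digits d -> (1 <= i)%nat -> 0 < cf_tail d i.
Proof.
  intros hd hi. rewrite cf_tail_step; auto. apply Rinv_0_lt_compat.
  assert (hr := cf_tail_range d (S i) hd ltac:(lia)).
  assert (hp := pos_digits_INR d i hd hi). lra.
Qed.

Lemma cf_tail_lt_1 (d : nat -> nat) (i : nat) :
  pos_digits d -> (1 <= i)%nat -> cf_tail d i < 1.
Proof.
  intros hd hi. rewrite cf_tail_step; auto. rewrite <- Rinv_1.
  assert (hr := cf_tail_pos d (S i) hd ltac:(lia)).
  assert (hp := pos_digits_INR d i hd hi). apply Rinv_lt_contravar; lra.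
Qed.

Lemma cf_tail_ext (d e : nat -> nat) (i j : nat) :
  (forall s, d (i + s)%nat = e (j + s)%nat) -> cf_tail d i = cf_tail e j.
Proof.
  intros H. unfold cf_tail. f_equal. apply Lim_seq_ext. intros n. revert i j H.
  induction n as [|n IH]; intros i j H; simpl; [reflexivity|].
  rewrite (IH (S i) (S j)).
  - assert (h := H 0%nat). rewrite !Nat.add_0_r in h. rewrite h. reflexivity.
  - intros s. assert (h := H (S s)). rewrite <- !Nat.add_succ_comm in h. exact h.
Qed.

Lemma cf_q_rec (d : nat -> nat) (n : nat) :
  INR (cf_q d (S (S n))) = INR (d (S n)) * INR (cf_q d (S n)) + INR (cf_q d n).
Proof.
  change (cf_q d (S (S n))) with (d (S n) * cf_q d (S n) + cf_q d n)%nat.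
  rewrite plus_INR, mult_INR. reflexivity.
Qed.

Lemma cf_p_rec (d : nat -> nat) (n : nat) :
  INR (cf_p d (S (S n))) = INR (d (S n)) * INR (cf_p d (S n)) + INR (cf_p d n).
Proof.
  change (cf_p d (S (S n))) with (d (S n) * cf_p d (S n) + cf_p d n)%nat.
  rewrite plus_INR, mult_INR. reflexivity.
Qed.

Lemma cf_q_pos (d : nat -> nat) (n : nat) :
  pos_digits d -> (1 <= n)%nat -> (1 <= cf_q d n)%nat.
Proof.
  intros hd. induction n as [n IH] using (well_founded_induction lt_wf).
  intros hn. destruct n as [|[|n]]; [lia|simpl; lia|].
  change (cf_q d (S (S n))) with (d (S n) * cf_q d (S n) + cf_q d n)%nat.
  assert (h := IH (S n) ltac:(lia) ltac:(lia)).
  assert (h2 := hd (S n) ltac:(lia)). nia.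
Qed.

Lemma cf_q_le_S (d : nat -> nat) (n : nat) :
  pos_digits d -> (cf_q d n <= cf_q d (S n))%nat.
Proof.
  intros hd. destruct n as [|n]; [simpl; lia|].
  change (cf_q d (S (S n))) with (d (S n) * cf_q d (S n) + cf_q d n)%nat.
  assert (h2 := hd (S n) ltac:(lia)). nia.
Qed.

(** Only the divergence of q_n is wanted, so a linear bound is enough. The slack of 1 is forced by
    q_2 = 1 when d_1 = 1. *)
Lemma cf_q_ge (d : nat -> nat) (n : nat) :
  pos_digits d -> (n <= S (cf_q d n))%nat.
Proof.
  intros hd. induction n as [n IH] using (well_founded_induction lt_wf).
  destruct n as [|[|[|n]]]; [lia|lia|assert (h := cf_q_pos d 2 hd); lia|].
  change (cf_q d (S (S (S n)))) with (d (S (S n)) * cf_q d (S (S n)) + cf_q d (S n))%nat.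
  assert (h := IH (S (S n)) ltac:(lia)).
  assert (h2 := hd (S (S n)) ltac:(lia)).
  assert (h3 := cf_q_pos d (S n) hd ltac:(lia)). nia.
Qed.

(* [cf_delta d n] is |q_n beta - p_n|, see [cf_approx]. *)
Fixpoint cf_delta (d : nat -> nat) (n : nat) : R :=
  match n with
  | O => 1
  | S n' => cf_delta d n' * cf_tail d n
  end.

Lemma cf_delta_pos (d : nat -> nat) (n : nat) :
  pos_digits d -> 0 < cf_delta d n.
Proof.
  intros hd. induction n as [|n IH]; simpl; [lra|].
  apply Rmult_lt_0_compat; [exact IH|apply cf_tail_pos; [exact hd|lia]].
Qed.

Lemma cf_delta_rec (d : nat -> nat) (n : nat) :
  pos_digits d ->
  cf_delta d (S (S n)) = cf_delta d n - INR (d (S n)) * cf_delta d (S n).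
Proof.
  intros hd.
  change (cf_delta d (S (S n))) with (cf_delta d n * cf_tail d (S n) * cf_tail d (S (S n))).
  change (cf_delta d (S n)) with (cf_delta d n * cf_tail d (S n)).
  rewrite (cf_tail_step d (S n) hd ltac:(lia)).
  assert (hr := cf_tail_pos d (S (S n)) hd ltac:(lia)).
  assert (hp := pos_digits_INR d (S n) hd ltac:(lia)). field. lra.
Qed.

(** Both sides obey the same three-term recurrence. The sign is the one that multiplies eps in
    [sudler]; for this reason every later formula depends on C_n + eps and not on the parity of
    n. *)
Lemma cf_approx (d : nat -> nat) (n : nat) :
  pos_digits d ->
  INR (cf_q d n) * cf d - INR (cf_p d n) = (-1) ^ (n + 1) * cf_delta d n.
Proof.
  intros hd.
  induction n as [n IH] using (well_founded_induction lt_wf).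
  destruct n as [|[|n]].
  - simpl. ring.
  - change (cf d) with (cf_tail d 1). simpl. ring.
  - rewrite cf_q_rec, cf_p_rec, cf_delta_rec; auto.
    assert (h1 := IH (S n) ltac:(lia)). assert (h0 := IH n ltac:(lia)).
    replace ((-1) ^ (S (S n) + 1)) with ((-1) ^ (n + 1)) by (simpl; ring).
    replace ((-1) ^ (S n + 1)) with (- (-1) ^ (n + 1)) in h1 by (simpl; ring).
    replace (INR (d (S n)) * INR (cf_q d (S n)) + INR (cf_q d n)) with
      (INR (cf_q d n) + INR (d (S n)) * INR (cf_q d (S n))) by ring.
    transitivity ((INR (cf_q d n) * cf d - INR (cf_p d n)) +
       INR (d (S n)) * (INR (cf_q d (S n)) * cf d - INR (cf_p d (S n)))); [ring|].
    rewrite h1, h0. ring.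
Qed.

Lemma cf_q_delta (d : nat -> nat) (n : nat) :
  pos_digits d ->
  INR (cf_q d (S n)) * cf_delta d n + INR (cf_q d n) * cf_delta d (S n) = 1.
Proof.
  intros hd. induction n as [|n IH].
  - simpl. ring.
  - rewrite cf_q_rec, cf_delta_rec; auto. rewrite <- IH. ring.
Qed.

Lemma cf_wronskian (d : nat -> nat) (n : nat) :
  INR (cf_q d (S n)) * INR (cf_p d n) - INR (cf_q d n) * INR (cf_p d (S n)) = (-1) ^ n.
Proof.
  induction n as [|n IH].
  - simpl. ring.
  - rewrite cf_q_rec, cf_p_rec.
    replace ((-1) ^ (S n)) with (- (-1) ^ n) by (simpl; ring). rewrite <- IH. ring.
Qed.

Lemma cf_delta_le (d : nat -> nat) (n : nat) :
  pos_digits d -> INR (cf_q d (S n)) * cf_delta d n <= 1.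
Proof.
  intros hd. rewrite <- (cf_q_delta d n hd).
  assert (h := pos_INR (cf_q d n)). assert (h2 := cf_delta_pos d (S n) hd). nra.
Qed.

Lemma cf_delta_small (d : nat -> nat) (M : R) :
  pos_digits d -> exists n, M * cf_delta d n < 1.
Proof.
  intros hd. destruct (INR_unbounded M) as [n hn].
  exists n. assert (h := cf_q_ge d (S n) hd).
  assert (h1 := cf_delta_le d n hd). assert (h2 := cf_delta_pos d n hd).
  assert (h3 : INR n <= INR (cf_q d (S n))) by (apply le_INR; lia). nra.
Qed.

(** If i beta + j = 0, then the integer q_n j + p_n i has absolute value |i| delta_n, which is below
    1 for large n. So it is 0, and i = 0 because delta_n > 0. *)
Lemma cf_irrational (d : nat -> nat) (i j : Z) :
  pos_digits d -> IZR i * cf d + IZR j = 0 -> i = 0%Z.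
Proof.
  intros hd H.
  destruct (cf_delta_small d (Rabs (IZR i)) hd) as [n hn].
  assert (h1 := cf_approx d n hd). assert (hp := cf_delta_pos d n hd).
  set (w := (Z.of_nat (cf_q d n) * j + Z.of_nat (cf_p d n) * i)%Z).
  assert (hw : IZR w = - IZR i * ((-1) ^ (n + 1) * cf_delta d n)).
  { rewrite <- h1. unfold w. rewrite plus_IZR, !mult_IZR, <- !INR_IZR_INZ.
    replace (IZR j) with (- (IZR i * cf d)) by lra. ring. }
  assert (habs : Rabs (IZR w) = Rabs (IZR i) * cf_delta d n).
  { rewrite hw, !Rabs_mult, pow_1_abs, Rabs_Ropp, (Rabs_pos_eq (cf_delta d n)); lra. }
  assert (w0 : w = 0%Z).
  { rewrite <- habs, <- abs_IZR in hn. apply lt_IZR in hn. lia. }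
  rewrite w0, Rabs_R0 in habs. symmetry in habs.
  apply Rmult_integral in habs. destruct habs as [h|h]; [|lra].
  rewrite <- abs_IZR in h. apply eq_IZR in h. lia.
Qed.

(** Two orbits driven by the same digits merge whatever their starting values. This is used to
    compare q_(n-1)/q_n with the reversed periodic continued fraction. *)
Lemma inv_orbit_contract (d : nat -> nat) (r s : nat -> R) (n0 : nat) :
  (forall n, (n0 <= n)%nat -> (1 <= d n)%nat) ->
  (forall n, (n0 <= n)%nat -> 0 <= r n /\ 0 <= s n) ->
  (forall n, (n0 <= n)%nat ->
     r (S n) = / (INR (d n) + r n) /\ s (S n) = / (INR (d n) + s n)) ->
  is_lim_seq (fun n => r n - s n) 0.
Proof.
  intros hd hrs hstep.
  apply (is_lim_seq_incr_n _ n0).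
  set (B := Rabs (r n0 - s n0) + 2 * Rabs (r (S n0) - s (S n0))).
  assert (hB0 : 0 <= Rabs (r n0 - s n0)) by apply Rabs_pos.
  assert (hB1 : 0 <= Rabs (r (S n0) - s (S n0))) by apply Rabs_pos.
  assert (H : forall n, Rabs (r (n + n0)%nat - s (n + n0)%nat) <= B * (1 / 2) ^ n /\
                        Rabs (r (S n + n0)%nat - s (S n + n0)%nat) <= B * (1 / 2) ^ (S n)).
  { induction n as [|n [IH1 IH2]].
    - simpl. unfold B. split; lra.
    - split; [exact IH2|].
      change (S (S n) + n0)%nat with (S (S (n + n0))).
      destruct (hstep (S (n + n0)) ltac:(lia)) as [e1 e2].
      destruct (hstep (n + n0)%nat ltac:(lia)) as [e3 e4].
      rewrite e1, e2, e3, e4.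
      destruct (hrs (n + n0)%nat ltac:(lia)).
      eapply Rle_trans.
      + apply inv_step_contract; auto; apply (le_INR 1); apply hd; lia.
      + simpl. lra. }
  apply is_lim_seq_abs_0.
  apply (is_lim_seq_le_le (fun _ => 0) _ (fun n => B * (1 / 2) ^ n)).
  - intros n. split; [apply Rabs_pos|apply H].
  - apply is_lim_seq_const.
  - evar_last.
    + apply is_lim_seq_scal_l. apply is_lim_seq_geom. rewrite Rabs_pos_eq; lra.
    + simpl. f_equal. ring.
Qed.

(** * Periodic digit sequences *)

Lemma cf_q_ext (d e : nat -> nat) (n : nat) :
  (forall i, (1 <= i)%nat -> d i = e i) -> cf_q d n = cf_q e n.
Proof.
  intros H. induction n as [n IH] using (well_founded_induction lt_wf).
  destruct n as [|[|n]]; [reflexivity|reflexivity|].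
  change (d (S n) * cf_q d (S n) + cf_q d n = e (S n) * cf_q e (S n) + cf_q e n)%nat.
  rewrite (IH (S n)), (IH n), H; lia.
Qed.

Lemma cf_p_ext (d e : nat -> nat) (n : nat) :
  (forall i, (1 <= i)%nat -> d i = e i) -> cf_p d n = cf_p e n.
Proof.
  intros H. induction n as [n IH] using (well_founded_induction lt_wf).
  destruct n as [|[|n]]; [reflexivity|reflexivity|].
  change (d (S n) * cf_p d (S n) + cf_p d n = e (S n) * cf_p e (S n) + cf_p e n)%nat.
  rewrite (IH (S n)), (IH n), H; lia.
Qed.

Lemma cf_solution (d : nat -> nat) (x : nat -> R) :
  (forall n, x (S (S n)) = INR (d (S n)) * x (S n) + x n) ->
  forall n, x n = INR (cf_q d n) * x 1%nat + INR (cf_p d n) * x 0%nat.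
Proof.
  intros H n. induction n as [n IH] using (well_founded_induction lt_wf).
  destruct n as [|[|n]]; [simpl; ring|simpl; ring|].
  rewrite H, cf_q_rec, cf_p_rec, (IH (S n)), (IH n) by lia. ring.
Qed.

(* Cayley-Hamilton for the transfer matrix of one period: its trace is
   q_(l+1) + p_l and its determinant is (-1)^l. *)
Lemma cf_solution_cayley (d : nat -> nat) (l : nat) (x : nat -> R) :
  (forall i, (1 <= i)%nat -> d (i + l)%nat = d i) ->
  (forall n, x (S (S n)) = INR (d (S n)) * x (S n) + x n) ->
  forall n, x (n + 2 * l)%nat =
    INR (cf_q d (l + 1) + cf_p d l) * x (n + l)%nat - (-1) ^ l * x n.
Proof.
  intros hper H.
  assert (Hl : forall n, x (n + l)%nat =
    INR (cf_q d n) * x (S l) + INR (cf_p d n) * x l).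
  { intros n.
    apply (cf_solution d (fun n => x (n + l)%nat)). intros m.
    simpl. rewrite H. f_equal. f_equal. f_equal.
    change (S (m + l)) with (S m + l)%nat. rewrite hper; [reflexivity|lia]. }
  assert (H0 := cf_solution d x H).
  assert (W := cf_wronskian d l).
  (* The defect y of the claimed identity solves the same periodic recurrence, so it vanishes once
     it vanishes at 0 and 1; there the Wronskian supplies the determinant (-1)^l. *)
  set (y := fun n => x (n + 2 * l)%nat - INR (cf_q d (l + 1) + cf_p d l) * x (n + l)%nat
                     + (-1) ^ l * x n).
  assert (y0 : y 0%nat = 0).
  { unfold y. replace (0 + 2 * l)%nat with (l + l)%nat by lia.
    rewrite (Hl l), plus_INR, <- W. simpl (0 + l)%nat. rewrite Nat.add_1_r.
    rewrite (H0 l), (H0 (S l)). ring. }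
  assert (y1 : y 1%nat = 0).
  { unfold y. replace (1 + 2 * l)%nat with (S l + l)%nat by lia.
    rewrite (Hl (S l)), plus_INR, <- W. change (1 + l)%nat with (S l).
    rewrite Nat.add_1_r. rewrite (H0 l), (H0 (S l)). ring. }
  intros n. assert (hy : y n = 0).
  { rewrite (cf_solution d y); [rewrite y0, y1; ring|].
    intros m. unfold y. simpl (S (S m) + _)%nat. simpl (S m + _)%nat.
    rewrite !H.
    assert (e1 : d (S (m + 2 * l)) = d (S m)).
    { replace (S (m + 2 * l)) with (S (m + l) + l)%nat by lia.
      rewrite hper by lia. change (S (m + l)) with (S m + l)%nat. apply hper; lia. }
    assert (e2 : d (S (m + l)) = d (S m)).
    { change (S (m + l)) with (S m + l)%nat. apply hper; lia. }
    simpl (2 * l)%nat in *. rewrite e1, e2. ring. }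
  unfold y in hy. lra.
Qed.

Definition periodic_from (d : nat -> nat) (h l : nat) : Prop :=
  pos_digits d /\ (1 <= l)%nat /\ forall i, (h < i)%nat -> d (i + l)%nat = d i.

(** This is the expanding eigenvalue a, read off from the decay of delta over one period. The form
    avoids square roots; [ev_digits_cst_a] matches it with the closed formula. *)
Definition period_growth (d : nat -> nat) (h l : nat) : R :=
  cf_delta d h / cf_delta d (h + l).

Lemma cf_tail_periodic (d : nat -> nat) (h l i : nat) :
  periodic_from d h l -> (h < i)%nat -> cf_tail d (i + l) = cf_tail d i.
Proof.
  intros (hd & hl & hper) hi. apply cf_tail_ext. intros s.
  replace (i + l + s)%nat with (i + s + l)%nat by lia. apply hper. lia.
Qed.

Lemma cf_delta_periodic (d : nat -> nat) (h l n : nat) :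
  periodic_from d h l -> (h <= n)%nat ->
  cf_delta d n = period_growth d h l * cf_delta d (n + l).
Proof.
  intros hp hn. assert (hd := proj1 hp). unfold period_growth.
  assert (h1 := cf_delta_pos d (h + l) hd).
  induction hn as [|n hn IH]; [field; lra|].
  simpl. rewrite IH. change (S (n + l)) with (S n + l)%nat.
  rewrite (cf_tail_periodic d h l); auto; [ring|lia].
Qed.

Lemma cf_delta_lt (d : nat -> nat) (n k : nat) :
  pos_digits d -> (1 <= k)%nat -> cf_delta d (n + k) < cf_delta d n.
Proof.
  intros hd hk. induction hk as [|k hk IH].
  - rewrite Nat.add_1_r. simpl. assert (h := cf_tail_lt_1 d (S n) hd ltac:(lia)).
    assert (h1 := cf_delta_pos d n hd). nra.
  - rewrite Nat.add_succ_r. simpl. assert (h := cf_tail_lt_1 d (S (n + k)) hd ltac:(lia)).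
    assert (h1 := cf_delta_pos d (n + k) hd). nra.
Qed.

Lemma period_growth_gt_1 (d : nat -> nat) (h l : nat) :
  periodic_from d h l -> 1 < period_growth d h l.
Proof.
  intros (hd & hl & _). unfold period_growth.
  assert (h1 := cf_delta_pos d (h + l) hd). assert (h2 := cf_delta_lt d h l hd hl).
  apply Rmult_lt_reg_r with (1 := h1). field_simplify; lra.
Qed.

Lemma periodic_from_shift (d : nat -> nat) (h l : nat) :
  periodic_from d h l ->
  forall i, (1 <= i)%nat -> d (h + (i + l))%nat = d (h + i)%nat.
Proof.
  intros (_ & _ & H) i hi. rewrite Nat.add_assoc. apply H. lia.
Qed.

Lemma pow_sqr_1 (n : nat) : (-1) ^ n * (-1) ^ n = 1.
Proof.
  rewrite <- Rpow_mult_distr. replace (-1 * -1) with 1 by ring. apply pow1.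
Qed.

(** The sequence (-1)^n delta_n satisfies the recurrence of the denominators and is geometric over
    periods, so Cayley-Hamilton applied to it is the characteristic equation for its ratio. *)
Lemma period_growth_root (d : nat -> nat) (h l : nat) :
  periodic_from d h l ->
  INR (cf_q (fun i => d (h + i)%nat) (l + 1) + cf_p (fun i => d (h + i)%nat) l)
  = period_growth d h l + (-1) ^ l / period_growth d h l.
Proof.
  intros hp. assert (hd := proj1 hp).
  assert (H := cf_solution_cayley (fun i => d (h + i)%nat) l
    (fun n => (-1) ^ n * cf_delta d (h + n)) (periodic_from_shift d h l hp)).
  assert (Hrec : forall n, (-1) ^ S (S n) * cf_delta d (h + S (S n)) =
     INR (d (h + S n)%nat) * ((-1) ^ S n * cf_delta d (h + S n)) + (-1) ^ n * cf_delta d (h + n)).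
  { intros n. rewrite !Nat.add_succ_r. rewrite cf_delta_rec; auto. simpl. ring. }
  specialize (H Hrec 0%nat). cbv beta in H. rewrite !Nat.add_0_l in H.
  assert (hA := period_growth_gt_1 d h l hp).
  set (A := period_growth d h l) in *.
  set (c := INR _) in *. clearbody c.
  assert (h1 := cf_delta_periodic d h l (h + l) hp ltac:(lia)).
  assert (h0 := cf_delta_periodic d h l h hp ltac:(lia)). fold A in h0, h1.
  rewrite Nat.add_0_r in H.
  replace (h + 2 * l)%nat with (h + l + l)%nat in H by lia.
  rewrite h0, h1 in H. assert (hpos := cf_delta_pos d (h + l + l) hd).
  set (D := cf_delta d (h + l + l)) in *.
  replace ((-1) ^ (2 * l)) with 1 in H
    by (replace (2 * l)%nat with (l + l)%nat by lia; rewrite pow_add, pow_sqr_1; ring).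
  assert (hs := pow_sqr_1 l). set (s := (-1) ^ l) in *.
  assert (H2 : 1 = c * s * A - s * A * A).
  { apply Rmult_eq_reg_r with D; [|lra]. rewrite <- (Rmult_1_l D) in H at 1. simpl in H. lra. }
  assert (H3 : s = c * A - A * A).
  { transitivity (s * (c * s * A - s * A * A)); [rewrite <- H2; ring|].
    transitivity (s * s * (c * A - A * A)); [ring|rewrite hs; ring]. }
  rewrite H3. field. lra.
Qed.

Lemma periodic_solution (d : nat -> nat) (h l : nat) (x : nat -> R) :
  periodic_from d h l ->
  (forall n, (h <= n)%nat -> x (S (S n)) = INR (d (S n)) * x (S n) + x n) ->
  forall n, (h <= n)%nat ->
  x (n + 2 * l)%nat =
    (period_growth d h l + (-1) ^ l / period_growth d h l) * x (n + l)%nat - (-1) ^ l * x n.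
Proof.
  intros hp H n hn. rewrite <- period_growth_root; auto.
  assert (H1 := cf_solution_cayley (fun i => d (h + i)%nat) l
    (fun n => x (h + n)%nat) (periodic_from_shift d h l hp)).
  assert (Hrec : forall n, x (h + S (S n))%nat =
     INR (d (h + S n)%nat) * x (h + S n)%nat + x (h + n)%nat).
  { intros m. rewrite !Nat.add_succ_r. apply H. lia. }
  specialize (H1 Hrec (n - h)%nat). simpl in H1.
  replace (h + (n - h + (l + (l + 0))))%nat with (n + 2 * l)%nat in H1 by lia.
  replace (h + (n - h + l))%nat with (n + l)%nat in H1 by lia.
  replace (h + (n - h))%nat with n in H1 by lia. exact H1.
Qed.

Lemma cf_q_periodic (d : nat -> nat) (h l n : nat) :
  periodic_from d h l -> (h <= n)%nat ->
  INR (cf_q d (n + 2 * l)) =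
    (period_growth d h l + (-1) ^ l / period_growth d h l) * INR (cf_q d (n + l))
    - (-1) ^ l * INR (cf_q d n).
Proof.
  intros hp hn. apply (periodic_solution d h l (fun n => INR (cf_q d n)) hp); auto.
  intros m _. apply cf_q_rec.
Qed.

(** Subtracting b q_n removes the contracting eigenvector: what is left is multiplied by a over one
    period, while delta is divided by a. *)
Lemma cf_q_geometric_defect (d : nat -> nat) (h l n : nat) :
  periodic_from d h l -> (h <= n)%nat ->
  let A := period_growth d h l in
  let b := (-1) ^ l / A in
  (INR (cf_q d (n + l + l)) - b * INR (cf_q d (n + l))) * cf_delta d (n + l) =
  (INR (cf_q d (n + l)) - b * INR (cf_q d n)) * cf_delta d n.
Proof.
  intros hp hn A b. assert (h1 := cf_q_periodic d h l n hp hn).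
  replace (n + 2 * l)%nat with (n + l + l)%nat in h1 by lia.
  rewrite h1, (cf_delta_periodic d h l n hp hn). fold A. fold b.
  assert (hA := period_growth_gt_1 d h l hp). fold A in hA.
  assert (hb : (-1) ^ l = A * b) by (unfold b; field; lra).
  rewrite hb. ring.
Qed.

(** An abstract form of [digits pre per]. It also covers shifts of the purely periodic sequence,
    with the same list [per] and another offset, so the constants attached to [per] can be computed
    from any of them. *)
Definition ev_digits (d : nat -> nat) (h : nat) (per : list nat) : Prop :=
  pos_digits d /\ (1 <= length per)%nat /\
  forall i, (1 <= i)%nat -> d (h + i)%nat = nth ((i - 1) mod length per) per 0%nat.

Lemma digits_pure (per : list nat) (i : nat) :
  (1 <= i)%nat -> digits [] per i = nth ((i - 1) mod length per) per 0%nat.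
Proof.
  intros hi. unfold digits. destruct i as [|i]; [lia|]. simpl. rewrite Nat.sub_0_r. reflexivity.
Qed.

Lemma ev_digits_periodic (d : nat -> nat) (h : nat) (per : list nat) :
  ev_digits d h per -> periodic_from d h (length per).
Proof.
  intros (hd & hl & H). split; [exact hd|split; [exact hl|]]. intros i hi.
  replace (i + length per)%nat with (h + (i - h + length per))%nat by lia.
  rewrite H by lia. replace i with (h + (i - h))%nat at 2 by lia. rewrite H by lia.
  f_equal. replace (i - h + length per - 1)%nat with (i - h - 1 + 1 * length per)%nat by lia.
  apply Nat.Div0.mod_add.
Qed.

Lemma ev_digits_pure (d : nat -> nat) (h : nat) (per : list nat) :
  ev_digits d h per -> ev_digits (digits [] per) 0 per.
Proof.
  intros (hd & hl & H). split; [|split; [exact hl|]].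
  - intros i hi. rewrite digits_pure, <- H by auto. apply hd. lia.
  - intros i hi. apply digits_pure. exact hi.
Qed.

Lemma ev_digits_root (d : nat -> nat) (h : nat) (per : list nat) :
  ev_digits d h per ->
  INR (cst_c per) = period_growth d h (length per)
                    + (-1) ^ length per / period_growth d h (length per).
Proof.
  intros hev. rewrite <- period_growth_root by (apply ev_digits_periodic; exact hev).
  unfold cst_c. f_equal. destruct hev as (hd & hl & H).
  rewrite (cf_q_ext (digits [] per) (fun i => d (h + i)%nat)).
  - rewrite (cf_p_ext (digits [] per) (fun i => d (h + i)%nat)); [reflexivity|].
    intros i hi. rewrite digits_pure, H; auto.
  - intros i hi. rewrite digits_pure, H; auto.
Qed.

Lemma ev_digits_cst_a (d : nat -> nat) (h : nat) (per : list nat) :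
  ev_digits d h per -> cst_a per = period_growth d h (length per).
Proof.
  intros hev. assert (hc := ev_digits_root d h per hev).
  assert (hA := period_growth_gt_1 d h _ (ev_digits_periodic d h per hev)).
  unfold cst_a, cst_disc. set (A := period_growth d h (length per)) in *.
  replace ((-1) ^ (length per - 1)) with (- (-1) ^ length per).
  - rewrite hc. assert (hs := pow_sqr_1 (length per)). set (s := (-1) ^ length per) in *.
    (* The roots A and s / A have product s, hence the discriminant is the square of their
       difference; A exceeds s / A, so the square root selects A. *)
    replace ((A + s / A) ^ 2 + 4 * - s) with ((A - s / A) ^ 2) by (field; lra).
    rewrite sqrt_pow2; [field; lra|].
    assert (s <= 1) by nra. assert (s / A < A); [|lra].
    apply Rmult_lt_reg_r with A; [lra|]. field_simplify; nra.
  - destruct hev as (_ & hl & _). destruct (length per) as [|l]; [lia|].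
    simpl. rewrite Nat.sub_0_r. ring.
Qed.

Lemma ev_digits_cst_b (d : nat -> nat) (h : nat) (per : list nat) :
  ev_digits d h per -> cst_b per = (-1) ^ length per / period_growth d h (length per).
Proof.
  intros hev. assert (hc := ev_digits_root d h per hev).
  assert (ha := ev_digits_cst_a d h per hev).
  assert (cst_a per + cst_b per = INR (cst_c per)) by (unfold cst_a, cst_b; field).
  lra.
Qed.

Lemma cst_a_gt_1 (d : nat -> nat) (h : nat) (per : list nat) :
  ev_digits d h per -> 1 < cst_a per.
Proof.
  intros hev. rewrite (ev_digits_cst_a d h per hev).
  apply period_growth_gt_1, ev_digits_periodic, hev.
Qed.

Lemma cst_b_eq (d : nat -> nat) (h : nat) (per : list nat) :
  ev_digits d h per -> cst_b per = (-1) ^ length per / cst_a per.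
Proof.
  intros hev. rewrite (ev_digits_cst_a d h per hev). apply ev_digits_cst_b, hev.
Qed.

Lemma cst_c_eq (d : nat -> nat) (h : nat) (per : list nat) :
  ev_digits d h per -> INR (cst_c per) = cst_a per + (-1) ^ length per / cst_a per.
Proof.
  intros hev. rewrite (ev_digits_cst_a d h per hev). apply ev_digits_root, hev.
Qed.

(** * The limits of q_n |q_n beta - p_n| *)

(* The k-th reversed digit sequence a_(k-1), a_(k-2), ..., with indices modulo
   l; adding (l - 1) i plays the role of subtracting i. *)
Definition rev_digits (per : list nat) (k i : nat) : nat :=
  nth ((k - 1 + (length per - 1) * i) mod length per) per 0%nat.

Definition rev_tail (per : list nat) (k : nat) : R := cf (rev_digits per k).

Definition fwd_tail (per : list nat) (k : nat) : R := cf_tail (digits [] per) k.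

Lemma ev_digits_nth_pos (d : nat -> nat) (h : nat) (per : list nat) (j : nat) :
  ev_digits d h per -> (1 <= nth (j mod length per) per 0)%nat.
Proof.
  intros (hd & hl & H). replace j with (j + 1 - 1)%nat by lia.
  rewrite <- (H (j + 1)%nat) by lia. apply hd. lia.
Qed.

Lemma rev_digits_pos (d : nat -> nat) (h : nat) (per : list nat) (k : nat) :
  ev_digits d h per -> pos_digits (rev_digits per k).
Proof.
  intros hev i hi. apply (ev_digits_nth_pos d h per _ hev).
Qed.

(** The list form of sigma_k makes sense for 1 <= k <= l only. The modular form has a value for
    every k, which is what lets [rev_tail_step] run along all n. *)
Lemma alpha_sigma_eq (per : list nat) (k : nat) :
  (1 <= k <= length per)%nat -> alpha_sigma per k = rev_tail per k.
Proof.
  intros hk. unfold alpha_sigma, rev_tail. change cf with (fun d => cf_tail d 1). cbv beta.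
  apply cf_tail_ext. intros s. unfold rev_digits.
  rewrite digits_pure by lia. rewrite <- rev_app_distr.
  set (X := skipn (k - 1) per ++ firstn (k - 1) per).
  set (l := length per) in *.
  assert (hX : length X = l).
  { unfold X. rewrite length_app, length_skipn, length_firstn. fold l. lia. }
  rewrite length_rev, hX. replace (1 + s - 1)%nat with s by lia.
  assert (hm : (s mod l < l)%nat) by (apply Nat.mod_upper_bound; lia).
  rewrite rev_nth by (rewrite hX; exact hm). rewrite hX. unfold X.
  assert (hj : ((k - 1 + (l - 1) * (1 + s)) mod l = (k - 1 + (l - 1) * (1 + s mod l)) mod l)%nat).
  { rewrite (Nat.div_mod_eq s l) at 1.
    replace (k - 1 + (l - 1) * (1 + (l * (s / l) + s mod l)))%nat with
      (k - 1 + (l - 1) * (1 + s mod l) + ((l - 1) * (s / l)) * l)%nat by ring.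
    apply Nat.Div0.mod_add. }
  rewrite hj. set (j := (s mod l)%nat) in *.
  (* The first k - 1 digits are a_(k-1), ..., a_1; from there on the reversed rest a_l, ..., a_k is
     read. *)
  destruct (Nat.lt_ge_cases j (k - 1)) as [h1|h1].
  - rewrite app_nth2; rewrite length_skipn; fold l; [|lia].
    rewrite nth_firstn.
    replace (l - S j - (l - (k - 1)))%nat with (k - 1 - S j)%nat by lia.
    assert (hlt : (k - 1 - S j <? k - 1)%nat = true) by (apply Nat.ltb_lt; lia).
    rewrite hlt. f_equal.
    replace (k - 1 + (l - 1) * (1 + j))%nat with (k - 1 - S j + (S j) * l)%nat by nia.
    rewrite Nat.Div0.mod_add, Nat.mod_small; lia.
  - rewrite app_nth1 by (rewrite length_skipn; fold l; lia).
    rewrite nth_skipn. f_equal.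
    replace (k - 1 + (l - 1) * (1 + j))%nat with (k - 1 + (l - S j) + j * l)%nat by nia.
    rewrite Nat.Div0.mod_add, Nat.mod_small; lia.
Qed.

Lemma rev_tail_add_period (per : list nat) (k m : nat) :
  (1 <= k)%nat -> rev_tail per (k + m * length per) = rev_tail per k.
Proof.
  intros hk. unfold rev_tail. change cf with (fun d => cf_tail d 1). cbv beta.
  apply cf_tail_ext. intros s. unfold rev_digits.
  replace (k + m * length per - 1 + (length per - 1) * (1 + s))%nat with
    (k - 1 + (length per - 1) * (1 + s) + m * length per)%nat by lia.
  rewrite Nat.Div0.mod_add. reflexivity.
Qed.

Lemma rev_tail_step (d : nat -> nat) (h : nat) (per : list nat) (k : nat) :
  ev_digits d h per -> (1 <= k)%nat ->
  rev_tail per (S k) = / (INR (d (h + k)%nat) + rev_tail per k).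
Proof.
  intros hev hk. unfold rev_tail. change cf with (fun d => cf_tail d 1). cbv beta.
  rewrite cf_tail_step; [|apply (rev_digits_pos d h per _ hev)|lia].
  assert (hl := proj1 (proj2 hev)).
  do 2 f_equal.
  - f_equal. rewrite (proj2 (proj2 hev) k hk). unfold rev_digits. f_equal.
    replace (S k - 1 + (length per - 1) * 1)%nat with (k - 1 + 1 * length per)%nat by lia.
    apply Nat.Div0.mod_add.
  - apply cf_tail_ext. intros s. unfold rev_digits. f_equal.
    replace (S k - 1 + (length per - 1) * (2 + s))%nat with
      (k - 1 + (length per - 1) * (1 + s) + 1 * length per)%nat by nia.
    apply Nat.Div0.mod_add.
Qed.

Lemma rev_tail_range (d : nat -> nat) (h : nat) (per : list nat) (k : nat) :
  ev_digits d h per -> 0 < rev_tail per k < 1.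
Proof.
  intros hev. assert (hd := rev_digits_pos d h per k hev). split.
  - apply (cf_tail_pos _ 1 hd). lia.
  - apply (cf_tail_lt_1 _ 1 hd). lia.
Qed.

Lemma fwd_tail_eq (d : nat -> nat) (h : nat) (per : list nat) (k m : nat) :
  ev_digits d h per -> (1 <= k)%nat ->
  cf_tail d (h + m * length per + k) = fwd_tail per k.
Proof.
  intros (hd & hl & H) hk. apply cf_tail_ext. intros s.
  replace (h + m * length per + k + s)%nat with (h + (k + s + m * length per))%nat by lia.
  rewrite digits_pure, H by lia. f_equal.
  replace (k + s + m * length per - 1)%nat with (k + s - 1 + m * length per)%nat by lia.
  apply Nat.Div0.mod_add.
Qed.

Lemma fwd_tail_add_period (d : nat -> nat) (h : nat) (per : list nat) (k m : nat) :
  ev_digits d h per -> (1 <= k)%nat -> fwd_tail per (k + m * length per) = fwd_tail per k.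
Proof.
  intros hev hk. assert (h0 := ev_digits_pure d h per hev).
  rewrite <- (fwd_tail_eq _ _ _ k m h0 hk). simpl. unfold fwd_tail. f_equal. lia.
Qed.

Lemma fwd_tail_range (d : nat -> nat) (h : nat) (per : list nat) (k : nat) :
  ev_digits d h per -> (1 <= k)%nat -> 0 < fwd_tail per k < 1.
Proof.
  intros hev hk. assert (hd := proj1 (ev_digits_pure d h per hev)). split.
  - apply cf_tail_pos; assumption.
  - apply cf_tail_lt_1; assumption.
Qed.

Lemma filterlim_arith_progression (h l k : nat) :
  (1 <= l)%nat -> filterlim (fun m => (h + m * l + k)%nat) eventually eventually.
Proof.
  intros hl P [N hN]. exists N. intros n hn. apply hN. nia.
Qed.

(** The ratio q_(n-1)/q_n is the finite continued fraction of the digits read backwards from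
    d_(n-1). It follows the same recursion x -> 1/(d_n + x) as the reversed tails, and the
    contraction erases the influence of the pre-period. *)
Lemma cf_q_ratio_lim (d : nat -> nat) (h : nat) (per : list nat) (k : nat) :
  ev_digits d h per -> (1 <= k)%nat ->
  is_lim_seq (fun m => INR (cf_q d (h + m * length per + k - 1))
                       / INR (cf_q d (h + m * length per + k))) (rev_tail per k).
Proof.
  intros hev hk. assert (hd := proj1 hev). assert (hl := proj1 (proj2 hev)).
  assert (hc : is_lim_seq (fun n => INR (cf_q d (n - 1)) / INR (cf_q d n)
                                    - rev_tail per (n - h)) 0).
  { apply (inv_orbit_contract d _ _ (S h)).
    - intros n hn. apply hd. lia.
    - intros n hn. split.
      + apply Rmult_le_pos; [apply pos_INR|]. left. apply Rinv_0_lt_compat.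
        apply (lt_INR 0). apply cf_q_pos; [exact hd|lia].
      + left. apply (rev_tail_range d h per _ hev).
    - intros n hn. split.
      + destruct n as [|n]; [lia|]. replace (S (S n) - 1)%nat with (S n) by lia.
        replace (S n - 1)%nat with n by lia. rewrite cf_q_rec.
        assert (hq : 0 < INR (cf_q d (S n)))
          by (apply (lt_INR 0); apply cf_q_pos; [exact hd|lia]).
        assert (hq' := pos_INR (cf_q d n)).
        assert (hq'' := pos_digits_INR d (S n) hd ltac:(lia)).
        field. split; [lra|]. nra.
      + replace (S n - h)%nat with (S (n - h)) by lia.
        rewrite (rev_tail_step d h per _ hev) by lia.
        replace (h + (n - h))%nat with n by lia. reflexivity. }
  apply (is_lim_seq_subseq _ _ _ (filterlim_arith_progression h (length per) k hl)) in hc.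
  apply (is_lim_seq_plus' _ (fun _ => rev_tail per k) _ _) with (2 := is_lim_seq_const _) in hc.
  rewrite Rplus_0_l in hc.
  eapply is_lim_seq_ext; [|exact hc]. intros m. cbv beta.
  replace (h + m * length per + k - h)%nat with (k + m * length per)%nat by lia.
  rewrite rev_tail_add_period by exact hk. ring.
Qed.

Definition cf_C (d : nat -> nat) (n : nat) : R := INR (cf_q d n) * cf_delta d n.

(** Divide q_n delta_(n-1) + q_(n-1) delta_n = 1 by q_n delta_n and use delta_n = delta_(n-1) times
    the n-th tail. *)
Lemma cf_C_eq (d : nat -> nat) (n : nat) :
  pos_digits d -> (1 <= n)%nat ->
  cf_C d n = / (/ cf_tail d n + INR (cf_q d (n - 1)) / INR (cf_q d n)).
Proof.
  intros hd hn. destruct n as [|n]; [lia|]. replace (S n - 1)%nat with n by lia.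
  assert (h := cf_q_delta d n hd). unfold cf_C. simpl cf_delta in *.
  assert (ht := cf_tail_pos d (S n) hd hn).
  assert (hq : 0 < INR (cf_q d (S n)))
    by (apply (lt_INR 0); apply cf_q_pos; [exact hd|lia]).
  assert (hq' := pos_INR (cf_q d n)). assert (hD := cf_delta_pos d n hd).
  set (q := INR (cf_q d (S n))) in *. set (q' := INR (cf_q d n)) in *.
  set (T := cf_tail d (S n)) in *. set (D := cf_delta d n) in *.
  replace (/ T + q' / q) with ((q + q' * T) / (q * T)) by (field; lra).
  assert (q * D + q' * (D * T) = D * (q + q' * T)) by ring.
  assert (0 < q + q' * T) by nra.
  replace D with (/ (q + q' * T)); [field; repeat split; lra|].
  apply Rmult_eq_reg_r with (q + q' * T); [|lra]. rewrite Rinv_l; lra.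
Qed.

(** The upper bound keeps [cf_N d n t] within 1/2 of t, so that the sines stay positive; the lower
    bound keeps ln C_n bounded along the progression. *)
Lemma cf_C_range (d : nat -> nat) (n : nat) :
  pos_digits d -> (1 <= n)%nat -> cf_tail d n / 2 <= cf_C d n < 1.
Proof.
  intros hd hn. rewrite cf_C_eq; auto.
  assert (ht := cf_tail_pos d n hd hn). assert (ht1 := cf_tail_lt_1 d n hd hn).
  assert (hq : 0 < INR (cf_q d n))
    by (apply (lt_INR 0); apply cf_q_pos; [exact hd|lia]).
  assert (hq' := pos_INR (cf_q d (n - 1))).
  assert (hqq : INR (cf_q d (n - 1)) <= INR (cf_q d n)).
  { apply le_INR. destruct n as [|n]; [lia|]. replace (S n - 1)%nat with n by lia.
    apply cf_q_le_S. exact hd. }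
  set (r := INR (cf_q d (n - 1)) / INR (cf_q d n)).
  assert (hr : 0 <= r <= 1).
  { unfold r. split.
    - apply Rmult_le_pos; [lra|]. left. apply Rinv_0_lt_compat. lra.
    - apply Rmult_le_reg_r with (1 := hq). field_simplify; lra. }
  assert (hT : 1 < / cf_tail d n) by (rewrite <- Rinv_1; apply Rinv_lt_contravar; lra).
  split.
  - replace (cf_tail d n / 2) with (/ (/ cf_tail d n * 2)) by (field; lra).
    apply Rinv_le_contravar; lra.
  - rewrite <- Rinv_1. apply Rinv_lt_contravar; lra.
Qed.

(** The limit of C_n along n = h + m l + k. It is |e_k c_k| in the notation of the theorem, by
    [abs_ec_eq]. *)
Definition lim_C (per : list nat) (k : nat) : R := / (/ fwd_tail per k + rev_tail per k).

Lemma lim_C_range (d : nat -> nat) (h : nat) (per : list nat) (k : nat) :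
  ev_digits d h per -> (1 <= k)%nat -> 0 < lim_C per k < 1.
Proof.
  intros hev hk. unfold lim_C.
  assert (h1 := rev_tail_range d h per k hev). assert (h2 := fwd_tail_range d h per k hev hk).
  assert (hT : 1 < / fwd_tail per k) by (rewrite <- Rinv_1; apply Rinv_lt_contravar; lra).
  split; [apply Rinv_0_lt_compat; lra|].
  rewrite <- Rinv_1. apply Rinv_lt_contravar; lra.
Qed.

Lemma lim_C_add_period (d : nat -> nat) (h : nat) (per : list nat) (k m : nat) :
  ev_digits d h per -> (1 <= k)%nat -> lim_C per (k + m * length per) = lim_C per k.
Proof.
  intros hev hk. unfold lim_C.
  rewrite rev_tail_add_period, (fwd_tail_add_period d h); auto.
Qed.

Lemma cf_C_lim (d : nat -> nat) (h : nat) (per : list nat) (k : nat) :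
  ev_digits d h per -> (1 <= k)%nat ->
  is_lim_seq (fun m => cf_C d (h + m * length per + k)) (lim_C per k).
Proof.
  intros hev hk. assert (hr := cf_q_ratio_lim d h per k hev hk).
  assert (hs := rev_tail_range d h per k hev). assert (ht := fwd_tail_range d h per k hev hk).
  assert (hT := Rinv_0_lt_compat _ (proj1 ht)).
  apply is_lim_seq_ext with (fun m => / (/ fwd_tail per k +
     INR (cf_q d (h + m * length per + k - 1)) / INR (cf_q d (h + m * length per + k)))).
  - intros m. rewrite cf_C_eq; [|apply hev|lia]. rewrite (fwd_tail_eq d h per k m hev hk).
    reflexivity.
  - apply (is_lim_seq_inv _ (/ fwd_tail per k + rev_tail per k)).
    + apply is_lim_seq_plus'; [apply is_lim_seq_const|exact hr].
    + intros E. injection E. lra.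
Qed.

(** Two offsets are needed: h says where the block reads as [per], h0 where periodicity starts. A
    shift of the purely periodic sequence has h0 = 0 although its block is aligned with [per] only
    from a later h. *)
Lemma cf_delta_growth (d : nat -> nat) (h h0 n : nat) (per : list nat) :
  ev_digits d h per -> periodic_from d h0 (length per) -> (h0 <= n)%nat ->
  cf_delta d n = cst_a per * cf_delta d (n + length per).
Proof.
  intros hev hp hn. rewrite (ev_digits_cst_a d h per hev).
  assert (hp' := ev_digits_periodic d h per hev).
  rewrite (cf_delta_periodic d h0 _ n hp hn). f_equal.
  assert (h1 := cf_delta_periodic d h0 _ (h0 + h) hp ltac:(lia)).
  assert (h2 := cf_delta_periodic d h _ (h0 + h) hp' ltac:(lia)).
  assert (h3 := cf_delta_pos d (h0 + h + length per) (proj1 hev)).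
  rewrite h2 in h1. apply Rmult_eq_reg_r in h1; lra.
Qed.

Lemma period_growth_cst_a (d : nat -> nat) (h h0 : nat) (per : list nat) :
  ev_digits d h per -> periodic_from d h0 (length per) ->
  period_growth d h0 (length per) = cst_a per.
Proof.
  intros hev hp. unfold period_growth.
  rewrite (cf_delta_growth d h h0 h0 per hev hp (Nat.le_refl _)).
  assert (h3 := cf_delta_pos d (h0 + length per) (proj1 hev)). field. lra.
Qed.

(** The left side does not change under n -> n + l, so it equals its own limit along the
    progression. There q_(n+l) delta_n = a C_(n+l) and q_n delta_n = C_n, and both C's tend to
    [lim_C per k]. *)
Lemma geometric_defect_lim (d : nat -> nat) (h h0 n k : nat) (per : list nat) :
  ev_digits d h per -> periodic_from d h0 (length per) ->
  (h0 <= n)%nat -> (1 <= k)%nat -> (n + length per = h + k)%nat ->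
  (INR (cf_q d (n + length per)) - cst_b per * INR (cf_q d n)) * cf_delta d n
  = (cst_a per - cst_b per) * lim_C per k.
Proof.
  intros hev hp hn hk hnk. set (l := length per) in *.
  set (E := fun n => (INR (cf_q d (n + l)) - cst_b per * INR (cf_q d n)) * cf_delta d n).
  assert (hE : forall m, E (n + m * l)%nat = E n).
  { induction m as [|m IH]; [f_equal; lia|]. rewrite <- IH.
    replace (n + S m * l)%nat with (n + m * l + l)%nat by lia. unfold E.
    rewrite (cst_b_eq d h per hev), <- (period_growth_cst_a d h h0 per hev hp).
    apply (cf_q_geometric_defect d h0 l _ hp). lia. }
  assert (hlim : is_lim_seq (fun m => E (h + m * l + k)%nat)
                   ((cst_a per - cst_b per) * lim_C per k)).
  { apply is_lim_seq_ext with (fun m => cst_a per * cf_C d (h + S m * l + k)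
                                  - cst_b per * cf_C d (h + m * l + k)).
    - intros m. unfold E, cf_C.
      rewrite (cf_delta_growth d h h0 (h + m * l + k) per hev hp ltac:(lia)). fold l.
      replace (h + m * l + k + l)%nat with (h + S m * l + k)%nat by lia. ring.
    - replace ((cst_a per - cst_b per) * lim_C per k) with
        (cst_a per * lim_C per k - cst_b per * lim_C per k) by ring.
      apply is_lim_seq_minus'.
      + apply (is_lim_seq_scal_l _ (cst_a per) (lim_C per k)).
        apply (is_lim_seq_incr_1 (fun m => cf_C d (h + m * l + k))).
        apply cf_C_lim; assumption.
      + apply (is_lim_seq_scal_l _ (cst_b per) (lim_C per k)).
        apply cf_C_lim; assumption. }
  assert (hconst : is_lim_seq (fun m => E (h + m * l + k)%nat) (E n)).
  { apply is_lim_seq_ext with (fun _ => E n); [|apply is_lim_seq_const].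
    intros m. rewrite <- (hE (S m)). f_equal. lia. }
  apply is_lim_seq_unique in hlim. apply is_lim_seq_unique in hconst.
  rewrite hlim in hconst. injection hconst. intros h1. symmetry. exact h1.
Qed.

(** Both sides solve the same recurrence and agree at n = 0 and n = 1. The correction term explains
    the formula for e_k: |a q_k - q_(l+k)| = q_l delta_k, that is, |e_k| = delta_k. *)
Lemma cf_q_add_period (d : nat -> nat) (h : nat) (per : list nat) (n : nat) :
  ev_digits d h per -> periodic_from d 0 (length per) ->
  INR (cf_q d (n + length per)) =
    cst_a per * INR (cf_q d n) + (-1) ^ n * INR (cf_q d (length per)) * cf_delta d n.
Proof.
  intros hev hp. assert (hd := proj1 hp). set (l := length per) in *.
  assert (ha : cst_a per * cf_delta d l = 1).
  { assert (h1 := cf_delta_growth d h 0 0 per hev hp (Nat.le_refl _)). symmetry. exact h1. }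
  assert (h1 := cf_q_delta d l hd).
  assert (hT : cf_delta d (S l) = cf_delta d l * cf_tail d 1).
  { simpl. f_equal. apply (cf_tail_periodic d 0 l 1 hp). lia. }
  rewrite hT in h1.
  assert (h2 : cst_a per = INR (cf_q d (S l)) + INR (cf_q d l) * cf_tail d 1).
  { apply Rmult_eq_reg_r with (cf_delta d l); [|intros Z; rewrite Z in ha; lra].
    rewrite ha, <- h1. ring. }
  induction n as [n IH] using (well_founded_induction lt_wf).
  destruct n as [|[|n]].
  - simpl. ring.
  - rewrite h2. simpl. ring.
  - change (S (S n) + l)%nat with (S (S (n + l))). rewrite !cf_q_rec.
    change (S (n + l)) with (S n + l)%nat.
    rewrite (proj2 (proj2 hp) (S n) ltac:(lia)).
    rewrite (IH (S n)), (IH n) by lia. rewrite cf_delta_rec by exact hd.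
    simpl pow. ring.
Qed.

Lemma abs_ec_eq (d : nat -> nat) (h : nat) (per : list nat) (k : nat) :
  ev_digits d h per -> (1 <= k <= length per)%nat -> abs_ec per k = lim_C per k.
Proof.
  intros hev0 hk. assert (hev := ev_digits_pure d h per hev0).
  assert (hp := ev_digits_periodic _ _ _ hev). set (D := digits [] per) in *.
  assert (hd := proj1 hp).
  unfold abs_ec, coef_e, coef_c. set (l := length per) in *. set (j := (k mod l)%nat).
  unfold alpha_q. fold D.
  (* For k = l the residue j is 0, while tails are indexed from 1; hence the passage through j +
     l. *)
  assert (hjk : lim_C per (j + l) = lim_C per k).
  { destruct (Nat.eq_dec k l) as [e|e].
    - unfold j. rewrite e, Nat.Div0.mod_same. reflexivity.
    - unfold j. rewrite Nat.mod_small by lia. replace (k + l)%nat with (k + 1 * l)%nat by lia.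
      apply (lim_C_add_period _ _ _ _ _ hev). lia. }
  assert (hdef := geometric_defect_lim D 0 0 j (j + l) per hev hp ltac:(lia) ltac:(lia) eq_refl).
  fold l in hdef. rewrite hjk in hdef.
  assert (hab : 0 < cst_a per - cst_b per).
  { assert (ha := cst_a_gt_1 _ _ _ hev). rewrite (cst_b_eq _ _ _ hev). fold l.
    assert (hs := pow_sqr_1 l). set (s := (-1) ^ l) in *.
    assert (s <= 1) by nra. assert (s / cst_a per <= 1); [|lra].
    apply Rmult_le_reg_r with (cst_a per); [lra|]. field_simplify; lra. }
  assert (hC := lim_C_range _ _ _ k hev ltac:(lia)).
  assert (hq : 0 < INR (cf_q D l)) by (apply (lt_INR 0); apply cf_q_pos; [exact hd|lia]).
  assert (hj := cf_q_add_period D 0 per j hev hp). fold l in hj.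
  replace (l + j)%nat with (j + l)%nat by lia.
  assert (hdl := cf_delta_pos D j hd).
  assert (he : Rabs (cst_a per * INR (cf_q D j) - INR (cf_q D (j + l))) =
               INR (cf_q D l) * cf_delta D j).
  { rewrite hj. replace (cst_a per * INR (cf_q D j) - (cst_a per * INR (cf_q D j)
       + (-1) ^ j * INR (cf_q D l) * cf_delta D j)) with
      (- ((-1) ^ j * (INR (cf_q D l) * cf_delta D j))) by ring.
    rewrite Rabs_Ropp, Rabs_mult, pow_1_abs, Rmult_1_l. apply Rabs_pos_eq. nra. }
  rewrite he. rewrite !Rabs_mult.
  replace (Rabs (powerRZ (-1) (Z.of_nat j - 1))) with 1.
  - rewrite Rmult_1_l, <- Rabs_mult.
    replace (INR (cf_q D l) * cf_delta D j / INR (cf_q D l) *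
      ((INR (cf_q D (j + l)) - cst_b per * INR (cf_q D j)) / (cst_a per - cst_b per)))
      with ((INR (cf_q D (j + l)) - cst_b per * INR (cf_q D j)) * cf_delta D j
            / (cst_a per - cst_b per)) by (field; split; lra).
    rewrite hdef. replace ((cst_a per - cst_b per) * lim_C per k / (cst_a per - cst_b per))
      with (lim_C per k) by (field; lra).
    apply Rabs_pos_eq. lra.
  - symmetry. destruct (Z.of_nat j - 1)%Z; simpl.
    + apply Rabs_R1.
    + apply pow_1_abs.
    + rewrite Rabs_inv, pow_1_abs. apply Rinv_1.
Qed.

(* The two eigenvalues of the period matrix, written in the basis given by the
   quadratic irrational 1 / fwd_tail and its conjugate - rev_tail. *)
Lemma cst_a_b_basis (d : nat -> nat) (h : nat) (per : list nat) (k : nat) :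
  ev_digits d h per -> (1 <= k <= length per)%nat ->
  exists Q P : nat, (1 <= Q)%nat /\
    cst_a per = INR Q * / fwd_tail per k + INR P /\
    cst_b per = INR P - INR Q * rev_tail per k.
Proof.
  intros hev0 hk. assert (hev1 := ev_digits_pure d h per hev0).
  destruct (ev_digits_pure d h per hev0) as (hd & hl & H).
  set (D := digits [] per) in *. set (l := length per) in *.
  (* The shift is chosen so that the l-th tail of e is [0; a_k, a_(k+1), ...]. Then a =
     1/delta_l(e), and dividing the relation q_l delta_(l-1) + q_(l-1) delta_l = 1 by delta_l gives
     the coordinates Q = q_l and P = q_(l-1). *)
  set (e := fun i => D (k + i)%nat).
  assert (hpe : pos_digits e) by (intros i hi; apply hd; lia).
  assert (heve : ev_digits e (l - k) per).
  { split; [exact hpe|split; [exact hl|]]. intros i hi. unfold e.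
    replace (k + (l - k + i))%nat with (0 + (i + l))%nat by lia. rewrite H by lia.
    fold l. f_equal. replace (i + l - 1)%nat with (i - 1 + 1 * l)%nat by lia.
    apply Nat.Div0.mod_add. }
  assert (hper : periodic_from e 0 l).
  { split; [exact hpe|split; [exact hl|]]. intros i hi. unfold e.
    assert (hp := ev_digits_periodic _ _ _ hev1).
    replace (k + (i + l))%nat with (k + i + l)%nat by lia. apply hp. lia. }
  exists (cf_q e l), (cf_q e (l - 1)).
  assert (hT : cf_tail e l = fwd_tail per k).
  { unfold fwd_tail. fold D. rewrite <- (cf_tail_periodic D 0 l k); [|
      apply (ev_digits_periodic _ _ _ hev1)|lia].
    apply cf_tail_ext. intros s. unfold e. f_equal. lia. }
  assert (hTpos := fwd_tail_range _ _ _ k hev1 ltac:(lia)).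
  assert (ha : cst_a per * cf_delta e l = 1).
  { symmetry. exact (cf_delta_growth e (l - k) 0 0 per heve hper (Nat.le_refl _)). }
  assert (hA : cst_a per = INR (cf_q e l) * / fwd_tail per k + INR (cf_q e (l - 1))).
  { assert (h1 := cf_q_delta e (l - 1) hpe).
    replace (S (l - 1)) with l in h1 by lia.
    assert (h2 : cf_delta e l = cf_delta e (l - 1) * fwd_tail per k).
    { rewrite <- hT. destruct l as [|l']; [lia|].
      replace (S l' - 1)%nat with l' by lia. reflexivity. }
    rewrite h2 in ha, h1.
    apply Rmult_eq_reg_r with (cf_delta e (l - 1) * fwd_tail per k);
      [|intros Z; rewrite Z in ha; lra].
    rewrite ha, <- h1. field. lra. }
  split; [apply cf_q_pos; assumption|]. split; [exact hA|].
  (* At n = 0 the term b q_0 vanishes and delta_0 = 1, so this reads q_l = (a - b) / (1 / [fwd_tail]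
     + [rev_tail]), from which b follows. *)
  assert (hdef := geometric_defect_lim e (l - k) 0 0 k per heve hper (Nat.le_refl _)
                    ltac:(lia) ltac:(fold l; lia)).
  fold l in hdef. simpl in hdef. unfold lim_C in hdef.
  assert (hs := rev_tail_range _ _ _ k hev1).
  assert (hTi := Rinv_0_lt_compat _ (proj1 hTpos)).
  set (th := / fwd_tail per k) in *. set (sg := rev_tail per k) in *.
  assert (h2 : INR (cf_q e l) * (th + sg) = cst_a per - cst_b per).
  { replace (INR (cf_q e l)) with ((cst_a per - cst_b per) * / (th + sg)) by lra.
    field. lra. }
  lra.
Qed.

(** * Irrationality, and non-vanishing of the factors at the special points *)

Lemma rev_tail_irrational (d : nat -> nat) (h : nat) (per : list nat) (k : nat) (i j : Z) :
  ev_digits d h per -> IZR i * rev_tail per k + IZR j = 0 -> i = 0%Z.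
Proof.
  intros hev. apply cf_irrational. apply (rev_digits_pos d h per k hev).
Qed.

Lemma fwd_tail_irrational (d : nat -> nat) (h : nat) (per : list nat) (k : nat) (i j : Z) :
  ev_digits d h per -> (1 <= k)%nat -> IZR i * / fwd_tail per k + IZR j = 0 -> i = 0%Z.
Proof.
  intros hev0 hk H. assert (hev := ev_digits_pure d h per hev0).
  assert (ht := fwd_tail_range _ _ _ k hev hk).
  set (e := fun i => digits [] per (k - 1 + i)%nat).
  assert (he : fwd_tail per k = cf e).
  { unfold fwd_tail. change (cf e) with (cf_tail e 1). apply cf_tail_ext.
    intros s. unfold e. f_equal. lia. }
  assert (hpe : pos_digits e) by (intros a ha; apply (proj1 hev); lia).
  assert (hj : j = 0%Z).
  { apply (cf_irrational e j i hpe). rewrite <- he.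
    replace (IZR j) with (- (IZR i * / fwd_tail per k)) by lra. field. lra. }
  rewrite hj in H. rewrite Rplus_0_r in H. apply Rmult_integral in H.
  destruct H as [H|H]; [apply eq_IZR; exact H|].
  exfalso. assert (hTi := Rinv_0_lt_compat _ (proj1 ht)). lra.
Qed.

Lemma u_eq (d : nat -> nat) (h : nat) (per : list nat) (k t : nat) :
  ev_digits d h per -> (1 <= k <= length per)%nat ->
  u per k t = 2 * (INR t / lim_C per k - frac_part (INR t * rev_tail per k) + 1 / 2).
Proof.
  intros hev hk. unfold u. rewrite (abs_ec_eq d h per k hev hk), alpha_sigma_eq by exact hk.
  reflexivity.
Qed.

(** Since 1 / [lim_C] is the sum of 1 / [fwd_tail] and [rev_tail], the fractional part cancels and
    u_k(t) gets integer coordinates in the basis (1 / [fwd_tail], 1) of Q(a). Comparing coordinates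
    then decides all equalities with special points. *)
Lemma u_eq_int_part (d : nat -> nat) (h : nat) (per : list nat) (k t : nat) :
  ev_digits d h per -> (1 <= k <= length per)%nat ->
  u per k t = 2 * (INR t * / fwd_tail per k + IZR (Int_part (INR t * rev_tail per k))) + 1.
Proof.
  intros hev hk. rewrite (u_eq d h per k t hev hk). unfold frac_part, lim_C.
  assert (h1 := rev_tail_range d h per k hev).
  assert (h2 := fwd_tail_range d h per k hev ltac:(lia)).
  field. assert (hT := Rinv_0_lt_compat _ (proj1 h2)). split; nra.
Qed.

Lemma u_ge (d : nat -> nat) (h : nat) (per : list nat) (k t : nat) :
  ev_digits d h per -> (1 <= k <= length per)%nat -> (1 <= t)%nat -> INR t <= u per k t.
Proof.
  intros hev hk ht. rewrite (u_eq d h per k t hev hk).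
  assert (hC := lim_C_range d h per k hev ltac:(lia)).
  assert (hf := base_fp (INR t * rev_tail per k)).
  assert (h1 : 1 <= INR t) by (apply (le_INR 1); exact ht).
  assert (h2 : INR t <= INR t / lim_C per k).
  { apply Rmult_le_reg_r with (lim_C per k); [lra|]. field_simplify; nra. }
  lra.
Qed.

(** Here u = 2 w + 1, so the difference of squares is 4 (y - w)(y + w + 1). *)
Lemma u_ne_of_shift (d : nat -> nat) (h : nat) (per : list nat) (k t : nat) (y : R) :
  ev_digits d h per -> (1 <= k <= length per)%nat ->
  let w := INR t * / fwd_tail per k + IZR (Int_part (INR t * rev_tail per k)) in
  y <> w -> y <> - w - 1 -> (1 + 2 * y) ^ 2 <> u per k t ^ 2.
Proof.
  intros hev hk w h1 h2 H. rewrite (u_eq_int_part d h per k t hev hk) in H. fold w in H.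
  assert (H' : (y - w) * (y + w + 1) = 0) by nra.
  apply Rmult_integral in H'. destruct H'; lra.
Qed.

Lemma u_ne_int (d : nat -> nat) (h : nat) (per : list nat) (k t : nat) (s : Z) :
  ev_digits d h per -> (1 <= k <= length per)%nat -> (1 <= t)%nat ->
  (1 + 2 * IZR s) ^ 2 <> u per k t ^ 2.
Proof.
  intros hev hk ht. apply (u_ne_of_shift d h per k t _ hev hk); intros E;
    rewrite INR_IZR_INZ in E.
  - assert (Z.of_nat t = 0%Z); [|lia].
    apply (fwd_tail_irrational d h per k _
      (Int_part (IZR (Z.of_nat t) * rev_tail per k) - s) hev ltac:(lia)).
    rewrite minus_IZR. lra.
  - assert (Z.of_nat t = 0%Z); [|lia].
    apply (fwd_tail_irrational d h per k _
      (Int_part (IZR (Z.of_nat t) * rev_tail per k) + s + 1) hev ltac:(lia)).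
    rewrite !plus_IZR. lra.
Qed.

Lemma cst_a_irrational (d : nat -> nat) (h : nat) (per : list nat) (s : Z) :
  ev_digits d h per -> cst_a per <> IZR s.
Proof.
  intros hev H. assert (hl := proj1 (proj2 hev)).
  destruct (cst_a_b_basis d h per 1 hev ltac:(lia)) as (Q & P & hQ & ha & _).
  rewrite !INR_IZR_INZ in ha.
  assert (Z.of_nat Q = 0%Z); [|lia].
  apply (fwd_tail_irrational d h per 1 _ (Z.of_nat P - s) hev (Nat.le_refl _)).
  rewrite minus_IZR. lra.
Qed.

(* If (1 + 2 a^2)^2 = u_k(t)^2, then comparing coefficients in the basis
   (1 / fwd_tail, 1) and conjugating gives b^2 = - {t sigma_k} <= 0. *)
Lemma u_ne_cst_a_sqr (d : nat -> nat) (h : nat) (per : list nat) (k t : nat) :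
  ev_digits d h per -> (1 <= k <= length per)%nat -> (1 <= t)%nat ->
  Nat.Even (length per) ->
  (1 + 2 * cst_a per ^ 2) ^ 2 <> u per k t ^ 2.
Proof.
  intros hev hk ht hl.
  assert (ha1 := cst_a_gt_1 d h per hev).
  assert (hb := cst_b_eq d h per hev). assert (hc := cst_c_eq d h per hev).
  assert (hs : (-1) ^ length per = 1).
  { destruct hl as [l' e]. rewrite e. apply pow_1_even. }
  rewrite hs in hb, hc.
  assert (hbpos : 0 < cst_b per) by (rewrite hb; apply Rdiv_lt_0_compat; lra).
  assert (hab : cst_a per * cst_b per = 1) by (rewrite hb; field; lra).
  assert (hcab : INR (cst_c per) = cst_a per + cst_b per) by lra.
  assert (hup := u_ge d h per k t hev hk ht).
  assert (ht1 : 1 <= INR t) by (apply (le_INR 1); exact ht).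
  assert (hue := u_eq_int_part d h per k t hev hk).
  destruct (cst_a_b_basis d h per k hev hk) as (Q & P & hQ & ha & hbm).
  apply (u_ne_of_shift d h per k t _ hev hk); intros E; [|nra].
  set (f := Int_part (INR t * rev_tail per k)) in *.
  set (c := cst_c per) in *.
  assert (h0 : (Z.of_nat t - Z.of_nat c * Z.of_nat Q)%Z = 0%Z).
  { apply (fwd_tail_irrational d h per k _ (f - Z.of_nat c * Z.of_nat P + 1) hev ltac:(lia)).
    rewrite plus_IZR, !minus_IZR, !mult_IZR, <- !INR_IZR_INZ.
    assert (e1 : cst_a per ^ 2 = INR c * cst_a per - 1) by (rewrite hcab; nra).
    rewrite e1, ha in E. lra. }
  assert (h1 : INR t = INR c * INR Q).
  { rewrite !INR_IZR_INZ, <- mult_IZR. f_equal. lia. }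
  assert (h2 : IZR f = INR c * INR P - 1).
  { assert (e1 : cst_a per ^ 2 = INR c * cst_a per - 1) by (rewrite hcab; nra).
    rewrite e1, ha, h1 in E. lra. }
  assert (hf := base_fp (INR t * rev_tail per k)). unfold frac_part in hf. fold f in hf.
  assert (e2 : cst_b per ^ 2 = INR c * cst_b per - 1) by (rewrite hcab; nra).
  rewrite hbm in e2 at 2. rewrite h2, h1 in hf. nra.
Qed.

(** Equality would give t = - Q or t = Q on comparing coefficients of 1 / [fwd_tail]. The first is
    impossible by sign. In the second, conjugation gives {t sigma_k} = s + 1 - b, which exceeds 1
    because b < 0 for odd l. *)
Lemma u_ne_sub_cst_a (d : nat -> nat) (h : nat) (per : list nat) (k t s : nat) :
  ev_digits d h per -> (1 <= k <= length per)%nat -> (1 <= t)%nat ->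
  Nat.Odd (length per) ->
  (1 + 2 * (INR s - cst_a per)) ^ 2 <> u per k t ^ 2.
Proof.
  intros hev hk ht hl.
  assert (ha1 := cst_a_gt_1 d h per hev).
  assert (hb := cst_b_eq d h per hev).
  assert (hs : (-1) ^ length per = -1).
  { destruct hl as [l' e]. rewrite e, Nat.add_1_r. apply pow_1_odd. }
  rewrite hs in hb.
  assert (hbneg : cst_b per < 0).
  { assert (H := Rinv_0_lt_compat (cst_a per) ltac:(lra)). rewrite hb. unfold Rdiv. lra. }
  assert (hs0 := pos_INR s).
  destruct (cst_a_b_basis d h per k hev hk) as (Q & P & hQ & ha & hbm).
  set (f := Int_part (INR t * rev_tail per k)).
  apply (u_ne_of_shift d h per k t _ hev hk); fold f; intros E; rewrite ha in E.
  - assert (Z.of_nat t + Z.of_nat Q = 0)%Z; [|lia].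
    apply (fwd_tail_irrational d h per k _ (f + Z.of_nat P - Z.of_nat s) hev ltac:(lia)).
    rewrite minus_IZR, !plus_IZR, <- !INR_IZR_INZ. lra.
  - assert (h0 : (Z.of_nat t - Z.of_nat Q = 0)%Z).
    { apply (fwd_tail_irrational d h per k _ (f + Z.of_nat s + 1 - Z.of_nat P) hev ltac:(lia)).
      rewrite !minus_IZR, !plus_IZR, <- !INR_IZR_INZ. lra. }
    assert (h1 : t = Q) by lia. subst Q.
    assert (h2 : INR P = IZR f + INR s + 1) by lra.
    assert (hf := base_fp (INR t * rev_tail per k)). unfold frac_part in hf. fold f in hf.
    lra.
Qed.

(** * The product of 2 sin (pi t / n) *)

Definition Rsum (s : list nat) (f : nat -> R) : R := fold_right Rplus 0 (map f s).

Lemma Rprod_ext (s : list nat) (f g : nat -> R) :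
  (forall x, In x s -> f x = g x) -> Rprod s f = Rprod s g.
Proof.
  intros H. unfold Rprod. rewrite (map_ext_in _ _ _ H). reflexivity.
Qed.

Lemma Rprod_app (s1 s2 : list nat) (f : nat -> R) :
  Rprod (s1 ++ s2) f = Rprod s1 f * Rprod s2 f.
Proof.
  induction s1 as [|x s1 IH]; unfold Rprod in *; simpl; [ring|]. rewrite IH. ring.
Qed.

Lemma Rsum_app (s1 s2 : list nat) (f : nat -> R) :
  Rsum (s1 ++ s2) f = Rsum s1 f + Rsum s2 f.
Proof.
  induction s1 as [|x s1 IH]; unfold Rsum in *; simpl; [ring|]. rewrite IH. ring.
Qed.

Lemma Rprod_seq_S (a n : nat) (f : nat -> R) :
  Rprod (seq a (S n)) f = Rprod (seq a n) f * f (a + n)%nat.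
Proof.
  rewrite seq_S, Rprod_app. unfold Rprod at 2. simpl. ring.
Qed.

Lemma Rsum_seq_S (a n : nat) (f : nat -> R) :
  Rsum (seq a (S n)) f = Rsum (seq a n) f + f (a + n)%nat.
Proof.
  rewrite seq_S, Rsum_app. unfold Rsum at 2. simpl. ring.
Qed.

Lemma Rprod_mult (s : list nat) (f g : nat -> R) :
  Rprod s (fun x => f x * g x) = Rprod s f * Rprod s g.
Proof.
  induction s as [|x s IH]; unfold Rprod in *; simpl; [ring|]. rewrite IH. ring.
Qed.

Lemma Rprod_const_1 (s : list nat) (f : nat -> R) :
  (forall x, In x s -> f x = 1) -> Rprod s f = 1.
Proof.
  intros H. induction s as [|x s IH]; [reflexivity|].
  unfold Rprod in *. simpl. rewrite IH by (intros; apply H; right; assumption).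
  rewrite H by (left; reflexivity). ring.
Qed.

Lemma Rprod_abs (s : list nat) (f : nat -> R) :
  Rabs (Rprod s f) = Rprod s (fun x => Rabs (f x)).
Proof.
  induction s as [|x s IH]; unfold Rprod in *; simpl; [apply Rabs_R1|].
  rewrite Rabs_mult, IH. reflexivity.
Qed.

Lemma Rprod_pos (s : list nat) (f : nat -> R) :
  (forall x, In x s -> 0 < f x) -> 0 < Rprod s f.
Proof.
  intros H. induction s as [|x s IH]; unfold Rprod in *; simpl; [lra|].
  apply Rmult_lt_0_compat; [apply H; left; reflexivity|].
  apply IH. intros; apply H; right; assumption.
Qed.

Lemma ln_Rprod (s : list nat) (f : nat -> R) :
  (forall x, In x s -> 0 < f x) -> ln (Rprod s f) = Rsum s (fun x => ln (f x)).
Proof.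
  intros H. induction s as [|x s IH]; unfold Rprod, Rsum in *; simpl; [apply ln_1|].
  rewrite ln_mult.
  - rewrite IH; [reflexivity|]. intros; apply H; right; assumption.
  - apply H; left; reflexivity.
  - apply (Rprod_pos s). intros; apply H; right; assumption.
Qed.

Lemma Rprod_map (s : list nat) (p : nat -> nat) (f : nat -> R) :
  Rprod (map p s) f = Rprod s (fun x => f (p x)).
Proof.
  unfold Rprod. rewrite map_map. reflexivity.
Qed.

Lemma Rprod_perm (s1 s2 : list nat) (f : nat -> R) :
  Permutation s1 s2 -> Rprod s1 f = Rprod s2 f.
Proof.
  intros H. unfold Rprod. induction H; simpl; [reflexivity|congruence|ring|congruence].
Qed.

Lemma Rprod_reindex (n : nat) (p : nat -> nat) (f : nat -> R) :
  (forall t, (1 <= t <= n)%nat -> (1 <= p t <= n)%nat) ->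
  (forall t t', (1 <= t <= n)%nat -> (1 <= t' <= n)%nat -> p t = p t' -> t = t') ->
  Rprod (seq 1 n) (fun t => f (p t)) = Rprod (seq 1 n) f.
Proof.
  intros hr hi. rewrite <- (Rprod_map _ p f). apply Rprod_perm.
  apply NoDup_Permutation_bis.
  - apply NoDup_map_NoDup_ForallPairs; [|apply seq_NoDup].
    intros x y hx hy. apply in_seq in hx. apply in_seq in hy. apply hi; lia.
  - rewrite length_map. apply Nat.le_refl.
  - intros x hx. apply in_map_iff in hx. destruct hx as (t & <- & ht).
    apply in_seq in ht. apply in_seq. assert (h := hr t ltac:(lia)). lia.
Qed.

Lemma Rprod_rev (n : nat) (f : nat -> R) :
  Rprod (seq 1 (n - 1)) (fun t => f (n - t)%nat) = Rprod (seq 1 (n - 1)) f.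
Proof.
  apply (Rprod_reindex (n - 1) (fun t => n - t)%nat f); lia.
Qed.

(** The upper half is reflected onto the lower one. For even n the fixed point n / 2 occurs once,
    hence the two different lengths. *)
Lemma Rprod_symmetric (n : nat) (f : nat -> R) :
  (1 <= n)%nat ->
  (forall t, (1 <= t <= n - 1)%nat -> f (n - t)%nat = f t) ->
  Rprod (seq 1 (n - 1)) f = Rprod (seq 1 (n / 2)) f * Rprod (seq 1 ((n - 1) / 2)) f.
Proof.
  intros hn hs.
  assert (H : forall b, (b <= n - 1)%nat -> Rprod (seq (n - b) b) f = Rprod (seq 1 b) f).
  { induction b as [|b IH]; intros hb; [reflexivity|].
    rewrite (Rprod_seq_S 1 b), <- IH by lia.
    change (seq (n - S b) (S b)) with ((n - S b)%nat :: seq (S (n - S b)) b).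
    replace (S (n - S b)) with (n - b)%nat by lia.
    rewrite <- (hs (1 + b)%nat) by lia. change (1 + b)%nat with (S b).
    unfold Rprod. simpl. ring. }
  rewrite <- (H ((n - 1) / 2)%nat) by (apply Nat.Div0.div_le_upper_bound; lia).
  rewrite <- Rprod_app. f_equal.
  assert (e : (n / 2 + (n - 1) / 2 = n - 1)%nat).
  { destruct n as [|m]; [lia|]. simpl (S m - 1)%nat. rewrite Nat.sub_0_r.
    assert (h1 := Nat.div_mod_eq (S m) 2). assert (h2 := Nat.div_mod_eq m 2).
    assert (h3 := Nat.mod_upper_bound (S m) 2). assert (h4 := Nat.mod_upper_bound m 2). lia. }
  replace (n - (n - 1) / 2)%nat with (1 + n / 2)%nat by lia.
  rewrite <- seq_app. f_equal. lia.
Qed.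

(* f is a real polynomial function of degree at most n whose coefficient of
   x^n is L. *)
Fixpoint polyfun (n : nat) (L : R) (f : R -> R) : Prop :=
  match n with
  | O => forall x, f x = L
  | S n' => exists (g : R -> R) (c : R), polyfun n' L g /\ forall x, f x = x * g x + c
  end.

Lemma polyfun_ext (n : nat) (L : R) (f g : R -> R) :
  (forall x, f x = g x) -> polyfun n L f -> polyfun n L g.
Proof.
  destruct n as [|n]; simpl; intros H.
  - intros h x. rewrite <- H. apply h.
  - intros (k & c & h1 & h2). exists k, c. split; [exact h1|].
    intros x. rewrite <- H. apply h2.
Qed.

Lemma polyfun_scal (n : nat) (L r : R) (f : R -> R) :
  polyfun n L f -> polyfun n (r * L) (fun x => r * f x).
Proof.
  revert f. induction n as [|n IH]; simpl; intros f.
  - intros h x. rewrite h. reflexivity.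
  - intros (k & c & h1 & h2). exists (fun x => r * k x), (r * c).
    split; [apply IH; exact h1|]. intros x. rewrite h2. ring.
Qed.

Lemma polyfun_add_lower (n : nat) (L M : R) (f g : R -> R) :
  polyfun (S n) L f -> polyfun n M g -> polyfun (S n) L (fun x => f x + g x).
Proof.
  revert f g. induction n as [|n IH]; intros f g.
  - intros (k & c & h1 & h2) h3. exists k, (c + M). split; [exact h1|].
    intros x. rewrite h2, h3. ring.
  - intros (k & c & h1 & h2) (k' & c' & h3 & h4).
    exists (fun x => k x + k' x), (c + c'). split; [apply IH; assumption|].
    intros x. rewrite h2, h4. ring.
Qed.

Lemma polyfun_weaken (n : nat) (L : R) (f : R -> R) :
  polyfun n L f -> polyfun (S n) 0 f.
Proof.
  revert f. induction n as [|n IH]; intros f.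
  - intros h. exists (fun _ => 0), L. split; [intros x; reflexivity|]. intros x. rewrite h. ring.
  - intros (k & c & h1 & h2). exists k, c. split; [apply IH; exact h1|exact h2].
Qed.

Lemma polyfun_sub_factor (n : nat) (L r : R) (f : R -> R) :
  polyfun (S n) L f ->
  exists g, polyfun n L g /\ forall x, f x - f r = (x - r) * g x.
Proof.
  revert f. induction n as [|n IH]; intros f (k & c & h1 & h2).
  - exists k. split; [exact h1|]. intros x. rewrite !h2. simpl in h1. rewrite !h1. ring.
  - destruct (IH k h1) as (g & h3 & h4).
    exists (fun x => k x + r * g x). split.
    + apply (polyfun_add_lower n L (r * L)); [exact h1|apply polyfun_scal; exact h3].
    + intros x. rewrite !h2.
      transitivity ((x - r) * k x + r * (k x - k r)); [ring|]. rewrite h4. ring.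
Qed.

Lemma polyfun_split (rs : nat -> R) (n : nat) (L : R) (f : R -> R) :
  polyfun n L f ->
  (forall i, (1 <= i <= n)%nat -> f (rs i) = 0) ->
  (forall i j, (1 <= i < j)%nat -> (j <= n)%nat -> rs i <> rs j) ->
  forall x, f x = L * Rprod (seq 1 n) (fun i => x - rs i).
Proof.
  revert f. induction n as [|n IH]; intros f hf hroot hinj x.
  - rewrite hf. unfold Rprod. simpl. ring.
  - destruct (polyfun_sub_factor n L (rs (S n)) f hf) as (g & hg & hfg).
    assert (hfg' : forall x, f x = (x - rs (S n)) * g x).
    { intros y. rewrite <- hfg, (hroot (S n)) by lia. ring. }
    rewrite hfg', Rprod_seq_S. rewrite (IH g hg).
    + change (1 + n)%nat with (S n). ring.
    + intros i hi. assert (h := hroot i ltac:(lia)). rewrite hfg' in h.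
      apply Rmult_integral in h. destruct h as [h|h]; [|exact h].
      exfalso. apply (hinj i (S n)); [lia|lia|lra].
    + intros i j hi hj. apply hinj; lia.
Qed.

(** Chebyshev polynomials of the second kind: U_(n-1) has the known roots cos(pi i / n), leading
    coefficient 2^(n-1) and the value n at 1, which is all that the sine product requires. *)
Fixpoint chebU (n : nat) (x : R) : R :=
  match n with
  | O => 1
  | S n1 =>
      match n1 with
      | O => 2 * x
      | S n0 => 2 * x * chebU n1 x - chebU n0 x
      end
  end.

Lemma chebU_rec (n : nat) (x : R) :
  chebU (S (S n)) x = 2 * x * chebU (S n) x - chebU n x.
Proof. reflexivity. Qed.

Lemma chebU_polyfun (n : nat) : polyfun n (2 ^ n) (chebU n).
Proof.
  induction n as [n IH] using (well_founded_induction lt_wf).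
  destruct n as [|[|n]].
  - intros x. reflexivity.
  - exists (fun _ => 2), 0. split; [intros x; simpl; ring|intros x; simpl; ring].
  - assert (h1 := IH (S n) ltac:(lia)). assert (h0 := IH n ltac:(lia)).
    apply polyfun_ext with (fun x => x * (2 * chebU (S n) x) + 0 + (-1) * chebU n x).
    + intros x. rewrite chebU_rec. ring.
    + apply (polyfun_add_lower (S n) _ 0).
      * exists (fun x => 2 * chebU (S n) x), 0. split; [|reflexivity].
        apply (polyfun_scal (S n) (2 ^ S n) 2 _ h1).
      * apply (polyfun_weaken n (-1 * 2 ^ n)). apply polyfun_scal. exact h0.
Qed.

Lemma chebU_sin (n : nat) (x : R) : sin x * chebU n (cos x) = sin (INR (S n) * x).
Proof.
  induction n as [n IH] using (well_founded_induction lt_wf).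
  destruct n as [|[|n]].
  - simpl. rewrite !Rmult_1_l, Rmult_1_r. reflexivity.
  - simpl. replace ((1 + 1) * x) with (2 * x) by ring. rewrite sin_2a. ring.
  - rewrite chebU_rec, Rmult_minus_distr_l.
    replace (sin x * (2 * cos x * chebU (S n) (cos x))) with
      (2 * cos x * (sin x * chebU (S n) (cos x))) by ring.
    rewrite (IH (S n)), (IH n) by lia.
    replace (INR (S (S (S n))) * x) with (INR (S (S n)) * x + x) by (rewrite (S_INR (S (S n))); ring).
    replace (INR (S n) * x) with (INR (S (S n)) * x - x) by (rewrite (S_INR (S n)); ring).
    rewrite sin_plus, sin_minus. ring.
Qed.

Lemma chebU_at_1 (n : nat) : chebU n 1 = INR (S n).
Proof.
  induction n as [n IH] using (well_founded_induction lt_wf).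
  destruct n as [|[|n]]; [reflexivity|simpl; ring|].
  rewrite chebU_rec, (IH (S n)), (IH n), !S_INR by lia. ring.
Qed.

(** Evaluate the factorization of U_(n-1) at 1 and write 1 - cos x = 2 sin(x/2)^2; the power of 2
    turns each factor 2 into 4. *)
Lemma prod_sin_sqr_half (n : nat) :
  (1 <= n)%nat ->
  Rprod (seq 1 (n - 1)) (fun t => 4 * sin (PI * INR t / (2 * INR n)) ^ 2) = INR n.
Proof.
  intros hn. assert (hN : 1 <= INR n) by (apply (le_INR 1); exact hn).
  assert (hpi := PI_RGT_0).
  assert (hroots := polyfun_split (fun i => cos (PI * INR i / INR n)) (n - 1) _ _
                      (chebU_polyfun (n - 1))).
  assert (hangle : forall i, (1 <= i <= n - 1)%nat -> 0 < PI * INR i / INR n < PI).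
  { intros i hi. assert (1 <= INR i) by (apply (le_INR 1); lia).
    assert (INR i < INR n) by (apply lt_INR; lia). split.
    - apply Rdiv_lt_0_compat; nra.
    - apply Rmult_lt_reg_r with (INR n); [lra|]. field_simplify; nra. }
  assert (H : chebU (n - 1) 1 = 2 ^ (n - 1) *
     Rprod (seq 1 (n - 1)) (fun i => 1 - cos (PI * INR i / INR n))).
  { apply hroots.
    - intros i hi. assert (ha := hangle i hi).
      assert (hs := chebU_sin (n - 1) (PI * INR i / INR n)).
      replace (S (n - 1)) with n in hs by lia.
      replace (INR n * (PI * INR i / INR n)) with (0 + INR i * PI) in hs by (field; lra).
      assert (h0 : sin (0 + INR i * PI) = 0).
      { rewrite Rplus_0_l. apply sin_eq_0_1. exists (Z.of_nat i). rewrite <- INR_IZR_INZ.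
        reflexivity. }
      rewrite h0 in hs. apply Rmult_integral in hs. destruct hs as [hs|hs]; [|exact hs].
      assert (hg := sin_gt_0 _ (proj1 ha) (proj2 ha)). lra.
    - intros i j hi hj E. assert (ha := hangle i ltac:(lia)). assert (hb := hangle j ltac:(lia)).
      assert (INR i < INR j) by (apply lt_INR; lia).
      assert (PI * INR i / INR n < PI * INR j / INR n).
      { unfold Rdiv. apply Rmult_lt_compat_r; [apply Rinv_0_lt_compat; lra|]. nra. }
      assert (cos (PI * INR j / INR n) < cos (PI * INR i / INR n)); [|lra].
      apply cos_decreasing_1; lra. }
  rewrite chebU_at_1 in H. replace (S (n - 1)) with n in H by lia.
  eapply eq_trans; [|symmetry; exact H].
  clear - hN. set (m := (n - 1)%nat). clearbody m.
  induction m as [|m IH]; [unfold Rprod; simpl; ring|].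
  rewrite !Rprod_seq_S, IH. change (2 ^ S m) with (2 * 2 ^ m).
  replace (PI * INR (1 + m) / INR n) with (2 * (PI * INR (1 + m) / (2 * INR n))).
  - rewrite cos_2a_sin. ring.
  - field. lra.
Qed.

(** By the double angle formula each factor is 4 sin^2 times 4 cos^2 of the half angle, and t -> n -
    t carries the cosines into the sines. So this is the half-angle product squared. *)
Lemma prod_sin_sqr (n : nat) :
  (1 <= n)%nat ->
  Rprod (seq 1 (n - 1)) (fun t => 4 * sin (PI * INR t / INR n) ^ 2) = INR n ^ 2.
Proof.
  intros hn. assert (hN : 1 <= INR n) by (apply (le_INR 1); exact hn).
  assert (h := prod_sin_sqr_half n hn).
  transitivity (INR n * INR n); [|ring].
  eapply eq_trans; [|apply f_equal2; [exact h|exact h]].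
  rewrite <- (Rprod_rev n (fun t => 4 * sin (PI * INR t / (2 * INR n)) ^ 2)) at 2.
  rewrite <- Rprod_mult. apply Rprod_ext. intros t ht. apply in_seq in ht.
  rewrite minus_INR by lia.
  replace (PI * INR t / INR n) with (2 * (PI * INR t / (2 * INR n))) by (field; lra).
  replace (PI * (INR n - INR t) / (2 * INR n)) with (PI / 2 - PI * INR t / (2 * INR n)) by (field; lra).
  rewrite sin_2a, sin_shift. ring.
Qed.

(** * Factorization of the Sudler product *)

Lemma Rabs_sin_add_int (z : Z) (m : nat) (y : R) :
  Rabs (sin (PI * (IZR z + (-1) ^ m * y))) = Rabs (sin (PI * y)).
Proof.
  assert (h1 : forall w, Rabs (sin (PI * (IZR z + w))) = Rabs (sin (PI * w))).
  { intros w. rewrite Rmult_plus_distr_l, sin_plus.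
    assert (hs : sin (PI * IZR z) = 0) by (apply sin_eq_0_1; exists z; ring).
    assert (hc := sin2_cos2 (PI * IZR z)). rewrite hs in *. unfold Rsqr in hc.
    rewrite Rmult_0_l, Rplus_0_l, Rabs_mult.
    assert (h : cos (PI * IZR z) = 1 \/ cos (PI * IZR z) = -1).
    { assert (e : (cos (PI * IZR z) - 1) * (cos (PI * IZR z) + 1) = 0) by lra.
      apply Rmult_integral in e. destruct e; [left|right]; lra. }
    destruct h as [h|h]; rewrite h; [rewrite Rabs_R1; ring|].
    rewrite Rabs_left by lra. ring. }
  rewrite h1.
  assert (hm : (-1) ^ m = 1 \/ (-1) ^ m = -1).
  { assert (e := pow_sqr_1 m).
    assert (e' : ((-1) ^ m - 1) * ((-1) ^ m + 1) = 0) by lra.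
    apply Rmult_integral in e'. destruct e'; [left|right]; lra. }
  destruct hm as [hm|hm]; rewrite hm.
  - f_equal. f_equal. ring.
  - replace (PI * (-1 * y)) with (- (PI * y)) by ring. rewrite sin_neg. apply Rabs_Ropp.
Qed.

(* q_(n-1) inverts p_n modulo q_n up to sign, so cf_res sorts the indices r
   according to the distance from r p_n / q_n to the integers. *)
Definition cf_res (d : nat -> nat) (n t : nat) : nat :=
  ((t * cf_q d (n - 1)) mod cf_q d n)%nat.

(** In units of pi / q_n this is the midpoint of a pair: up to sign and integers, the factors at r
    and q_n - r have the arguments N - (C_n/2 + eps) and N + (C_n/2 + eps). *)
Definition cf_N (d : nat -> nat) (n t : nat) : R :=
  INR t + cf_C d n / 2 - INR (cf_res d n t) * cf_delta d n.

(** By the Wronskian q_(n-1) is a unit modulo q_n, so the residue of t q_(n-1) determines t modulo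
    q_n. *)
Lemma cf_res_inj (d : nat -> nat) (n t t' : nat) :
  pos_digits d -> (1 <= n)%nat -> (t < cf_q d n)%nat -> (t' < cf_q d n)%nat ->
  cf_res d n t = cf_res d n t' -> t = t'.
Proof.
  intros hd hn ht ht' H. unfold cf_res in H.
  assert (W := cf_wronskian d (n - 1)). replace (S (n - 1)) with n in W by lia.
  set (q := cf_q d n) in *. set (Q := cf_q d (n - 1)) in *.
  set (p := cf_p d n) in *. set (p' := cf_p d (n - 1)) in *.
  assert (hw : exists sg : Z, (sg * sg = 1)%Z /\
             (Z.of_nat q * Z.of_nat p' - Z.of_nat Q * Z.of_nat p = sg)%Z).
  { assert (e := pow_sqr_1 (n - 1)). rewrite <- W in e.
    exists (Z.of_nat q * Z.of_nat p' - Z.of_nat Q * Z.of_nat p)%Z. split; [|reflexivity].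
    apply eq_IZR. rewrite mult_IZR, minus_IZR, !mult_IZR, <- !INR_IZR_INZ. exact e. }
  destruct hw as (sg & hsg & hw).
  assert (h1 := Nat.div_mod_eq (t * Q) q). assert (h2 := Nat.div_mod_eq (t' * Q) q).
  rewrite H in h1. set (r := ((t' * Q) mod q)%nat) in *.
  set (w := (t * Q / q)%nat) in *. set (w' := (t' * Q / q)%nat) in *.
  set (x := (Z.of_nat t - Z.of_nat t')%Z).
  assert (h3 : (x * Z.of_nat Q = Z.of_nat q * (Z.of_nat w - Z.of_nat w'))%Z) by (unfold x; nia).
  assert (h4 : (x = Z.of_nat q * (sg * (x * Z.of_nat p' - (Z.of_nat w - Z.of_nat w') * Z.of_nat p)))%Z).
  { transitivity (x * (sg * sg))%Z; [rewrite hsg; ring|]. rewrite <- hw at 2.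
    transitivity (sg * (Z.of_nat q * (x * Z.of_nat p') - x * Z.of_nat Q * Z.of_nat p))%Z; [ring|].
    rewrite h3. ring. }
  set (y := (sg * (x * Z.of_nat p' - (Z.of_nat w - Z.of_nat w') * Z.of_nat p))%Z) in *.
  assert (y = 0%Z); [|subst x; lia].
  assert (- Z.of_nat q < x < Z.of_nat q)%Z by (unfold x; lia). nia.
Qed.

Lemma cf_res_range (d : nat -> nat) (n t : nat) :
  pos_digits d -> (1 <= n)%nat -> (1 <= t <= cf_q d n - 1)%nat ->
  (1 <= cf_res d n t <= cf_q d n - 1)%nat.
Proof.
  intros hd hn ht.
  assert (h : (cf_res d n t < cf_q d n)%nat) by (apply Nat.mod_upper_bound; lia).
  assert (cf_res d n t <> 0%nat); [|lia]. intros E.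
  assert (t = 0%nat); [|lia]. apply (cf_res_inj d n t 0 hd hn); [lia|lia|].
  rewrite E. unfold cf_res. simpl. rewrite Nat.Div0.mod_0_l. reflexivity.
Qed.

Lemma cf_res_sym (d : nat -> nat) (n t : nat) :
  pos_digits d -> (1 <= n)%nat -> (1 <= t <= cf_q d n - 1)%nat ->
  (cf_res d n (cf_q d n - t) + cf_res d n t = cf_q d n)%nat.
Proof.
  intros hd hn ht.
  assert (h1 := cf_res_range d n t hd hn ht).
  assert (h2 := cf_res_range d n (cf_q d n - t) hd hn ltac:(lia)).
  unfold cf_res in *. set (q := cf_q d n) in *. set (Q := cf_q d (n - 1)) in *.
  assert (h3 := Nat.div_mod_eq (t * Q) q). assert (h4 := Nat.div_mod_eq ((q - t) * Q) q).
  set (r := ((t * Q) mod q)%nat) in *. set (r' := (((q - t) * Q) mod q)%nat) in *.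
  set (w := (t * Q / q)%nat) in *. set (w' := ((q - t) * Q / q)%nat) in *.
  assert (h5 : (t * Q + (q - t) * Q = q * Q)%nat) by (rewrite <- Nat.mul_add_distr_r; f_equal; lia).
  assert (h6 : (Z.of_nat r' + Z.of_nat r =
           Z.of_nat q * (Z.of_nat Q - Z.of_nat w - Z.of_nat w'))%Z) by nia.
  (* The two residues add up to q y and each lies strictly between 0 and q, which forces y = 1. *)
  set (y := (Z.of_nat Q - Z.of_nat w - Z.of_nat w')%Z) in *.
  assert (y = 1%Z) by nia. nia.
Qed.

Lemma cf_N_sym (d : nat -> nat) (n t : nat) :
  pos_digits d -> (1 <= n)%nat -> (1 <= t <= cf_q d n - 1)%nat ->
  cf_N d n (cf_q d n - t) = INR (cf_q d n) - cf_N d n t.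
Proof.
  intros hd hn ht. assert (h := cf_res_sym d n t hd hn ht).
  apply (f_equal INR) in h. rewrite plus_INR in h. unfold cf_N.
  rewrite minus_INR by lia.
  replace (INR (cf_res d n (cf_q d n - t))) with (INR (cf_q d n) - INR (cf_res d n t)) by lra.
  unfold cf_C. field.
Qed.

Lemma cf_N_range (d : nat -> nat) (n t : nat) :
  pos_digits d -> (1 <= n)%nat ->
  Rabs (cf_N d n t - INR t) <= cf_C d n / 2.
Proof.
  intros hd hn. assert (hq := cf_q_pos d n hd hn).
  assert (h : (cf_res d n t < cf_q d n)%nat) by (apply Nat.mod_upper_bound; lia).
  apply lt_INR in h. assert (h0 := pos_INR (cf_res d n t)).
  assert (hdl := cf_delta_pos d n hd). unfold cf_N, cf_C. apply Rabs_le. nra.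
Qed.

(** The Wronskian gives q_(n-1) p_n = - (-1)^(n+1) modulo q_n, so r p_n / q_n is congruent to -
    (-1)^(n+1) t / q_n modulo 1. The rest is the approximation error r delta_n / q_n. *)
Lemma cf_rational_part (d : nat -> nat) (n t : nat) :
  pos_digits d -> (1 <= n)%nat ->
  exists z : Z, INR (cf_res d n t) * cf d =
    IZR z + (-1) ^ (n + 1) * ((INR (cf_res d n t) * cf_delta d n - INR t) / INR (cf_q d n)).
Proof.
  intros hd hn. assert (hq : 0 < INR (cf_q d n)) by (apply (lt_INR 0), cf_q_pos; assumption).
  assert (W := cf_wronskian d (n - 1)). assert (Hap := cf_approx d n hd).
  replace (S (n - 1)) with n in W by lia.
  assert (es : (-1) ^ (n - 1) = (-1) ^ (n + 1)).
  { replace (n + 1)%nat with (n - 1 + 2)%nat by lia. rewrite pow_add. simpl. ring. }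
  rewrite es in W. clear es.
  unfold cf_res. set (q := cf_q d n) in *. set (Q := cf_q d (n - 1)) in *.
  set (p := cf_p d n) in *. set (p' := cf_p d (n - 1)) in *. set (s := (-1) ^ (n + 1)) in *.
  assert (h1 := Nat.div_mod_eq (t * Q) q).
  set (r := ((t * Q) mod q)%nat) in *. set (w := (t * Q / q)%nat) in *.
  apply (f_equal INR) in h1. rewrite plus_INR, !mult_INR in h1.
  exists (Z.of_nat t * Z.of_nat p' - Z.of_nat w * Z.of_nat p)%Z.
  rewrite minus_IZR, !mult_IZR, <- !INR_IZR_INZ.
  replace (cf d) with ((INR p + s * cf_delta d n) / INR q) by (rewrite <- Hap; field; lra).
  assert (h2 : INR r * INR p = INR t * (INR q * INR p' - s) - INR q * INR w * INR p).
  { replace (INR r) with (INR t * INR Q - INR q * INR w) by lra. rewrite <- W. ring. }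
  apply Rmult_eq_reg_r with (INR q); [|lra]. field_simplify; [|lra|lra].
  rewrite h2. ring.
Qed.

Definition sudler_factor (d : nat -> nat) (n : nat) (eps : R) (r : nat) : R :=
  2 * Rabs (sin (PI * (INR r * cf d + (-1) ^ (n + 1) * (eps / INR (cf_q d n))))).

(** The identity sin(A - B) sin(A + B) = sin(A)^2 - sin(B)^2 separates the variables: t enters the
    first square only and eps the second only. *)
Lemma sudler_factor_pair (d : nat -> nat) (n t : nat) (eps : R) :
  pos_digits d -> (1 <= n)%nat ->
  let q := cf_q d n in
  sudler_factor d n eps (cf_res d n t) * sudler_factor d n eps (q - cf_res d n t) =
  4 * Rabs (sin (PI * cf_N d n t / INR q) ^ 2 - sin (PI * (cf_C d n / 2 + eps) / INR q) ^ 2).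
Proof.
  intros hd hn q. assert (hq : 0 < INR q) by (apply (lt_INR 0), cf_q_pos; assumption).
  assert (hr : (cf_res d n t < q)%nat).
  { apply Nat.mod_upper_bound. assert (H := cf_q_pos d n hd hn). lia. }
  destruct (cf_rational_part d n t hd hn) as (z & hz). fold q in hz.
  assert (Hap := cf_approx d n hd). fold q in Hap.
  unfold sudler_factor. fold q. set (s := (-1) ^ (n + 1)) in *.
  set (r := cf_res d n t) in *. set (dl := cf_delta d n) in *.
  assert (hC : cf_C d n = INR q * dl) by reflexivity.
  assert (hN : cf_N d n t = INR t + cf_C d n / 2 - INR r * dl) by reflexivity.
  replace (INR r * cf d + s * (eps / INR q)) with
    (IZR z + s * ((INR r * dl - INR t + eps) / INR q)) by (rewrite hz; field; lra).
  replace (INR (q - r) * cf d + s * (eps / INR q)) with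
    (IZR (Z.of_nat (cf_p d n) - z) + s * ((INR t - INR r * dl + cf_C d n + eps) / INR q)).
  2:{ rewrite minus_INR by lia. rewrite Rmult_minus_distr_r, hz.
      replace (INR q * cf d) with (INR (cf_p d n) + s * dl) by lra.
      rewrite minus_IZR, <- INR_IZR_INZ, hC. field. lra. }
  unfold s. rewrite !Rabs_sin_add_int.
  replace (PI * ((INR r * dl - INR t + eps) / INR q)) with
    (- (PI * cf_N d n t / INR q - PI * (cf_C d n / 2 + eps) / INR q))
    by (rewrite hN; field; lra).
  replace (PI * ((INR t - INR r * dl + cf_C d n + eps) / INR q)) with
    (PI * cf_N d n t / INR q + PI * (cf_C d n / 2 + eps) / INR q)
    by (rewrite hN; field; lra).
  set (a := PI * cf_N d n t / INR q). set (b := PI * (cf_C d n / 2 + eps) / INR q).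
  rewrite sin_neg, Rabs_Ropp.
  replace (sin a ^ 2 - sin b ^ 2) with (sin (a - b) * sin (a + b)).
  - rewrite Rabs_mult. ring.
  - rewrite sin_plus, sin_minus. assert (ha := sin2_cos2 a). assert (hb := sin2_cos2 b).
    unfold Rsqr in *.
    transitivity (sin a * sin a * (cos b * cos b) - (cos a * cos a) * (sin b * sin b)); [ring|].
    replace (cos b * cos b) with (1 - sin b * sin b) by lra.
    replace (cos a * cos a) with (1 - sin a * sin a) by lra. ring.
Qed.

(** In the square, the product over r is multiplied by the same product over q_n - r. The index r =
    q_n is left over and gives the factor in front. *)
Lemma sudler_sqr (d : nat -> nat) (n : nat) (eps : R) :
  pos_digits d -> (1 <= n)%nat ->
  let q := cf_q d n in
  sudler d n eps ^ 2 =
  4 * sin (PI * (cf_C d n + eps) / INR q) ^ 2 *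
  Rprod (seq 1 (q - 1)) (fun t =>
    4 * Rabs (sin (PI * cf_N d n t / INR q) ^ 2 - sin (PI * (cf_C d n / 2 + eps) / INR q) ^ 2)).
Proof.
  intros hd hn q. assert (hq1 := cf_q_pos d n hd hn).
  assert (hq : 0 < INR q) by (apply (lt_INR 0); exact hq1).
  assert (hs : sudler d n eps = Rprod (seq 1 (q - 1)) (sudler_factor d n eps)
                                * sudler_factor d n eps q).
  { unfold sudler. fold q. change (fun r => 2 * _) with (sudler_factor d n eps).
    replace q with (S (q - 1)) at 1 by (unfold q; lia). rewrite Rprod_seq_S.
    replace (1 + (q - 1))%nat with q by (unfold q; lia). reflexivity. }
  rewrite hs.
  assert (hlast : sudler_factor d n eps q = 2 * Rabs (sin (PI * (cf_C d n + eps) / INR q))).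
  { unfold sudler_factor. fold q. f_equal.
    assert (Hap := cf_approx d n hd). fold q in Hap.
    replace (INR q * cf d + (-1) ^ (n + 1) * (eps / INR q)) with
      (IZR (Z.of_nat (cf_p d n)) + (-1) ^ (n + 1) * ((cf_C d n + eps) / INR q)).
    - rewrite Rabs_sin_add_int. f_equal. f_equal. field. lra.
    - rewrite <- INR_IZR_INZ. unfold cf_C. fold q.
      replace (INR q * cf d) with (INR (cf_p d n) + (-1) ^ (n + 1) * cf_delta d n) by lra.
      field. lra. }
  rewrite Rpow_mult_distr, hlast, Rpow_mult_distr, pow2_abs, Rmult_comm.
  f_equal; [ring|].
  rewrite <- (Rprod_reindex (q - 1) (cf_res d n)).
  - transitivity (Rprod (seq 1 (q - 1)) (fun t => sudler_factor d n eps (cf_res d n t))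
                  * Rprod (seq 1 (q - 1)) (fun t => sudler_factor d n eps (q - cf_res d n t))).
    + rewrite (Rprod_reindex (q - 1) (cf_res d n) (fun r => sudler_factor d n eps (q - r))).
      * rewrite Rprod_rev. rewrite (Rprod_reindex (q - 1) (cf_res d n)); [ring| |].
        -- intros t ht. apply cf_res_range; assumption.
        -- intros t t' ht ht'. apply cf_res_inj; auto; fold q; lia.
      * intros t ht. apply cf_res_range; assumption.
      * intros t t' ht ht'. apply cf_res_inj; auto; fold q; lia.
    + rewrite <- Rprod_mult. apply Rprod_ext. intros t ht.
      apply sudler_factor_pair; assumption.
  - intros t ht. apply cf_res_range; assumption.
  - intros t t' ht ht'. apply cf_res_inj; auto; fold q; lia.
Qed.

(** * Infinite products with quadratically decaying terms *)

Lemma Rsum_le (s : list nat) (f g : nat -> R) :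
  (forall x, In x s -> f x <= g x) -> Rsum s f <= Rsum s g.
Proof.
  intros H. induction s as [|x s IH]; unfold Rsum in *; simpl; [lra|].
  apply Rplus_le_compat; [apply H; left; reflexivity|].
  apply IH. intros; apply H; right; assumption.
Qed.

Lemma Rsum_nonneg (s : list nat) (f : nat -> R) :
  (forall x, In x s -> 0 <= f x) -> 0 <= Rsum s f.
Proof.
  intros H. induction s as [|x s IH]; unfold Rsum in *; simpl; [lra|].
  apply Rplus_le_le_0_compat; [apply H; left; reflexivity|].
  apply IH. intros; apply H; right; assumption.
Qed.

Lemma Rsum_plus (s : list nat) (f g : nat -> R) :
  Rsum s (fun x => f x + g x) = Rsum s f + Rsum s g.
Proof.
  induction s as [|x s IH]; unfold Rsum in *; simpl; [ring|]. rewrite IH. ring.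
Qed.

Lemma Rsum_scal (s : list nat) (c : R) (f : nat -> R) :
  Rsum s (fun x => c * f x) = c * Rsum s f.
Proof.
  induction s as [|x s IH]; unfold Rsum in *; simpl; [ring|]. rewrite IH. ring.
Qed.

Lemma Rsum_inv_sqr_tail (T K : nat) (M : R) :
  (1 <= T)%nat -> 0 <= M ->
  Rsum (seq (S T) K) (fun t => M / INR t ^ 2) <= M / INR T.
Proof.
  intros hT hM. assert (hT1 : 1 <= INR T) by (apply (le_INR 1); exact hT).
  assert (H : Rsum (seq (S T) K) (fun t => M / INR t ^ 2) <= M / INR T - M / INR (T + K)).
  { induction K as [|K IH].
    - rewrite Nat.add_0_r. unfold Rsum. simpl. lra.
    - rewrite Rsum_seq_S. replace (S T + K)%nat with (S (T + K)) by lia.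
      replace (T + S K)%nat with (S (T + K)) by lia.
      assert (h1 : 1 <= INR (T + K)) by (apply (le_INR 1); lia).
      rewrite S_INR. set (y := INR (T + K)) in *.
      assert (M / (y + 1) ^ 2 <= M / y - M / (y + 1)); [|lra].
      replace (M / y - M / (y + 1)) with (M / (y * (y + 1))) by (field; lra).
      unfold Rdiv. apply Rmult_le_compat_l; [exact hM|].
      apply Rinv_le_contravar; nra. }
  assert (0 <= M / INR (T + K)); [|lra].
  apply Rmult_le_pos; [exact hM|]. left. apply Rinv_0_lt_compat. apply (lt_INR 0). lia.
Qed.

Lemma Rsum_inv_sqr (K : nat) (M : R) :
  0 <= M -> Rsum (seq 1 K) (fun t => M / INR t ^ 2) <= 2 * M.
Proof.
  intros hM. destruct K as [|K]; [unfold Rsum; simpl; lra|].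
  change (seq 1 (S K)) with ([1%nat] ++ seq 2 K). rewrite Rsum_app.
  assert (h := Rsum_inv_sqr_tail 1 K M (Nat.le_refl _) hM).
  unfold Rsum at 1. simpl in *. lra.
Qed.

(** Dominated convergence. The bound is uniform in the number N of terms because the lengths of the
    products to which it is applied grow with m. *)
Lemma Rsum_dominated (X : nat -> nat -> R) (x : nat -> R) (M : R) :
  0 <= M ->
  (forall m t, (1 <= t)%nat -> Rabs (X m t) <= M / INR t ^ 2) ->
  (forall t, (1 <= t)%nat -> Rabs (x t) <= M / INR t ^ 2) ->
  (forall t, (1 <= t)%nat -> is_lim_seq (fun m => X m t) (x t)) ->
  forall e, 0 < e -> exists m0, forall m N, (m0 <= m)%nat ->
    Rsum (seq 1 N) (fun t => Rabs (X m t - x t)) <= e.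
Proof.
  intros hM hX hx hlim e he.
  destruct (INR_unbounded (4 * M / e)) as [T0 hT0]. set (T := S T0).
  assert (hT : 2 * M / INR T <= e / 2).
  { unfold T. rewrite S_INR. assert (h0 := pos_INR T0).
    apply Rmult_le_reg_r with (INR T0 + 1); [lra|].
    replace (2 * M / (INR T0 + 1) * (INR T0 + 1)) with (2 * M) by (field; lra).
    assert (4 * M < e * INR T0); [|lra].
    apply Rmult_lt_reg_r with (/ e); [apply Rinv_0_lt_compat; exact he|].
    replace (e * INR T0 * / e) with (INR T0) by (field; lra). exact hT0. }
  assert (hhead : forall K, exists m0, forall m, (m0 <= m)%nat ->
            Rsum (seq 1 K) (fun t => Rabs (X m t - x t)) <= e / 2).
  { intros K.
    assert (hs : is_lim_seq (fun m => Rsum (seq 1 K) (fun t => Rabs (X m t - x t))) 0).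
    { induction K as [|K IH].
      - apply is_lim_seq_const.
      - apply is_lim_seq_ext with (fun m => Rsum (seq 1 K) (fun t => Rabs (X m t - x t))
            + Rabs (X m (1 + K)%nat - x (1 + K)%nat)).
        + intros m. rewrite Rsum_seq_S. reflexivity.
        + rewrite <- (Rplus_0_r 0). apply is_lim_seq_plus'; [exact IH|].
          apply (proj1 (is_lim_seq_abs_0 _)).
          rewrite <- (Rminus_diag (x (1 + K)%nat)).
          apply is_lim_seq_minus'; [apply hlim; lia|apply is_lim_seq_const]. }
    apply is_lim_seq_spec in hs.
    assert (he2 : 0 < e / 2) by lra.
    destruct (hs (mkposreal _ he2)) as [m0 h0]. exists m0. intros m hm.
    specialize (h0 m hm). simpl in h0. rewrite Rminus_0_r in h0.
    apply Rabs_def2 in h0. lra. }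
  destruct (hhead T) as [m0 h0]. exists m0. intros m N hm.
  specialize (h0 m hm).
  destruct (Nat.le_gt_cases N T) as [hN|hN].
  - replace T with (N + (T - N))%nat in h0 by lia. rewrite seq_app, Rsum_app in h0.
    assert (h1 : 0 <= Rsum (seq (1 + N) (T - N)) (fun t => Rabs (X m t - x t)))
      by (apply Rsum_nonneg; intros; apply Rabs_pos). lra.
  - replace N with (T + (N - T))%nat by lia. rewrite seq_app, Rsum_app.
    assert (h1 : Rsum (seq (1 + T) (N - T)) (fun t => Rabs (X m t - x t)) <= 2 * M / INR T).
    { eapply Rle_trans; [|apply (Rsum_inv_sqr_tail T (N - T) (2 * M)); [unfold T; lia|lra]].
      apply Rsum_le. intros t ht. apply in_seq in ht.
      assert (a1 := hX m t ltac:(lia)). assert (a2 := hx t ltac:(lia)).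
      replace (2 * M / INR t ^ 2) with (M / INR t ^ 2 + M / INR t ^ 2)
        by (unfold Rdiv; ring).
      eapply Rle_trans; [apply Rabs_triang|]. rewrite Rabs_Ropp. lra. }
    lra.
Qed.

Lemma Rprod_le_exp (s : list nat) (x : nat -> R) :
  Rabs (Rprod s (fun t => 1 - x t)) <= exp (Rsum s (fun t => Rabs (x t))).
Proof.
  induction s as [|t s IH]; unfold Rprod, Rsum in *; simpl.
  - rewrite Rabs_R1, exp_0. lra.
  - rewrite Rabs_mult, exp_plus. apply Rmult_le_compat; try apply Rabs_pos; [|exact IH].
    eapply Rle_trans; [|apply exp_ineq1_le].
    eapply Rle_trans; [apply Rabs_triang|]. rewrite Rabs_Ropp, Rabs_R1. lra.
Qed.

Lemma Rprod_diff (s : list nat) (x y : nat -> R) :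
  Rabs (Rprod s (fun t => 1 - x t) - Rprod s (fun t => 1 - y t)) <=
  exp (Rsum s (fun t => Rabs (x t)) + Rsum s (fun t => Rabs (y t)))
  * Rsum s (fun t => Rabs (x t - y t)).
Proof.
  induction s as [|t s IH].
  - unfold Rprod, Rsum. simpl. rewrite Rminus_diag, Rabs_R0. lra.
  - assert (hy := Rprod_le_exp s y).
    assert (hx0 : 0 <= Rsum s (fun t => Rabs (x t)))
      by (apply Rsum_nonneg; intros; apply Rabs_pos).
    assert (hd0 : 0 <= Rsum s (fun t => Rabs (x t - y t)))
      by (apply Rsum_nonneg; intros; apply Rabs_pos).
    change (Rprod (t :: s) (fun t => 1 - x t)) with ((1 - x t) * Rprod s (fun t => 1 - x t)).
    change (Rprod (t :: s) (fun t => 1 - y t)) with ((1 - y t) * Rprod s (fun t => 1 - y t)).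
    change (Rsum (t :: s) (fun t => Rabs (x t))) with
      (Rabs (x t) + Rsum s (fun t => Rabs (x t))).
    change (Rsum (t :: s) (fun t => Rabs (y t))) with
      (Rabs (y t) + Rsum s (fun t => Rabs (y t))).
    change (Rsum (t :: s) (fun t => Rabs (x t - y t))) with
      (Rabs (x t - y t) + Rsum s (fun t => Rabs (x t - y t))).
    set (A := Rprod s (fun t => 1 - x t)) in *. set (B := Rprod s (fun t => 1 - y t)) in *.
    set (SX := Rsum s (fun t => Rabs (x t))) in *.
    set (SY := Rsum s (fun t => Rabs (y t))) in *.
    set (SD := Rsum s (fun t => Rabs (x t - y t))) in *.
    replace ((1 - x t) * A - (1 - y t) * B) with ((1 - x t) * (A - B) + - ((x t - y t) * B)) by ring.
    eapply Rle_trans; [apply Rabs_triang|]. rewrite Rabs_Ropp, !Rabs_mult.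
    assert (h1 : Rabs (1 - x t) <= exp (Rabs (x t))).
    { eapply Rle_trans; [|apply exp_ineq1_le].
      eapply Rle_trans; [apply Rabs_triang|]. rewrite Rabs_Ropp, Rabs_R1. lra. }
    replace (Rabs (x t) + SX + (Rabs (y t) + SY)) with (Rabs (x t) + (SX + SY) + Rabs (y t)) by ring.
    rewrite (exp_plus _ (Rabs (y t))), (exp_plus (Rabs (x t))).
    assert (hy1 : 1 <= exp (Rabs (y t))).
    { rewrite <- exp_0.
      destruct (Rabs_pos (y t)) as [h|h]; [left; apply exp_increasing; exact h|rewrite <- h; lra]. }
    assert (hx1 : 1 <= exp (Rabs (x t))).
    { rewrite <- exp_0.
      destruct (Rabs_pos (x t)) as [h|h]; [left; apply exp_increasing; exact h|rewrite <- h; lra]. }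
    assert (hB : Rabs B <= exp (SX + SY)).
    { eapply Rle_trans; [exact hy|]. destruct hx0 as [h|h].
      - left. apply exp_increasing. lra.
      - rewrite <- h, Rplus_0_l. lra. }
    assert (hdt := Rabs_pos (x t - y t)). assert (hAB := Rabs_pos (A - B)).
    set (E1 := exp (Rabs (x t))) in *. set (E2 := exp (Rabs (y t))) in *.
    set (E0 := exp (SX + SY)) in *.
    assert (hE0 : 0 < E0) by apply exp_pos.
    apply Rle_trans with (E1 * (E0 * SD) + Rabs (x t - y t) * E0).
    + apply Rplus_le_compat.
      * apply Rmult_le_compat; auto. apply Rabs_pos.
      * apply Rmult_le_compat_l; auto.
    + apply Rle_trans with (E1 * E0 * (Rabs (x t - y t) + SD)).
      * rewrite Rmult_plus_distr_l. assert (1 * (E0 * Rabs (x t - y t)) <= E1 * (E0 * Rabs (x t - y t))).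
        { apply Rmult_le_compat_r; [nra|exact hx1]. } lra.
      * apply Rmult_le_compat_r; [lra|]. rewrite <- (Rmult_1_r (E1 * E0)) at 1.
        apply Rmult_le_compat_l; [nra|exact hy1].
Qed.

(** * The infinite product as an entire power series *)

Definition inv_sqr_bounded (x : nat -> R) (M : R) : Prop :=
  0 <= M /\ forall t, (1 <= t)%nat -> 0 <= x t <= M / INR t ^ 2.

(** Elementary symmetric polynomials of x_1, ..., x_N, by splitting off x_N. Up to sign they are the
    coefficients of the partial product; in the limit they give a power series, so smoothness
    follows without estimates on derivatives of products. For x >= 0 they increase with N. *)
Fixpoint esym (x : nat -> R) (N j : nat) : R :=
  match N with
  | O => match j with O => 1 | S _ => 0 end
  | S N' => esym x N' j + x N * match j with O => 0 | S j' => esym x N' j' end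
  end.

Definition esym_lim (x : nat -> R) (j : nat) : R := real (Lim_seq (fun N => esym x N j)).

Definition signed (e : nat -> R) (j : nat) : R := (-1) ^ j * e j.

(* Value at z of the infinite product of the 1 - z x_t, see
   [entire_prod_error]. *)
Definition entire_prod (x : nat -> R) (z : R) : R := PSeries (signed (esym_lim x)) z.

Definition part_prod (x : nat -> R) (N : nat) (z : R) : R :=
  Rprod (seq 1 N) (fun t => 1 - z * x t).

Lemma part_prod_S (x : nat -> R) (N : nat) (z : R) :
  part_prod x (S N) z = part_prod x N z * (1 - z * x (S N)).
Proof. apply (Rprod_seq_S 1 N). Qed.

Lemma is_pseries_part_prod (x : nat -> R) (N : nat) (z : R) :
  is_pseries (signed (esym x N)) z (part_prod x N z).
Proof.
  induction N as [|N IH].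
  - unfold part_prod, Rprod. simpl.
    apply is_pseries_R. apply is_series_ext with (fun n => match n with O => 1 | S _ => 0 end).
    + intros [|n]; unfold signed; simpl; ring.
    + apply (is_series_decr_1 (fun n : nat => match n with O => 1 | S _ => 0 end)).
      change (is_series (fun _ : nat => 0) (1 + - 1)). rewrite Rplus_opp_r.
      unfold is_series. apply filterlim_ext with (fun _ => 0).
      * intros n. symmetry. rewrite sum_n_const. ring.
      * apply filterlim_const.
  - rewrite part_prod_S.
    apply is_pseries_ext with (PS_plus (signed (esym x N))
      (PS_scal (- x (S N)) (PS_incr_1 (signed (esym x N))))).
    + intros [|n]; unfold PS_plus, PS_scal, PS_incr_1, signed, plus, scal, mult, zero; simpl;
        unfold mult; simpl; ring.
    + assert (h := is_pseries_plus (K := R_AbsRing) (V := R_NormedModule)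
        (signed (esym x N)) (PS_scal (- x (S N)) (PS_incr_1 (signed (esym x N)))) z
        (part_prod x N z) (- x (S N) * (z * part_prod x N z))).
      replace (part_prod x N z * (1 - z * x (S N))) with
        (part_prod x N z + (- x (S N) * (z * part_prod x N z))) by ring.
      apply h; [exact IH|].
      apply (is_pseries_scal (K := R_AbsRing) (V := R_NormedModule) (- x (S N))
        (PS_incr_1 (signed (esym x N))) z (z * part_prod x N z)); [apply Rmult_comm|].
      apply (is_pseries_incr_1 (K := R_AbsRing) (V := R_NormedModule)). exact IH.
Qed.

Lemma Rsum_inv_sqr_bounded (x : nat -> R) (M : R) (N : nat) :
  inv_sqr_bounded x M -> 0 <= Rsum (seq 1 N) x <= 2 * M.
Proof.
  intros (hM & hx). split.
  - apply Rsum_nonneg. intros t ht. apply in_seq in ht. apply hx. lia.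
  - eapply Rle_trans; [|apply (Rsum_inv_sqr N M hM)].
    apply Rsum_le. intros t ht. apply in_seq in ht. apply hx. lia.
Qed.

Lemma esym_nonneg (x : nat -> R) (N j : nat) :
  (forall t, (1 <= t)%nat -> 0 <= x t) -> 0 <= esym x N j.
Proof.
  intros hx. revert j. induction N as [|N IH]; intros j; simpl.
  - destruct j; lra.
  - apply Rplus_le_le_0_compat; [apply IH|]. apply Rmult_le_pos; [apply hx; lia|].
    destruct j; [lra|apply IH].
Qed.

Lemma esym_incr (x : nat -> R) (N j : nat) :
  (forall t, (1 <= t)%nat -> 0 <= x t) -> esym x N j <= esym x (S N) j.
Proof.
  intros hx. simpl.
  assert (0 <= x (S N) * match j with O => 0 | S j' => esym x N j' end); [|lra].
  apply Rmult_le_pos; [apply hx; lia|]. destruct j; [lra|apply esym_nonneg; exact hx].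
Qed.

Lemma pow_add_ge (S y : R) (j : nat) :
  0 <= S -> 0 <= y -> S ^ (j + 1) + INR (j + 1) * y * S ^ j <= (S + y) ^ (j + 1).
Proof.
  intros hS hy. induction j as [|j IH]; [simpl; lra|].
  replace (Datatypes.S j + 1)%nat with (Datatypes.S (j + 1)) by lia.
  rewrite S_INR. simpl pow.
  assert (h1 := pow_le S j hS).
  assert (h3 : 0 <= INR (j + 1)) by apply pos_INR.
  rewrite Nat.add_1_r in *. simpl pow in *.
  set (A := S ^ j) in *. set (B := (S + y) ^ j) in *. set (n := INR (Datatypes.S j)) in *.
  assert (h4 : (S + y) * (S * A + n * y * A) <= (S + y) * ((S + y) * B))
    by (apply Rmult_le_compat_l; lra).
  assert (0 <= n * (y * y) * A) by (apply Rmult_le_pos; [apply Rmult_le_pos; nra|exact h1]).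
  nra.
Qed.

(** As in the multinomial theorem, j! e_j is a part of the expansion of (x_1 + ... + x_N)^j. The
    inductive step keeps two terms of the binomial expansion, by [pow_add_ge]. *)
Lemma esym_le (x : nat -> R) (N j : nat) :
  (forall t, (1 <= t)%nat -> 0 <= x t) ->
  esym x N j <= Rsum (seq 1 N) x ^ j / INR (fact j).
Proof.
  intros hx. revert j. induction N as [|N IH]; intros j.
  - destruct j as [|j]; simpl; [lra|]. unfold Rsum. simpl.
    rewrite !Rmult_0_l. unfold Rdiv. rewrite Rmult_0_l. lra.
  - rewrite Rsum_seq_S. change (1 + N)%nat with (S N).
    assert (hS : 0 <= Rsum (seq 1 N) x).
    { apply Rsum_nonneg. intros t ht. apply in_seq in ht. apply hx. lia. }
    set (s := Rsum (seq 1 N) x) in *. assert (hy := hx (S N) ltac:(lia)).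
    destruct j as [|j].
    + specialize (IH 0%nat). simpl in *. lra.
    + assert (h1 := IH (S j)). assert (h0 := IH j).
      assert (hf : 0 < INR (fact j)) by (apply (lt_INR 0), lt_O_fact).
      assert (hj : 0 < INR (S j)) by (apply (lt_INR 0); lia).
      assert (hp := pow_add_ge s (x (S N)) j hS hy). rewrite Nat.add_1_r in hp.
      rewrite fact_simpl, mult_INR in *.
      change (esym x (S N) (S j)) with (esym x N (S j) + x (S N) * esym x N j).
      apply Rle_trans with (s ^ S j / (INR (S j) * INR (fact j))
                            + x (S N) * (s ^ j / INR (fact j))).
      * apply Rplus_le_compat; [exact h1|]. apply Rmult_le_compat_l; assumption.
      * replace (s ^ S j / (INR (S j) * INR (fact j)) + x (S N) * (s ^ j / INR (fact j)))
          with ((s ^ S j + INR (S j) * x (S N) * s ^ j) / (INR (S j) * INR (fact j)))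
          by (field; lra).
        unfold Rdiv. apply Rmult_le_compat_r; [|exact hp].
        left. apply Rinv_0_lt_compat. nra.
Qed.

Lemma esym_bound (x : nat -> R) (M : R) (N j : nat) :
  inv_sqr_bounded x M -> 0 <= esym x N j <= (2 * M) ^ j / INR (fact j).
Proof.
  intros hb. assert (hx : forall t, (1 <= t)%nat -> 0 <= x t)
    by (intros t ht; apply hb; exact ht).
  split; [apply esym_nonneg; exact hx|].
  eapply Rle_trans; [apply esym_le; exact hx|].
  assert (hs := Rsum_inv_sqr_bounded x M N hb).
  unfold Rdiv. apply Rmult_le_compat_r.
  - left. apply Rinv_0_lt_compat. apply (lt_INR 0), lt_O_fact.
  - apply pow_incr. exact hs.
Qed.

Lemma esym_lim_correct (x : nat -> R) (M : R) (j : nat) :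
  inv_sqr_bounded x M -> is_lim_seq (fun N => esym x N j) (esym_lim x j).
Proof.
  intros hb. assert (hx : forall t, (1 <= t)%nat -> 0 <= x t)
    by (intros t ht; apply hb; exact ht).
  destruct (ex_finite_lim_seq_incr (fun N => esym x N j) ((2 * M) ^ j / INR (fact j))) as [l hl].
  - intros N. apply esym_incr. exact hx.
  - intros N. apply esym_bound. exact hb.
  - unfold esym_lim. rewrite (is_lim_seq_unique _ _ hl). exact hl.
Qed.

Lemma esym_lim_bound (x : nat -> R) (M : R) (j : nat) :
  inv_sqr_bounded x M -> 0 <= esym_lim x j <= (2 * M) ^ j / INR (fact j).
Proof.
  intros hb. assert (hl := esym_lim_correct x M j hb). split.
  - apply (is_lim_seq_le (fun _ => 0) _ 0 (esym_lim x j)) with (3 := hl).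
    + intros N. apply (esym_bound x M N j hb).
    + apply is_lim_seq_const.
  - apply (is_lim_seq_le _ (fun _ => (2 * M) ^ j / INR (fact j)) (esym_lim x j)
             ((2 * M) ^ j / INR (fact j))) with (2 := hl).
    + intros N. apply (esym_bound x M N j hb).
    + apply is_lim_seq_const.
Qed.

(** Every new variable x_i adds x_i e_j, and the x_i beyond N sum to at most M / N. The bound is
    thus 1 / N times coefficients of an exponential series. *)
Lemma esym_tail (x : nat -> R) (M : R) (N j : nat) :
  inv_sqr_bounded x M -> (1 <= N)%nat ->
  0 <= esym_lim x (S j) - esym x N (S j) <= M / INR N * ((2 * M) ^ j / INR (fact j)).
Proof.
  intros hb hN. assert (hx : forall t, (1 <= t)%nat -> 0 <= x t)
    by (intros t ht; apply hb; exact ht).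
  set (c := (2 * M) ^ j / INR (fact j)).
  assert (hc : 0 <= c).
  { assert (h := esym_bound x M 0 j hb). unfold c. lra. }
  assert (H : forall K, 0 <= esym x (N + K) (S j) - esym x N (S j) <=
                        Rsum (seq (S N) K) x * c).
  { induction K as [|K IH].
    - rewrite Nat.add_0_r. unfold Rsum. simpl. lra.
    - rewrite Rsum_seq_S. rewrite Nat.add_succ_r.
      change (esym x (S (N + K)) (S j)) with
        (esym x (N + K) (S j) + x (S (N + K)) * esym x (N + K) j).
      change (S N + K)%nat with (S (N + K)).
      assert (h1 := esym_bound x M (N + K) j hb). fold c in h1.
      assert (h2 := hx (S (N + K)) ltac:(lia)).
      assert (0 <= x (S (N + K)) * esym x (N + K) j <= x (S (N + K)) * c).
      { split; [apply Rmult_le_pos; lra|apply Rmult_le_compat_l; lra]. }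
      lra. }
  assert (H' : forall K, 0 <= esym x (K + N) (S j) - esym x N (S j) <= M / INR N * c).
  { intros K. rewrite Nat.add_comm. split; [apply H|].
    eapply Rle_trans; [apply H|]. apply Rmult_le_compat_r; [exact hc|].
    eapply Rle_trans; [|apply (Rsum_inv_sqr_tail N K M hN); apply hb].
    apply Rsum_le. intros t ht. apply in_seq in ht. apply hb. lia. }
  assert (hl : is_lim_seq (fun K => esym x (K + N) (S j) - esym x N (S j))
                 (esym_lim x (S j) - esym x N (S j))).
  { apply is_lim_seq_minus'; [|apply is_lim_seq_const].
    apply (is_lim_seq_incr_n (fun K => esym x K (S j))).
    apply (esym_lim_correct x M). exact hb. }
  split.
  - apply (is_lim_seq_le (fun _ => 0) _ 0 (esym_lim x (S j) - esym x N (S j))) with (3 := hl).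
    + intros K. apply H'.
    + apply is_lim_seq_const.
  - apply (is_lim_seq_le _ (fun _ => M / INR N * c)
             (esym_lim x (S j) - esym x N (S j)) (M / INR N * c)) with (2 := hl).
    + intros K. apply H'.
    + apply is_lim_seq_const.
Qed.

Lemma is_series_exp (y : R) : is_series (fun j => y ^ j / INR (fact j)) (exp y).
Proof.
  assert (h := is_exp_Reals y). apply is_pseries_R in h.
  eapply is_series_ext; [|exact h]. intros n. simpl. unfold Rdiv. ring.
Qed.

Lemma ex_pseries_of_exp_bound (a : nat -> R) (S z : R) :
  (forall j, Rabs (a j) <= S ^ j / INR (fact j)) -> ex_pseries a z.
Proof.
  intros H. apply ex_pseries_R.
  apply (ex_series_le (V := R_CompleteNormedModule) (fun n => a n * z ^ n)
    (fun j => (S * Rabs z) ^ j / INR (fact j))).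
  - intros n. change (norm (a n * z ^ n)) with (Rabs (a n * z ^ n)).
    rewrite Rabs_mult, <- RPow_abs, Rpow_mult_distr.
    replace (S ^ n * Rabs z ^ n / INR (fact n)) with (S ^ n / INR (fact n) * Rabs z ^ n)
      by (unfold Rdiv; ring).
    apply Rmult_le_compat_r; [apply pow_le, Rabs_pos|apply H].
  - exists (exp (S * Rabs z)). apply is_series_exp.
Qed.

Lemma signed_abs (e : nat -> R) (j : nat) : 0 <= e j -> Rabs (signed e j) = e j.
Proof.
  intros h. unfold signed. rewrite Rabs_mult, pow_1_abs, Rmult_1_l. apply Rabs_pos_eq, h.
Qed.

Lemma ex_pseries_esym_lim (x : nat -> R) (M z : R) :
  inv_sqr_bounded x M -> ex_pseries (signed (esym_lim x)) z.
Proof.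
  intros hb. apply ex_pseries_of_exp_bound with (2 * M). intros j.
  assert (h := esym_lim_bound x M j hb). rewrite signed_abs; lra.
Qed.

(** The two power series share the constant term 1. After one factor z is taken out, the
    coefficients of the difference are bounded by [esym_tail] and sum to the exponential. *)
Lemma entire_prod_error (x : nat -> R) (M : R) (N : nat) (z : R) :
  inv_sqr_bounded x M -> (1 <= N)%nat ->
  Rabs (part_prod x N z - entire_prod x z) <= M / INR N * Rabs z * exp (2 * M * Rabs z).
Proof.
  intros hb hN.
  assert (hp := is_pseries_part_prod x N z).
  assert (hex1 : ex_pseries (signed (esym x N)) z) by (eexists; exact hp).
  assert (hex2 := ex_pseries_esym_lim x M z hb).
  unfold entire_prod. rewrite <- (is_pseries_unique _ _ _ hp), <- PSeries_minus by assumption.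
  set (D := PS_minus (signed (esym x N)) (signed (esym_lim x))).
  assert (hD0 : D 0%nat = 0).
  { unfold D, PS_minus, PS_plus, PS_opp, signed, plus, opp. simpl.
    assert (e0 : forall N, esym x N 0 = 1).
    { clear. induction N as [|N IH]; simpl; [reflexivity|]. rewrite IH. ring. }
    assert (e1 : esym_lim x 0 = 1).
    { unfold esym_lim. rewrite (Lim_seq_ext _ (fun _ => 1)) by exact e0.
      rewrite Lim_seq_const. reflexivity. }
    rewrite e0, e1. ring. }
  set (tau := M / INR N).
  assert (hDS : forall j, Rabs (D (S j)) <= tau * ((2 * M) ^ j / INR (fact j))).
  { intros j. assert (h := esym_tail x M N j hb hN).
    change (D (S j)) with ((-1) ^ S j * esym x N (S j) + - ((-1) ^ S j * esym_lim x (S j))).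
    replace ((-1) ^ S j * esym x N (S j) + - ((-1) ^ S j * esym_lim x (S j))) with
      (- ((-1) ^ S j * (esym_lim x (S j) - esym x N (S j)))) by ring.
    rewrite Rabs_Ropp, Rabs_mult, pow_1_abs, Rmult_1_l, Rabs_pos_eq; [apply h|apply h]. }
  assert (hs := is_series_exp (2 * M * Rabs z)).
  assert (hdec : PSeries D z = z * PSeries (PS_decr_1 D) z).
  { rewrite PSeries_decr_1; [rewrite hD0; ring|]. apply ex_pseries_minus; assumption. }
  rewrite hdec, Rabs_mult.
  replace (tau * Rabs z * exp (2 * M * Rabs z)) with
    (Rabs z * (tau * exp (2 * M * Rabs z))) by ring.
  apply Rmult_le_compat_l; [apply Rabs_pos|].
  assert (hb2 : forall j, 0 <= Rabs (PS_decr_1 D j * z ^ j) <=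
                  tau * ((2 * M * Rabs z) ^ j / INR (fact j))).
  { intros j. split; [apply Rabs_pos|]. unfold PS_decr_1.
    rewrite Rabs_mult, <- RPow_abs, (Rpow_mult_distr (2 * M)).
    replace (tau * ((2 * M) ^ j * Rabs z ^ j / INR (fact j))) with
      (tau * ((2 * M) ^ j / INR (fact j)) * Rabs z ^ j) by (unfold Rdiv; ring).
    apply Rmult_le_compat_r; [apply pow_le, Rabs_pos|apply hDS]. }
  assert (hex : ex_series (fun j => tau * ((2 * M * Rabs z) ^ j / INR (fact j)))).
  { apply (ex_series_scal_l (K := R_AbsRing) (V := R_NormedModule) tau
      (fun j => (2 * M * Rabs z) ^ j / INR (fact j))). exists (exp (2 * M * Rabs z)). exact hs. }
  unfold PSeries.
  eapply Rle_trans; [apply Series_Rabs|].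
  - apply (ex_series_le (V := R_CompleteNormedModule) (fun j => Rabs (PS_decr_1 D j * z ^ j))
      (fun j => tau * ((2 * M * Rabs z) ^ j / INR (fact j)))); [|exact hex].
    intros n. change (norm ?y) with (Rabs y). rewrite Rabs_Rabsolu. apply hb2.
  - eapply Rle_trans; [apply Series_le; [exact hb2|exact hex]|].
    rewrite Series_scal_l, (is_series_unique _ _ hs). apply Rle_refl.
Qed.

Lemma entire_prod_lim (x : nat -> R) (M z : R) :
  inv_sqr_bounded x M -> is_lim_seq (fun N => part_prod x N z) (entire_prod x z).
Proof.
  intros hb.
  assert (H : is_lim_seq (fun N => M * (Rabs z * exp (2 * M * Rabs z)) * / INR N) 0).
  { evar_last.
    - apply is_lim_seq_scal_l. apply is_lim_seq_inv; [apply is_lim_seq_INR|discriminate].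
    - simpl. f_equal. ring. }
  assert (H2 : is_lim_seq (fun N => part_prod x N z - entire_prod x z) 0).
  { apply is_lim_seq_abs_0.
    apply (is_lim_seq_le_le_loc (fun _ => 0) _ _ 0) with (3 := H).
    - exists 1%nat. intros N hN. split; [apply Rabs_pos|].
      eapply Rle_trans; [apply (entire_prod_error x M N z hb hN)|].
      unfold Rdiv. right. ring.
    - apply is_lim_seq_const. }
  apply (is_lim_seq_plus' _ (fun _ => entire_prod x z) _ _) with (2 := is_lim_seq_const _) in H2.
  rewrite Rplus_0_l in H2. eapply is_lim_seq_ext; [|exact H2]. intros N. cbv beta. ring.
Qed.

Lemma Rprod_ge_1_minus_Rsum (s : list nat) (x : nat -> R) :
  Rsum s (fun t => Rabs (x t)) <= 1 ->
  1 - Rsum s (fun t => Rabs (x t)) <= Rabs (Rprod s (fun t => 1 - x t)).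
Proof.
  induction s as [|t s IH].
  - intros _. unfold Rsum, Rprod. simpl. rewrite Rabs_R1. lra.
  - change (Rprod (t :: s) (fun t => 1 - x t)) with ((1 - x t) * Rprod s (fun t => 1 - x t)).
    change (Rsum (t :: s) (fun t => Rabs (x t))) with
      (Rabs (x t) + Rsum s (fun t => Rabs (x t))).
    assert (hp := Rabs_pos (x t)).
    assert (h0 : 0 <= Rsum s (fun t => Rabs (x t)))
      by (apply Rsum_nonneg; intros; apply Rabs_pos).
    intros hle. specialize (IH ltac:(lra)). rewrite Rabs_mult.
    assert (h1 : 1 - Rabs (x t) <= Rabs (1 - x t)).
    { assert (h := Rabs_triang_inv 1 (x t)). rewrite Rabs_R1 in h. exact h. }
    set (S := Rsum s (fun t => Rabs (x t))) in *.
    set (P := Rabs (Rprod s (fun t => 1 - x t))) in *.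
    apply Rle_trans with ((1 - Rabs (x t)) * (1 - S)); [nra|].
    apply Rmult_le_compat; lra.
Qed.

(** Beyond a suitable T the product stays at least 1/2 in absolute value by Weierstrass's
    inequality, and the first T factors are not 0. *)
Lemma entire_prod_neq_0 (x : nat -> R) (M z : R) :
  inv_sqr_bounded x M -> (forall t, (1 <= t)%nat -> 1 - z * x t <> 0) ->
  entire_prod x z <> 0.
Proof.
  intros hb hz. assert (hl := entire_prod_lim x M z hb).
  destruct (INR_unbounded (2 * (Rabs z * M))) as [T0 hT0]. set (T := S T0).
  assert (hzM : 0 <= Rabs z * M) by (apply Rmult_le_pos; [apply Rabs_pos|apply hb]).
  assert (hP : 0 < Rabs (part_prod x T z)).
  { unfold part_prod. rewrite Rprod_abs. apply Rprod_pos. intros t ht. apply in_seq in ht.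
    apply Rabs_pos_lt, hz. lia. }
  assert (hlow : forall K, Rabs (part_prod x T z) / 2 <= Rabs (part_prod x (K + T) z)).
  { intros K. unfold part_prod at 2. rewrite (Nat.add_comm K T), seq_app, Rprod_app, Rabs_mult.
    fold (part_prod x T z).
    assert (hs : Rsum (seq (1 + T) K) (fun t => Rabs (z * x t)) <= 1 / 2).
    { eapply Rle_trans.
      - apply (Rsum_le _ _ (fun t => Rabs z * M / INR t ^ 2)). intros t ht. apply in_seq in ht.
        rewrite Rabs_mult. unfold Rdiv. rewrite Rmult_assoc.
        apply Rmult_le_compat_l; [apply Rabs_pos|].
        assert (h := proj2 hb t ltac:(lia)). rewrite Rabs_pos_eq; apply h.
      - eapply Rle_trans; [apply (Rsum_inv_sqr_tail T K _); [unfold T; lia|exact hzM]|].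
        unfold T. rewrite S_INR. assert (h0 := pos_INR T0).
        apply Rmult_le_reg_r with (INR T0 + 1); [lra|]. field_simplify; lra. }
    assert (h1 := Rprod_ge_1_minus_Rsum (seq (1 + T) K) (fun t => z * x t) ltac:(lra)).
    cbv beta in h1. unfold Rdiv. apply Rmult_le_compat_l; lra. }
  assert (hl2 : is_lim_seq (fun K => Rabs (part_prod x (K + T) z)) (Rabs (entire_prod x z))).
  { apply (is_lim_seq_abs _ (entire_prod x z)).
    apply (is_lim_seq_incr_n (fun K => part_prod x K z)). exact hl. }
  assert (h := is_lim_seq_le (fun _ => Rabs (part_prod x T z) / 2) _
     (Rabs (part_prod x T z) / 2) (Rabs (entire_prod x z)) hlow (is_lim_seq_const _) hl2).
  simpl in h. intros E. rewrite E, Rabs_R0 in h. lra.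
Qed.

(** * Smoothness of the limit function *)

Definition smooth (f : R -> R) : Prop := forall n x, ex_derive_n f n x.

Lemma smooth_PSeries (a : nat -> R) :
  (forall z, ex_pseries a z) -> smooth (PSeries a).
Proof.
  intros ha n x. apply ex_derive_n_PSeries.
  destruct (Rbar_lt_le_dec (Rabs x) (CV_radius a)) as [h|h]; [exact h|exfalso].
  apply (CV_disk_outside a (Rabs x + 1)).
  - assert (h0 := Rabs_pos x). rewrite (Rabs_pos_eq (Rabs x + 1)) by lra.
    eapply Rbar_le_lt_trans; [exact h|]. simpl. lra.
  - apply ex_series_lim_0. apply ex_pseries_R. apply ha.
Qed.

Lemma smooth_comp_affine (f : R -> R) (a b : R) :
  smooth f -> smooth (fun y => f (a * y + b)).
Proof.
  intros hf n x.
  apply (ex_derive_n_comp_scal (fun w => f (w + b))).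
  exists (mkposreal 1 Rlt_0_1). intros y _ k _.
  apply (ex_derive_n_comp_trans f k y b). apply hf.
Qed.

Lemma smooth_scal (f : R -> R) (c : R) : smooth f -> smooth (fun y => c * f y).
Proof.
  intros hf n x. apply ex_derive_n_scal_l. apply hf.
Qed.

Lemma smooth_ext (f g : R -> R) : (forall x, f x = g x) -> smooth f -> smooth g.
Proof.
  intros H hf n x. apply ex_derive_n_ext with f; auto.
Qed.

(** In the variable w = 1 + 2 eps / C the limit function is half of this expression, because 1 + eps
    / C = (1 + w) / 2. *)
Lemma smooth_linear_mult_entire_prod (x : nat -> R) (M : R) :
  inv_sqr_bounded x M -> smooth (fun w => (1 + w) * entire_prod x (w ^ 2)).
Proof.
  intros hb.
  (* The product in w^2 has even powers only, and the factor 1 + w adds a copy shifted by one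
     degree. So each coefficient appears twice in a row, whence n / 2. *)
  set (a := fun n => signed (esym_lim x) (n / 2)).
  assert (H : forall w, is_pseries a w ((1 + w) * entire_prod x (w ^ 2))).
  { intros w. replace ((1 + w) * entire_prod x (w ^ 2)) with
      (entire_prod x (w ^ 2) + w * entire_prod x (w ^ 2)) by ring.
    assert (h := PSeries_correct _ _ (ex_pseries_esym_lim x M (w ^ 2) hb)).
    apply is_pseries_odd_even.
    - eapply is_pseries_ext; [|exact h]. intros n. unfold a.
      rewrite Nat.mul_comm, Nat.div_mul by lia. reflexivity.
    - eapply is_pseries_ext; [|exact h]. intros n. unfold a.
      rewrite Nat.mul_comm, Nat.div_add_l by lia. rewrite Nat.add_0_r. reflexivity. }
  apply smooth_ext with (PSeries a).
  - intros w. apply is_pseries_unique, H.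
  - apply smooth_PSeries. intros z. eexists. apply H.
Qed.

Lemma smooth_continuous (f : R -> R) (x : R) : smooth f -> continuous f x.
Proof.
  intros hf. apply (ex_derive_continuous (V := R_NormedModule)). apply (hf 1%nat x).
Qed.

Lemma ex_derive_n_Rabs (f : R -> R) (n : nat) (x : R) :
  smooth f -> f x <> 0 -> ex_derive_n (fun y => Rabs (f y)) n x.
Proof.
  intros hf hx. assert (hc := smooth_continuous f x hf).
  destruct (Rtotal_order (f x) 0) as [h|[h|h]]; [|contradiction|].
  - apply ex_derive_n_ext_loc with (fun y => (-1) * f y).
    + assert (hl := hc (fun z => z < 0) (open_lt 0 (f x) h)).
      apply (filter_imp (F := locally x)) with (2 := hl). intros y hy.
      rewrite Rabs_left by exact hy. ring.
    + apply ex_derive_n_scal_l, hf.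
  - apply ex_derive_n_ext_loc with f; [|apply hf].
    assert (hl := hc (fun z => 0 < z) (open_gt 0 (f x) h)).
    apply (filter_imp (F := locally x)) with (2 := hl). intros y hy.
    rewrite Rabs_pos_eq by (left; exact hy). reflexivity.
Qed.

(** * Recurrences and uniform convergence *)

Lemma contraction_to_0 (y v : nat -> R) (r : R) :
  0 <= r < 1 -> (forall m, 0 <= y m) -> (forall m, y (S m) <= r * y m + v m) ->
  is_lim_seq v 0 -> is_lim_seq y 0.
Proof.
  intros hr hy hrec hv. apply is_lim_seq_spec. intros eps.
  apply is_lim_seq_spec in hv.
  assert (he := cond_pos eps).
  assert (he1 : 0 < eps / 2 * (1 - r)) by nra.
  destruct (hv (mkposreal _ he1)) as [m0 hm0]. simpl in hm0.
  assert (hb : forall j, y (m0 + j)%nat <= r ^ j * y m0 + eps / 2).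
  { induction j as [|j IH].
    - rewrite Nat.add_0_r. simpl. lra.
    - rewrite Nat.add_succ_r. eapply Rle_trans; [apply hrec|].
      assert (h1 := hm0 (m0 + j)%nat ltac:(lia)). rewrite Rminus_0_r in h1.
      apply Rabs_def2 in h1. simpl. nra. }
  assert (hg : is_lim_seq (fun j => r ^ j * y m0) 0).
  { evar_last.
    - apply is_lim_seq_scal_r. apply is_lim_seq_geom. rewrite Rabs_pos_eq; lra.
    - simpl. f_equal. ring. }
  apply is_lim_seq_spec in hg.
  assert (he2 : 0 < eps / 2) by lra.
  destruct (hg (mkposreal _ he2)) as [j0 hj0]. simpl in hj0.
  exists (m0 + j0)%nat. intros m hm. rewrite Rminus_0_r, Rabs_pos_eq by apply hy.
  assert (h1 := hb (m - m0)%nat). replace (m0 + (m - m0))%nat with m in h1 by lia.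
  assert (h2 := hj0 (m - m0)%nat ltac:(lia)). rewrite Rminus_0_r in h2.
  apply Rabs_def2 in h2. lra.
Qed.

(* The factor x_(m+1) - b x_m grows like a^m unless it is asymptotically
   determined by the right-hand side, so subexponential growth forces
   convergence. *)
Lemma unstable_recurrence (x : nat -> R) (a b kappa : R) :
  1 < a -> Rabs b < 1 ->
  is_lim_seq (fun m => x m / a ^ m) 0 ->
  is_lim_seq (fun m => x (S (S m)) - (a + b) * x (S m) + a * b * x m) kappa ->
  is_lim_seq x (kappa / ((1 - a) * (1 - b))).
Proof.
  intros ha hb hgr hrec.
  assert (hb1 : b < 1) by (apply Rabs_def2 in hb; lra).
  set (xs := kappa / ((1 - a) * (1 - b))).
  assert (hxs : (1 - a) * (1 - b) * xs = kappa) by (unfold xs; field; split; lra).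
  set (X := fun m => x m - xs).
  (* The root b is removed first, so that w satisfies a first-order recurrence with the expanding
     root a and a right-hand side z tending to 0. *)
  set (w := fun m => X (S m) - b * X m).
  set (z := fun m => w (S m) - a * w m).
  assert (hz : is_lim_seq z 0).
  { apply is_lim_seq_ext with
      (fun m => (x (S (S m)) - (a + b) * x (S m) + a * b * x m) - kappa).
    - intros m. unfold z, w, X. rewrite <- hxs. ring.
    - rewrite <- (Rminus_diag kappa). apply is_lim_seq_minus'; [exact hrec|apply is_lim_seq_const]. }
  assert (hpow : forall m, 0 < a ^ m) by (intros m; apply pow_lt; lra).
  assert (hinv : is_lim_seq (fun m => / a ^ m) 0).
  { apply is_lim_seq_ext with (fun m => (/ a) ^ m).
    - intros m. rewrite pow_inv. reflexivity.
    - apply is_lim_seq_geom. rewrite Rabs_pos_eq.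
      + rewrite <- Rinv_1. apply Rinv_lt_contravar; lra.
      + left. apply Rinv_0_lt_compat. lra. }
  assert (hXg : is_lim_seq (fun m => X m / a ^ m) 0).
  { apply is_lim_seq_ext with (fun m => x m / a ^ m - xs * / a ^ m).
    - intros m. unfold X, Rdiv. ring.
    - evar_last.
      + apply is_lim_seq_minus'; [exact hgr|].
        apply (is_lim_seq_scal_l _ xs 0). exact hinv.
      + f_equal. ring. }
  assert (hwg : is_lim_seq (fun m => w m / a ^ m) 0).
  { apply is_lim_seq_ext with (fun m => a * (X (S m) / a ^ S m) - b * (X m / a ^ m)).
    - intros m. unfold w. simpl. assert (h := hpow m). field. lra.
    - evar_last.
      + apply is_lim_seq_minus'.
        * apply (is_lim_seq_scal_l _ a 0).
          apply (is_lim_seq_incr_1 (fun m => X m / a ^ m)). exact hXg.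
        * apply (is_lim_seq_scal_l _ b 0). exact hXg.
      + f_equal. ring. }
  assert (hw : is_lim_seq w 0).
  { apply is_lim_seq_spec. intros eps. assert (he := cond_pos eps).
    apply is_lim_seq_spec in hz.
    assert (he1 : 0 < eps / 2 * (a - 1)) by nra.
    destruct (hz (mkposreal _ he1)) as [m0 hm0]. simpl in hm0.
    exists m0. intros m hm. rewrite Rminus_0_r.
    destruct (Rlt_le_dec (Rabs (w m)) eps) as [h|h]; [exact h|exfalso].
    (* Once |w| reaches eps where z is already small, it grows at least like a^j eps / 2, which
       contradicts w = o(a^m). *)
    assert (hg : forall j, a ^ j * (eps / 2) <= Rabs (w (m + j)%nat) - eps / 2).
    { induction j as [|j IH].
      - rewrite Nat.add_0_r. simpl. lra.
      - rewrite Nat.add_succ_r.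
        assert (h1 := hm0 (m + j)%nat ltac:(lia)). rewrite Rminus_0_r in h1.
        replace (w (S (m + j))) with (a * w (m + j)%nat - - z (m + j)%nat) by (unfold z; ring).
        assert (h2 := Rabs_triang_inv (a * w (m + j)%nat) (- z (m + j)%nat)).
        rewrite Rabs_Ropp, Rabs_mult, (Rabs_pos_eq a) in h2 by lra.
        simpl. nra. }
    apply is_lim_seq_spec in hwg.
    assert (he2 : 0 < eps / 2 * / a ^ m).
    { apply Rmult_lt_0_compat; [lra|apply Rinv_0_lt_compat, hpow]. }
    destruct (hwg (mkposreal _ he2)) as [j0 hj0]. simpl in hj0.
    assert (h1 := hj0 (m + j0)%nat ltac:(lia)). rewrite Rminus_0_r in h1.
    unfold Rdiv in h1. rewrite Rabs_mult, Rabs_inv, (Rabs_pos_eq (a ^ _)) in h1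
      by (left; apply hpow).
    rewrite pow_add in h1. assert (h2 := hg j0).
    assert (hpm := hpow m). assert (hpj := hpow j0).
    apply (Rmult_lt_compat_r (a ^ m * a ^ j0)) in h1; [|nra].
    replace (Rabs (w (m + j0)%nat) * / (a ^ m * a ^ j0) * (a ^ m * a ^ j0)) with
      (Rabs (w (m + j0)%nat)) in h1 by (field; split; lra).
    replace (eps * / 2 * / a ^ m * (a ^ m * a ^ j0)) with (a ^ j0 * (eps / 2)) in h1
      by (field; lra).
    lra. }
  assert (hX : is_lim_seq X 0).
  { apply is_lim_seq_abs_0.
    apply (contraction_to_0 _ (fun m => Rabs (w m)) (Rabs b)).
    - split; [apply Rabs_pos|exact hb].
    - intros m. apply Rabs_pos.
    - intros m. replace (X (S m)) with (b * X m + w m) by (unfold w; ring).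
      rewrite <- Rabs_mult. apply Rabs_triang.
    - apply (proj1 (is_lim_seq_abs_0 w)). exact hw. }
  apply is_lim_seq_ext with (fun m => X m + xs); [intros m; unfold X; ring|].
  replace (Finite xs) with (Finite (0 + xs)) by (f_equal; ring).
  apply is_lim_seq_plus'; [exact hX|apply is_lim_seq_const].
Qed.

(** With a = s^2, one power s^m absorbs the linear numerator by Bernoulli's inequality and the other
    still decays. *)
Lemma linear_over_geom (A B a : R) :
  1 < a -> is_lim_seq (fun m => (A + B * INR m) / a ^ m) 0.
Proof.
  intros ha. set (s := sqrt a).
  assert (hs : 1 < s) by (unfold s; rewrite <- sqrt_1; apply sqrt_lt_1; lra).
  assert (hss : s * s = a) by (apply sqrt_sqrt; lra).
  set (y := s - 1). assert (hy : 0 < y) by (unfold y; lra).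
  assert (hbern : forall m, 1 + INR m * y <= s ^ m).
  { intros m. replace s with (1 + y) by (unfold y; ring). apply poly; exact hy. }
  assert (hg : is_lim_seq (fun m => (Rabs A + Rabs B / y) * (/ s) ^ m) 0).
  { evar_last.
    - apply is_lim_seq_scal_l. apply is_lim_seq_geom. rewrite Rabs_pos_eq.
      + rewrite <- Rinv_1. apply Rinv_lt_contravar; lra.
      + left. apply Rinv_0_lt_compat. lra.
    - simpl. f_equal. ring. }
  apply is_lim_seq_abs_0.
  apply (is_lim_seq_le_le (fun _ => 0) _ _ 0) with (3 := hg); [|apply is_lim_seq_const].
  intros m. split; [apply Rabs_pos|].
  assert (hsm : 0 < s ^ m) by (apply pow_lt; lra).
  replace (a ^ m) with (s ^ m * s ^ m) by (rewrite <- hss, Rpow_mult_distr; reflexivity).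
  rewrite pow_inv. unfold Rdiv at 1. rewrite Rabs_mult, Rabs_inv, (Rabs_pos_eq (s ^ m * s ^ m)) by nra.
  apply Rmult_le_reg_r with (s ^ m * s ^ m); [nra|].
  replace (Rabs (A + B * INR m) * / (s ^ m * s ^ m) * (s ^ m * s ^ m)) with
    (Rabs (A + B * INR m) * (/ (s ^ m * s ^ m) * (s ^ m * s ^ m))) by ring.
  rewrite Rinv_l, Rmult_1_r by nra.
  replace ((Rabs A + Rabs B / y) * / s ^ m * (s ^ m * s ^ m)) with
    ((Rabs A + Rabs B / y) * (s ^ m * (/ s ^ m * s ^ m))) by ring.
  rewrite Rinv_l, Rmult_1_r by lra.
  assert (h1 := hbern m). assert (hm := pos_INR m).
  eapply Rle_trans; [apply Rabs_triang|]. rewrite Rabs_mult, (Rabs_pos_eq (INR m)) by exact hm.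
  assert (h2 := Rabs_pos A). assert (h3 := Rabs_pos B).
  assert (hmy : 0 <= INR m * y) by (apply Rmult_le_pos; lra).
  rewrite Rmult_plus_distr_r. apply Rplus_le_compat.
  { rewrite <- (Rmult_1_r (Rabs A)) at 1. apply Rmult_le_compat_l; lra. }
  unfold Rdiv. rewrite Rmult_assoc. apply Rmult_le_compat_l; [exact h3|].
  apply Rmult_le_reg_l with y; [exact hy|].
  replace (y * (/ y * s ^ m)) with (s ^ m) by (field; lra). lra.
Qed.

(** Locally uniform convergence on the line, stated on balls around 0. The weak inequality survives
    passage to limits; [ucv_CVU] converts it at the end. *)
Definition ucv (f : nat -> R -> R) (g : R -> R) : Prop :=
  forall B e, 0 < e ->
    exists N, forall m y, (N <= m)%nat -> Rabs y <= B -> Rabs (f m y - g y) <= e.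

Definition bounded_on_bounded (g : R -> R) : Prop :=
  forall B, exists M, forall y, Rabs y <= B -> Rabs (g y) <= M.

Lemma continuous_bounded (g : R -> R) :
  (forall x, continuous g x) -> bounded_on_bounded g.
Proof.
  intros hg B. destruct (Rle_lt_dec 0 B) as [hB|hB].
  - assert (hc : forall c, - B <= c <= B -> continuity_pt g c)
      by (intros c _; apply continuity_pt_filterlim, hg).
    destruct (continuity_ab_maj g (- B) B ltac:(lra) hc) as (M1 & h1 & _).
    destruct (continuity_ab_min g (- B) B ltac:(lra) hc) as (M2 & h2 & _).
    exists (Rabs (g M1) + Rabs (g M2)). intros y hy. apply Rabs_le_between in hy.
    specialize (h1 y hy). specialize (h2 y hy). apply Rabs_le.
    assert (a1 := Rle_abs (g M1)). assert (a2 := Rle_abs (- g M2)). rewrite Rabs_Ropp in a2.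
    assert (a3 := Rabs_pos (g M1)). assert (a4 := Rabs_pos (g M2)). lra.
  - exists 0. intros y hy. assert (h := Rabs_pos y). lra.
Qed.

Lemma ucv_ext (f f' : nat -> R -> R) (g g' : R -> R) :
  (forall m y, f m y = f' m y) -> (forall y, g y = g' y) -> ucv f g -> ucv f' g'.
Proof.
  intros h1 h2 H B e he. destruct (H B e he) as [N hN]. exists N. intros m y hm hy.
  rewrite <- h1, <- h2. apply hN; assumption.
Qed.

Lemma ucv_seq (s : nat -> R) (l : R) :
  is_lim_seq s l -> ucv (fun m _ => s m) (fun _ => l).
Proof.
  intros hs B e he. apply is_lim_seq_spec in hs.
  destruct (hs (mkposreal e he)) as [N hN]. exists N. intros m y hm _.
  left. apply (hN m hm).
Qed.

Lemma ucv_const (g : R -> R) : ucv (fun _ => g) g.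
Proof.
  intros B e he. exists 0%nat. intros m y _ _. rewrite Rminus_diag, Rabs_R0. lra.
Qed.

Lemma ucv_plus (f f' : nat -> R -> R) (g g' : R -> R) :
  ucv f g -> ucv f' g' -> ucv (fun m y => f m y + f' m y) (fun y => g y + g' y).
Proof.
  intros h1 h2 B e he.
  destruct (h1 B (e / 2) ltac:(lra)) as [N1 hN1]. destruct (h2 B (e / 2) ltac:(lra)) as [N2 hN2].
  exists (N1 + N2)%nat. intros m y hm hy.
  specialize (hN1 m y ltac:(lia) hy). specialize (hN2 m y ltac:(lia) hy).
  replace (f m y + f' m y - (g y + g' y)) with ((f m y - g y) + (f' m y - g' y)) by ring.
  eapply Rle_trans; [apply Rabs_triang|]. lra.
Qed.

Lemma ucv_mult (f f' : nat -> R -> R) (g g' : R -> R) :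
  bounded_on_bounded g -> bounded_on_bounded g' ->
  ucv f g -> ucv f' g' -> ucv (fun m y => f m y * f' m y) (fun y => g y * g' y).
Proof.
  intros hb hb' h1 h2 B e he.
  destruct (hb B) as [M hM]. destruct (hb' B) as [M' hM'].
  set (K := 1 + Rabs M + Rabs M').
  assert (hK : 1 <= K) by (unfold K; assert (h := Rabs_pos M); assert (h' := Rabs_pos M'); lra).
  set (e1 := Rmin 1 (e / (4 * K))).
  assert (hpos : 0 < e / (4 * K)) by (apply Rdiv_lt_0_compat; lra).
  assert (he1 : 0 < e1) by (unfold e1; apply Rmin_glb_lt; lra).
  destruct (h1 B e1 he1) as [N1 hN1]. destruct (h2 B e1 he1) as [N2 hN2].
  exists (N1 + N2)%nat. intros m y hm hy.
  specialize (hN1 m y ltac:(lia) hy). specialize (hN2 m y ltac:(lia) hy).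
  specialize (hM y hy). specialize (hM' y hy).
  assert (l1 : e1 <= 1) by apply Rmin_l. assert (l2 : e1 <= e / (4 * K)) by apply Rmin_r.
  assert (l3 : 4 * K * e1 <= e).
  { apply Rmult_le_reg_r with (/ (4 * K)); [apply Rinv_0_lt_compat; lra|].
    replace (4 * K * e1 * / (4 * K)) with e1 by (field; lra). exact l2. }
  replace (f m y * f' m y - g y * g' y) with
    ((f m y - g y) * (f' m y - g' y) + (f m y - g y) * g' y + g y * (f' m y - g' y)) by ring.
  eapply Rle_trans; [apply Rabs_triang|].
  eapply Rle_trans; [apply Rplus_le_compat_r, Rabs_triang|].
  rewrite !Rabs_mult.
  assert (m1 := Rle_abs M). assert (m2 := Rle_abs M').
  assert (p1 := Rabs_pos (f m y - g y)). assert (p2 := Rabs_pos (f' m y - g' y)).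
  assert (p3 := Rabs_pos (g y)). assert (p4 := Rabs_pos (g' y)).
  apply Rle_trans with (e1 * 1 + e1 * K + K * e1).
  - apply Rplus_le_compat; [apply Rplus_le_compat|]; apply Rmult_le_compat; try lra;
      unfold K; assert (h := Rabs_pos M); assert (h' := Rabs_pos M'); lra.
  - assert (e1 * 1 <= e1 * K) by (apply Rmult_le_compat_l; lra).
    assert (4 * K * e1 <= e) by exact l3. lra.
Qed.

Lemma ucv_abs (f : nat -> R -> R) (g : R -> R) :
  ucv f g -> ucv (fun m y => Rabs (f m y)) (fun y => Rabs (g y)).
Proof.
  intros H B e he. destruct (H B e he) as [N hN]. exists N. intros m y hm hy.
  eapply Rle_trans; [apply Rabs_triang_inv2|]. apply hN; assumption.
Qed.

(** For nonnegative numbers |f - g|^2 <= |f^2 - g^2|, hence the tolerance e * e. No lower bound on g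
    is needed, so zeros of the limit are harmless. *)
Lemma ucv_of_sqr (f : nat -> R -> R) (g : R -> R) :
  (forall m y, 0 <= f m y) -> (forall y, 0 <= g y) ->
  ucv (fun m y => f m y ^ 2) (fun y => g y ^ 2) -> ucv f g.
Proof.
  intros hf hg H B e he. destruct (H B (e * e) ltac:(nra)) as [N hN].
  exists N. intros m y hm hy. specialize (hN m y hm hy). cbv beta in hN.
  specialize (hf m y). specialize (hg y).
  apply Rabs_le_between in hN. apply Rabs_le.
  destruct (Rle_lt_dec (f m y) (g y)); split; nra.
Qed.

(** Applied at the moving points eps = C_n y of the functional equations, where pointwise
    convergence would not suffice. *)
Lemma ucv_point (f : nat -> R -> R) (g : R -> R) (y : nat -> R) (x : R) :
  ucv f g -> continuous g x -> is_lim_seq y x -> is_lim_seq (fun m => f m (y m)) (g x).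
Proof.
  intros H hg hy.
  assert (hgy : is_lim_seq (fun m => g (y m)) (g x)).
  { apply (is_lim_seq_continuous g y x); [apply continuity_pt_filterlim, hg|exact hy]. }
  assert (hd : is_lim_seq (fun m => f m (y m) - g (y m)) 0).
  { apply is_lim_seq_spec. intros eps. apply is_lim_seq_spec in hy.
    destruct (hy (mkposreal 1 Rlt_0_1)) as [N1 hN1]. simpl in hN1.
    destruct (H (Rabs x + 1) (eps / 2)) as [N2 hN2].
    { assert (h := cond_pos eps). lra. }
    exists (N1 + N2)%nat. intros m hm. rewrite Rminus_0_r.
    eapply Rle_lt_trans; [apply hN2; [lia|]|assert (h := cond_pos eps); lra].
    specialize (hN1 m ltac:(lia)). replace (y m) with (x + (y m - x)) by ring.
    eapply Rle_trans; [apply Rabs_triang|]. lra. }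
  apply is_lim_seq_ext with (fun m => (f m (y m) - g (y m)) + g (y m)); [intros m; ring|].
  rewrite <- (Rplus_0_l (g x)). apply is_lim_seq_plus'; assumption.
Qed.

Lemma ucv_CVU (f : nat -> R -> R) (g : R -> R) (x : R) (r : posreal) :
  ucv f g -> CVU f g x r.
Proof.
  intros H e he. destruct (H (Rabs x + r) (e / 2) ltac:(lra)) as [N hN].
  exists N. intros m y hm hy. unfold Boule in hy. rewrite Rabs_minus_sym.
  eapply Rle_lt_trans; [apply hN; [exact hm|]|lra].
  replace y with (x + (y - x)) by ring.
  eapply Rle_trans; [apply Rabs_triang|]. lra.
Qed.

Lemma sin_cubic_error (x : R) : Rabs (sin x - x) <= 2 * Rabs x ^ 3.
Proof.
  assert (hpos : forall y, 0 <= y -> Rabs (sin y - y) <= 2 * Rabs y ^ 3).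
  { intros y hy. rewrite (Rabs_pos_eq y) by exact hy.
    destruct (Rle_lt_dec y 1) as [h|h].
    - assert (h1 := pre_sin_bound y 0 hy ltac:(lra)). unfold sin_approx, sin_term in h1.
      simpl in h1. assert (hy2 : 0 <= y * y <= 1) by nra.
      assert (hy3 : 0 <= y * y * y) by (apply Rmult_le_pos; lra).
      assert (hy5 : y * y * y * (y * y) <= y * y * y * 1) by (apply Rmult_le_compat_l; lra).
      apply Rabs_le. simpl. lra.
    - assert (h1 := SIN_bound y).
      assert (hy2 : 1 <= y * y) by nra.
      assert (y * 1 <= y * (y * y)) by (apply Rmult_le_compat_l; lra).
      apply Rabs_le. simpl. lra. }
  destruct (Rle_lt_dec 0 x) as [h|h]; [apply hpos; exact h|].
  assert (h1 := hpos (- x) ltac:(lra)). rewrite sin_neg, Rabs_Ropp in h1.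
  replace (- sin x - - x) with (- (sin x - x)) in h1 by ring. rewrite Rabs_Ropp in h1. exact h1.
Qed.

Lemma ucv_sin_rescaled (kap : nat -> R) (w : nat -> R -> R) (g : R -> R) :
  (forall m, 0 < kap m) -> is_lim_seq kap 0 -> bounded_on_bounded g -> ucv w g ->
  ucv (fun m y => sin (kap m * w m y) / kap m) g.
Proof.
  intros hk hk0 hb hw B e he. destruct (hb B) as [M hM].
  destruct (hw B (Rmin 1 (e / 2))) as [N1 hN1]; [apply Rmin_glb_lt; lra|].
  set (K := Rabs M + 1). assert (hK : 1 <= K) by (unfold K; assert (h := Rabs_pos M); lra).
  set (e1 := e / (4 * K ^ 3)).
  assert (hK3 : 1 <= K ^ 3) by (apply pow_R1_Rle; exact hK).
  assert (he1 : 0 < e1) by (unfold e1; apply Rdiv_lt_0_compat; lra).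
  apply is_lim_seq_spec in hk0.
  destruct (hk0 (mkposreal _ (Rmin_glb_lt _ _ _ Rlt_0_1 he1))) as [N2 hN2]. simpl in hN2.
  exists (N1 + N2)%nat. intros m y hm hy.
  specialize (hN1 m y ltac:(lia) hy). specialize (hN2 m ltac:(lia)). specialize (hM y hy).
  rewrite Rminus_0_r in hN2. specialize (hk m). rewrite Rabs_pos_eq in hN2 by lra.
  assert (hk1 : kap m < 1) by (eapply Rlt_le_trans; [exact hN2|apply Rmin_l]).
  assert (hk2 : kap m < e1) by (eapply Rlt_le_trans; [exact hN2|apply Rmin_r]).
  assert (hw1 : Rabs (w m y) <= K).
  { replace (w m y) with (g y + (w m y - g y)) by ring.
    eapply Rle_trans; [apply Rabs_triang|]. unfold K. assert (h := Rle_abs M).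
    assert (h' := Rmin_l 1 (e / 2)). lra. }
  assert (hs := sin_cubic_error (kap m * w m y)).
  rewrite Rabs_mult, (Rabs_pos_eq (kap m)) in hs by lra.
  replace (sin (kap m * w m y) / kap m - g y) with
    ((sin (kap m * w m y) - kap m * w m y) / kap m + (w m y - g y)) by (field; lra).
  eapply Rle_trans; [apply Rabs_triang|].
  assert (h1 : Rabs ((sin (kap m * w m y) - kap m * w m y) / kap m) <= e / 2).
  { unfold Rdiv. rewrite Rabs_mult, Rabs_inv, (Rabs_pos_eq (kap m)) by lra.
    apply Rmult_le_reg_r with (kap m); [exact hk|].
    rewrite Rmult_assoc, Rinv_l, Rmult_1_r by lra.
    eapply Rle_trans; [exact hs|]. rewrite Rpow_mult_distr.
    assert (hw3 : Rabs (w m y) ^ 3 <= K ^ 3) by (apply pow_incr; split; [apply Rabs_pos|exact hw1]).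
    assert (e1K : 4 * K ^ 3 * e1 = e) by (unfold e1; field; lra).
    assert (hk3 : kap m ^ 3 <= e1 * kap m).
    { simpl. assert (kap m * (kap m * 1) <= e1) by nra. nra. }
    assert (0 <= kap m ^ 3) by (apply pow_le; lra).
    assert (0 <= Rabs (w m y) ^ 3) by (apply pow_le, Rabs_pos).
    apply Rle_trans with (2 * (e1 * kap m * K ^ 3)); [|nra].
    apply Rmult_le_compat_l; [lra|]. apply Rmult_le_compat; lra. }
  assert (h2 := Rmin_r 1 (e / 2)). lra.
Qed.

Lemma sin_rescaled_lim (kap w : nat -> R) (l : R) :
  (forall m, 0 < kap m) -> is_lim_seq kap 0 -> is_lim_seq w l ->
  is_lim_seq (fun m => sin (kap m * w m) / kap m) l.
Proof.
  intros hk hk0 hw.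
  apply (ucv_point (fun m _ => sin (kap m * w m) / kap m) (fun _ => l) (fun _ => 0) 0).
  - apply (ucv_sin_rescaled kap (fun m _ => w m)); auto.
    + intros B. exists (Rabs l). intros y _. apply Rle_refl.
    + apply ucv_seq. exact hw.
  - apply continuous_const.
  - apply is_lim_seq_const.
Qed.

(** * Convergence of the normalized Sudler products *)

(** The terms, the argument and the number of factors all vary with m. The domination is assumed
    only for t <= J m, the range in which the sine estimates are available. *)
Lemma ucv_partial_product (X : nat -> nat -> R) (x : nat -> R) (J : nat -> nat) (M : R)
    (zf : nat -> R -> R) (zg : R -> R) :
  inv_sqr_bounded x M ->
  (exists m1, forall m t, (m1 <= m)%nat -> (1 <= t <= J m)%nat -> 0 <= X m t <= M / INR t ^ 2) ->
  (forall t, (1 <= t)%nat -> is_lim_seq (fun m => X m t) (x t)) ->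
  (forall K, exists m1, forall m, (m1 <= m)%nat -> (K <= J m)%nat) ->
  bounded_on_bounded zg -> ucv zf zg ->
  ucv (fun m y => Rprod (seq 1 (J m)) (fun t => 1 - zf m y * X m t))
      (fun y => entire_prod x (zg y)).
Proof.
  intros hx (m1 & hX) hlim hJ hzg hz B e he.
  assert (hM := proj1 hx).
  (* Extension by 0 makes the missing factors equal to 1, so the product may be lengthened to K + J
     m terms and compared with the limit product as K grows. *)
  set (X' := fun m t => if ((m1 <=? m) && (t <=? J m))%nat%bool then X m t else 0).
  assert (hX'b : forall m t, (1 <= t)%nat -> Rabs (X' m t) <= M / INR t ^ 2).
  { intros m t ht. unfold X'.
    assert (h0 : 0 <= M / INR t ^ 2).
    { apply Rmult_le_pos; [exact hM|]. left. apply Rinv_0_lt_compat, pow_lt, (lt_INR 0). lia. }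
    destruct (Nat.leb_spec m1 m); simpl; [|rewrite Rabs_R0; exact h0].
    destruct (Nat.leb_spec t (J m)); [|rewrite Rabs_R0; exact h0].
    destruct (hX m t); [assumption|lia|]. rewrite Rabs_pos_eq; assumption. }
  assert (hxb : forall t, (1 <= t)%nat -> Rabs (x t) <= M / INR t ^ 2).
  { intros t ht. destruct (proj2 hx t ht). rewrite Rabs_pos_eq; assumption. }
  assert (hX'l : forall t, (1 <= t)%nat -> is_lim_seq (fun m => X' m t) (x t)).
  { intros t ht. apply is_lim_seq_ext_loc with (fun m => X m t); [|apply hlim; exact ht].
    destruct (hJ t) as [m2 hm2]. exists (m1 + m2)%nat. intros m hm. unfold X'.
    destruct (Nat.leb_spec m1 m); [|lia]. simpl.
    destruct (Nat.leb_spec t (J m)); [reflexivity|]. specialize (hm2 m ltac:(lia)). lia. }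
  destruct (hzg B) as [R0 hR0]. set (R1 := Rabs R0 + 1).
  assert (hR1 : 1 <= R1) by (unfold R1; assert (h := Rabs_pos R0); lra).
  set (E := exp (R1 * (2 * M) + R1 * (2 * M))). assert (hE : 0 < E) by apply exp_pos.
  set (D := E * (R1 + 2 * M)). assert (hD : 0 < D) by (unfold D; nra).
  set (e1 := Rmin 1 (e / D)).
  assert (heD : 0 < e / D) by (apply Rdiv_lt_0_compat; lra).
  assert (he1 : 0 < e1) by (apply Rmin_glb_lt; lra).
  assert (he1D : D * e1 <= e).
  { apply Rmult_le_reg_r with (/ D); [apply Rinv_0_lt_compat; lra|].
    replace (D * e1 * / D) with e1 by (field; lra). apply Rmin_r. }
  destruct (Rsum_dominated X' x M hM hX'b hxb hX'l e1 he1) as [m2 hm2].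
  destruct (hz B e1 he1) as [m3 hm3].
  exists (m1 + m2 + m3)%nat. intros m y hm hy.
  specialize (hm3 m y ltac:(lia) hy). specialize (hR0 y hy).
  assert (hzy : Rabs (zg y) <= R1) by (unfold R1; assert (h := Rle_abs R0); lra).
  assert (hzm : Rabs (zf m y) <= R1).
  { replace (zf m y) with (zg y + (zf m y - zg y)) by ring.
    eapply Rle_trans; [apply Rabs_triang|]. unfold R1.
    assert (h := Rle_abs R0). assert (h' := Rmin_l 1 (e / D)). fold e1 in h'. lra. }
  set (P := Rprod (seq 1 (J m)) (fun t => 1 - zf m y * X m t)).
  assert (hP : forall K, P = Rprod (seq 1 (K + J m)) (fun t => 1 - zf m y * X' m t)).
  { intros K. rewrite (Nat.add_comm K), seq_app, Rprod_app.
    rewrite (Rprod_const_1 (seq (1 + J m) K)).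
    - rewrite Rmult_1_r. apply Rprod_ext. intros t ht. apply in_seq in ht. unfold X'.
      destruct (Nat.leb_spec m1 m); [|lia]. simpl.
      destruct (Nat.leb_spec t (J m)); [reflexivity|lia].
    - intros t ht. apply in_seq in ht. unfold X'.
      destruct (Nat.leb_spec m1 m); [|lia]. simpl.
      destruct (Nat.leb_spec t (J m)); [lia|ring]. }
  assert (hK : forall K, Rabs (P - part_prod x (K + J m) (zg y)) <= e).
  { intros K. rewrite (hP K). unfold part_prod. set (s := seq 1 (K + J m)).
    eapply Rle_trans; [apply Rprod_diff|].
    assert (b1 : Rsum s (fun t => Rabs (zf m y * X' m t)) <= R1 * (2 * M)).
    { apply Rle_trans with (Rsum s (fun t => R1 * (M / INR t ^ 2))).
      - apply Rsum_le. intros t ht. apply in_seq in ht. rewrite Rabs_mult.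
        apply Rmult_le_compat; try apply Rabs_pos; [exact hzm|apply hX'b; lia].
      - rewrite Rsum_scal. apply Rmult_le_compat_l; [lra|]. apply Rsum_inv_sqr, hM. }
    assert (b2 : Rsum s (fun t => Rabs (zg y * x t)) <= R1 * (2 * M)).
    { apply Rle_trans with (Rsum s (fun t => R1 * (M / INR t ^ 2))).
      - apply Rsum_le. intros t ht. apply in_seq in ht. rewrite Rabs_mult.
        apply Rmult_le_compat; try apply Rabs_pos; [exact hzy|apply hxb; lia].
      - rewrite Rsum_scal. apply Rmult_le_compat_l; [lra|]. apply Rsum_inv_sqr, hM. }
    assert (b3 : Rsum s (fun t => Rabs (zf m y * X' m t - zg y * x t)) <= R1 * e1 + e1 * (2 * M)).
    { apply Rle_trans with (Rsum s (fun t => R1 * Rabs (X' m t - x t) + e1 * (M / INR t ^ 2))).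
      - apply Rsum_le. intros t ht. apply in_seq in ht.
        replace (zf m y * X' m t - zg y * x t) with
          (zf m y * (X' m t - x t) + (zf m y - zg y) * x t) by ring.
        eapply Rle_trans; [apply Rabs_triang|]. rewrite !Rabs_mult.
        apply Rplus_le_compat.
        + apply Rmult_le_compat_r; [apply Rabs_pos|exact hzm].
        + apply Rmult_le_compat; try apply Rabs_pos; [exact hm3|apply hxb; lia].
      - rewrite Rsum_plus, !Rsum_scal. apply Rplus_le_compat.
        + apply Rmult_le_compat_l; [lra|]. apply hm2. lia.
        + apply Rmult_le_compat_l; [lra|]. apply Rsum_inv_sqr, hM. }
    apply Rle_trans with (E * (R1 * e1 + e1 * (2 * M))); [|unfold D in he1D; lra].
    apply Rmult_le_compat; [left; apply exp_pos| | |exact b3].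
    - apply Rsum_nonneg. intros. apply Rabs_pos.
    - unfold E. destruct (Rle_lt_or_eq_dec _ _ (Rplus_le_compat _ _ _ _ b1 b2)) as [h|h].
      + left. apply exp_increasing. exact h.
      + rewrite h. lra. }
  assert (hl := entire_prod_lim x M (zg y) hx).
  assert (hl2 : is_lim_seq (fun K => Rabs (P - part_prod x (K + J m) (zg y)))
                  (Rabs (P - entire_prod x (zg y)))).
  { apply (is_lim_seq_abs _ (P - entire_prod x (zg y))).
    apply is_lim_seq_minus'; [apply is_lim_seq_const|].
    apply (is_lim_seq_incr_n (fun K => part_prod x K (zg y))). exact hl. }
  exact (is_lim_seq_le _ (fun _ => e) (Rabs (P - entire_prod x (zg y))) e hK hl2
           (is_lim_seq_const e)).
Qed.

Definition cf_kap (d : nat -> nat) (n : nat) : R := PI / INR (cf_q d n).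

(** [cf_xi], [sudler_arg], [sudler_shape] and [sudler_const] are x_n(t), z_n(eps), H_n(eps) and K_n.
    The factors C_n / 2 cancel in the product z_n x_n; they are inserted so that the limits are 1 /
    u_k(t)^2 and (1 + 2 eps / C)^2. *)
Definition cf_xi (d : nat -> nat) (n t : nat) : R :=
  (cf_kap d n * (cf_C d n / 2)) ^ 2 / sin (cf_kap d n * cf_N d n t) ^ 2.

Definition sudler_arg (d : nat -> nat) (n : nat) (eps : R) : R :=
  (sin (cf_kap d n * (cf_C d n / 2 + eps)) / cf_kap d n / (cf_C d n / 2)) ^ 2.

Definition sudler_shape (d : nat -> nat) (n : nat) (eps : R) : R :=
  (sin (cf_kap d n * (cf_C d n + eps)) / cf_kap d n / cf_C d n) ^ 2
  * Rabs (Rprod (seq 1 (cf_q d n - 1)) (fun t => 1 - sudler_arg d n eps * cf_xi d n t)).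

Definition sudler_const (d : nat -> nat) (n : nat) : R :=
  4 * (cf_kap d n * cf_C d n) ^ 2
  * Rprod (seq 1 (cf_q d n - 1)) (fun t => 4 * sin (cf_kap d n * cf_N d n t) ^ 2).

Lemma cf_kap_pos (d : nat -> nat) (n : nat) :
  pos_digits d -> (1 <= n)%nat -> 0 < cf_kap d n.
Proof.
  intros hd hn. apply Rdiv_lt_0_compat; [apply PI_RGT_0|].
  apply (lt_INR 0), cf_q_pos; assumption.
Qed.

Lemma cf_C_pos (d : nat -> nat) (n : nat) :
  pos_digits d -> (1 <= n)%nat -> 0 < cf_C d n.
Proof.
  intros hd hn. assert (h1 := cf_C_range d n hd hn). assert (h2 := cf_tail_pos d n hd hn). lra.
Qed.

Lemma sin_cf_N_pos (d : nat -> nat) (n t : nat) :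
  pos_digits d -> (1 <= n)%nat -> (1 <= t <= cf_q d n - 1)%nat ->
  0 < sin (cf_kap d n * cf_N d n t).
Proof.
  intros hd hn ht. assert (hN := cf_N_range d n t hd hn). apply Rabs_le_between in hN.
  assert (hC := cf_C_range d n hd hn).
  assert (h1 : 1 <= INR t) by (apply (le_INR 1); lia).
  assert (h2 : INR t <= INR (cf_q d n) - 1).
  { change 1 with (INR 1). rewrite <- minus_INR by lia. apply le_INR. lia. }
  assert (hpi := PI_RGT_0). unfold cf_kap.
  apply sin_gt_0.
  - apply Rmult_lt_0_compat; [apply Rdiv_lt_0_compat; lra|lra].
  - apply Rmult_lt_reg_r with (INR (cf_q d n)); [lra|].
    replace (PI / INR (cf_q d n) * cf_N d n t * INR (cf_q d n)) with (PI * cf_N d n t)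
      by (field; lra).
    apply Rmult_lt_compat_l; lra.
Qed.

Lemma sudler_sqr_eq (d : nat -> nat) (n : nat) (eps : R) :
  pos_digits d -> (1 <= n)%nat ->
  sudler d n eps ^ 2 = sudler_const d n * sudler_shape d n eps.
Proof.
  intros hd hn. rewrite sudler_sqr by assumption. unfold sudler_const, sudler_shape.
  assert (hk := cf_kap_pos d n hd hn). assert (hC := cf_C_pos d n hd hn).
  assert (hq : 0 < INR (cf_q d n)) by (apply (lt_INR 0), cf_q_pos; assumption).
  rewrite Rprod_abs.
  replace (PI * (cf_C d n + eps) / INR (cf_q d n)) with (cf_kap d n * (cf_C d n + eps))
    by (unfold cf_kap; field; lra).
  set (P1 := Rprod _ (fun t => 4 * sin _ ^ 2)). set (P2 := Rprod _ (fun t => Rabs (1 - _))).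
  transitivity (4 * sin (cf_kap d n * (cf_C d n + eps)) ^ 2 * (P1 * P2)); [|field; lra].
  f_equal. unfold P1, P2. rewrite <- Rprod_mult. apply Rprod_ext. intros t ht.
  apply in_seq in ht. assert (hs := sin_cf_N_pos d n t hd hn ltac:(lia)).
  unfold sudler_arg, cf_xi.
  replace (PI * cf_N d n t / INR (cf_q d n)) with (cf_kap d n * cf_N d n t)
    by (unfold cf_kap; field; lra).
  replace (PI * (cf_C d n / 2 + eps) / INR (cf_q d n)) with
    (cf_kap d n * (cf_C d n / 2 + eps)) by (unfold cf_kap; field; lra).
  rewrite Rmult_assoc. f_equal. set (S := sin (cf_kap d n * cf_N d n t)) in *.
  rewrite <- (Rabs_pos_eq (S ^ 2)) at 2 by apply pow2_ge_0. rewrite <- Rabs_mult. f_equal.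
  field. repeat split; lra.
Qed.

Lemma sudler_const_pos (d : nat -> nat) (n : nat) :
  pos_digits d -> (1 <= n)%nat -> 0 < sudler_const d n.
Proof.
  intros hd hn. unfold sudler_const.
  assert (hk := cf_kap_pos d n hd hn). assert (hC := cf_C_pos d n hd hn).
  apply Rmult_lt_0_compat.
  - assert (0 < (cf_kap d n * cf_C d n) ^ 2) by (apply pow_lt; nra). lra.
  - apply Rprod_pos. intros t ht. apply in_seq in ht.
    assert (hs := sin_cf_N_pos d n t hd hn ltac:(lia)).
    assert (0 < sin (cf_kap d n * cf_N d n t) ^ 2) by (apply pow_lt; exact hs). lra.
Qed.

Lemma sin_cf_N_sym (d : nat -> nat) (n t : nat) :
  pos_digits d -> (1 <= n)%nat -> (1 <= t <= cf_q d n - 1)%nat ->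
  sin (cf_kap d n * cf_N d n (cf_q d n - t)) = sin (cf_kap d n * cf_N d n t).
Proof.
  intros hd hn ht. rewrite cf_N_sym by assumption.
  assert (hq : 0 < INR (cf_q d n)) by (apply (lt_INR 0), cf_q_pos; assumption).
  replace (cf_kap d n * (INR (cf_q d n) - cf_N d n t)) with
    (PI - cf_kap d n * cf_N d n t) by (unfold cf_kap; field; lra).
  apply sin_PI_x.
Qed.

(** The Taylor polynomial of degree 4 already makes cos(17/10) negative. The value is small enough
    for sin y >= y - y^3/6 to give sin y >= y/8 up to 2 pi / 3, and 51/100 y up to pi / 2. *)
Lemma PI_lt_17_5 : PI < 17 / 5.
Proof.
  destruct (Rlt_le_dec PI (17 / 5)) as [h|h]; [exact h|exfalso].
  assert (h1 := cos_ge_0 (17 / 10) ltac:(lra) ltac:(lra)).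
  assert (h2 := proj2 (pre_cos_bound (17 / 10) 0 ltac:(lra) ltac:(lra))).
  unfold cos_approx, cos_term in h2. simpl in h2. lra.
Qed.

(** For t <= q/2, q >= 3 and C_n < 1 the angle is at most 2 pi / 3, where sin y >= y/8; together
    with N >= t/2 this gives 64 = 8^2. Near t = q_n the sine is small again, hence the restriction
    to half of the range. *)
Lemma cf_xi_bound (d : nat -> nat) (n t : nat) :
  pos_digits d -> (1 <= n)%nat -> (3 <= cf_q d n)%nat -> (1 <= t <= cf_q d n / 2)%nat ->
  0 <= cf_xi d n t <= 64 / INR t ^ 2.
Proof.
  intros hd hn hq3 ht.
  assert (hk := cf_kap_pos d n hd hn). assert (hC := cf_C_range d n hd hn).
  assert (hC0 := cf_C_pos d n hd hn).
  assert (hN := cf_N_range d n t hd hn). apply Rabs_le_between in hN.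
  assert (h1 : 1 <= INR t) by (apply (le_INR 1); lia).
  assert (h3 : 3 <= INR (cf_q d n)) by (apply (le_INR 3) in hq3; simpl in hq3; lra).
  assert (h2 : 2 * INR t <= INR (cf_q d n)).
  { change 2 with (INR 2). rewrite <- mult_INR. apply le_INR.
    assert (h := Nat.div_mod_eq (cf_q d n) 2). lia. }
  set (N := cf_N d n t) in *. set (K := cf_kap d n) in *. set (q := INR (cf_q d n)) in *.
  set (y := K * N). assert (hy0 : 0 < y) by (unfold y; nra).
  assert (hy1 : y <= 17 / 5 * (2 / 3)).
  { assert (hpi := PI_lt_17_5). assert (hpi0 := PI_RGT_0).
    apply Rle_trans with (PI * (2 / 3)); [|nra].
    unfold y, K, cf_kap. fold q. apply Rmult_le_reg_r with q; [lra|].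
    replace (PI / q * N * q) with (PI * N) by (field; lra). nra. }
  assert (hs : y / 8 <= sin y).
  { assert (h := proj1 (pre_sin_bound y 0 ltac:(lra) ltac:(lra))).
    unfold sin_approx, sin_term in h. simpl in h.
    assert (hyy : y * y <= 21 / 4) by nra.
    assert (y * (y * y) <= y * (21 / 4)) by (apply Rmult_le_compat_l; lra). lra. }
  unfold cf_xi. fold K N y.
  assert (hs2 : 0 < sin y ^ 2) by (apply pow_lt; lra).
  split.
  - apply Rmult_le_pos; [apply pow2_ge_0|]. left. apply Rinv_0_lt_compat, hs2.
  - apply Rmult_le_reg_r with (sin y ^ 2); [exact hs2|].
    replace ((K * (cf_C d n / 2)) ^ 2 / sin y ^ 2 * sin y ^ 2) with ((K * (cf_C d n / 2)) ^ 2)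
      by (field; lra).
    apply Rmult_le_reg_r with (INR t ^ 2); [apply pow_lt; lra|].
    replace (64 / INR t ^ 2 * sin y ^ 2 * INR t ^ 2) with ((8 * sin y) ^ 2) by (field; lra).
    rewrite <- Rpow_mult_distr. apply pow_incr. split.
    + apply Rmult_le_pos; [|lra]. apply Rmult_le_pos; lra.
    + apply Rle_trans with y; [|lra]. unfold y. rewrite Rmult_assoc.
      apply Rmult_le_compat_l; [lra|]. nra.
Qed.

Lemma cf_kap_lim (d : nat -> nat) (h l k : nat) :
  pos_digits d -> (1 <= l)%nat ->
  is_lim_seq (fun m => cf_kap d (h + m * l + k)) 0.
Proof.
  intros hd hl. unfold cf_kap.
  assert (hq : is_lim_seq (fun m => INR (cf_q d (h + m * l + k))) p_infty).
  { apply (is_lim_seq_le_p_loc (fun m => INR m - 1)).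
    - exists 0%nat. intros m _. assert (h1 := cf_q_ge d (h + m * l + k) hd).
      assert (h2 : (m <= S (cf_q d (h + m * l + k)))%nat) by nia.
      apply le_INR in h2. rewrite S_INR in h2. lra.
    - eapply is_lim_seq_minus; [apply is_lim_seq_INR|apply is_lim_seq_const|].
      reflexivity. }
  evar_last.
  - apply is_lim_seq_scal_l. apply is_lim_seq_inv; [exact hq|discriminate].
  - simpl. f_equal. ring.
Qed.

(** By definition N = t + C_n/2 - C_n {t rho} with rho = q_(n-1)/q_n, and rho tends to sigma_k. As t
    sigma_k is not an integer, the integer part of t rho is eventually constant, so the fractional
    part passes to the limit. *)
Lemma cf_N_lim (d : nat -> nat) (h : nat) (per : list nat) (k t : nat) :
  ev_digits d h per -> (1 <= k <= length per)%nat -> (1 <= t)%nat ->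
  is_lim_seq (fun m => cf_N d (h + m * length per + k) t) (lim_C per k / 2 * u per k t).
Proof.
  intros hev hk ht. assert (hd := proj1 hev).
  rewrite (u_eq d h per k t hev hk).
  assert (hrho := cf_q_ratio_lim d h per k hev ltac:(lia)).
  assert (hC := cf_C_lim d h per k hev ltac:(lia)).
  assert (hC0 := lim_C_range d h per k hev ltac:(lia)).
  set (idx := fun m => (h + m * length per + k)%nat) in *.
  set (sg := rev_tail per k) in *. set (f := Int_part (INR t * sg)).
  set (rho := fun m => INR (cf_q d (idx m - 1)) / INR (cf_q d (idx m))).
  assert (hbf := base_fp (INR t * sg)). unfold frac_part in *. fold f in hbf |- *.
  assert (hstrict : IZR f < INR t * sg).
  { destruct (Rle_lt_or_eq_dec (IZR f) (INR t * sg)) as [hlt|heq]; [lra|exact hlt|exfalso].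
    rewrite INR_IZR_INZ in heq. assert (Z.of_nat t = 0%Z); [|lia].
    apply (rev_tail_irrational d h per k _ (- f) hev). rewrite opp_IZR. fold sg. lra. }
  assert (htr : is_lim_seq (fun m => INR t * rho m) (INR t * sg))
    by (apply (is_lim_seq_scal_l _ (INR t) sg); exact hrho).
  apply is_lim_seq_ext_loc with
    (fun m => INR t + cf_C d (idx m) / 2 - cf_C d (idx m) * (INR t * rho m - IZR f)).
  - assert (htr' := htr). apply is_lim_seq_spec in htr'.
    assert (he : 0 < Rmin (INR t * sg - IZR f) (IZR f + 1 - INR t * sg))
      by (apply Rmin_glb_lt; lra).
    destruct (htr' (mkposreal _ he)) as [m0 hm0]. simpl in hm0.
    exists m0. intros m hm. specialize (hm0 m hm). apply Rabs_def2 in hm0.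
    assert (r1 := Rmin_l (INR t * sg - IZR f) (IZR f + 1 - INR t * sg)).
    assert (r2 := Rmin_r (INR t * sg - IZR f) (IZR f + 1 - INR t * sg)).
    unfold cf_N, cf_res. fold (idx m).
    set (q := cf_q d (idx m)) in *. set (Q := cf_q d (idx m - 1)) in *.
    assert (hq1 : (1 <= q)%nat) by (apply cf_q_pos; [exact hd|unfold idx; lia]).
    assert (hq : 0 < INR q) by (apply (lt_INR 0); exact hq1).
    assert (hdm := Nat.div_mod_eq (t * Q) q).
    assert (hmod := Nat.mod_upper_bound (t * Q) q ltac:(lia)).
    set (r := ((t * Q) mod q)%nat) in *. set (w := (t * Q / q)%nat) in *.
    apply (f_equal INR) in hdm. rewrite plus_INR, !mult_INR in hdm.
    apply lt_INR in hmod. assert (hr0 := pos_INR r).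
    assert (hrho_eq : INR t * rho m = INR w + INR r / INR q).
    { unfold rho. fold q Q. apply Rmult_eq_reg_r with (INR q); [|lra].
      replace (INR t * (INR Q / INR q) * INR q) with (INR t * INR Q) by (field; lra).
      rewrite hdm. field. lra. }
    assert (hfr : 0 <= INR r / INR q < 1).
    { split.
      - apply Rmult_le_pos; [exact hr0|]. left. apply Rinv_0_lt_compat, hq.
      - apply Rmult_lt_reg_r with (INR q); [exact hq|].
        replace (INR r / INR q * INR q) with (INR r) by (field; lra). lra. }
    assert (hw : f = Z.of_nat w).
    { rewrite (INR_IZR_INZ w) in hrho_eq.
      assert (IZR f < IZR (Z.of_nat w + 1)) by (rewrite plus_IZR; lra).
      assert (IZR (Z.of_nat w) < IZR (f + 1)) by (rewrite plus_IZR; lra).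
      apply lt_IZR in H. apply lt_IZR in H0. lia. }
    rewrite hrho_eq, hw, <- INR_IZR_INZ. unfold cf_C. fold q. field. apply Rgt_not_eq, hq.
  - replace (lim_C per k / 2 * (2 * (INR t / lim_C per k - (INR t * sg - IZR f) + 1 / 2))) with
      (INR t + lim_C per k / 2 - lim_C per k * (INR t * sg - IZR f)) by (field; lra).
    apply is_lim_seq_minus'.
    + apply is_lim_seq_plus'; [apply is_lim_seq_const|].
      apply (is_lim_seq_scal_r _ (/ 2) (lim_C per k)). exact hC.
    + apply is_lim_seq_mult'; [exact hC|].
      apply is_lim_seq_minus'; [exact htr|apply is_lim_seq_const].
Qed.

Definition inv_u_sqr (per : list nat) (k t : nat) : R := / u per k t ^ 2.

(** The constant 64 is that of [cf_xi_bound], so that the approximating terms and their limits share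
    one majorant. *)
Lemma inv_u_sqr_bounded (d : nat -> nat) (h : nat) (per : list nat) (k : nat) :
  ev_digits d h per -> (1 <= k <= length per)%nat ->
  inv_sqr_bounded (inv_u_sqr per k) 64.
Proof.
  intros hev hk. split; [lra|]. intros t ht. unfold inv_u_sqr.
  assert (hu := u_ge d h per k t hev hk ht).
  assert (ht1 : 1 <= INR t) by (apply (le_INR 1); exact ht).
  assert (hp : 0 < INR t ^ 2) by (apply pow_lt; lra).
  assert (hle : INR t ^ 2 <= u per k t ^ 2) by (apply pow_incr; lra).
  split; [left; apply Rinv_0_lt_compat; lra|].
  apply Rle_trans with (/ INR t ^ 2); [apply Rinv_le_contravar; assumption|].
  assert (hi := Rinv_0_lt_compat _ hp). unfold Rdiv. lra.
Qed.

Lemma cf_xi_lim (d : nat -> nat) (h : nat) (per : list nat) (k t : nat) :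
  ev_digits d h per -> (1 <= k <= length per)%nat -> (1 <= t)%nat ->
  is_lim_seq (fun m => cf_xi d (h + m * length per + k) t) (inv_u_sqr per k t).
Proof.
  intros hev hk ht. assert (hd := proj1 hev). assert (hl := proj1 (proj2 hev)).
  assert (hN := cf_N_lim d h per k t hev hk ht).
  assert (hC := cf_C_lim d h per k hev ltac:(lia)).
  assert (hC0 := lim_C_range d h per k hev ltac:(lia)).
  assert (hu := u_ge d h per k t hev hk ht).
  assert (ht1 : 1 <= INR t) by (apply (le_INR 1); exact ht).
  assert (hkp : forall m, 0 < cf_kap d (h + m * length per + k))
    by (intros m; apply cf_kap_pos; [exact hd|lia]).
  assert (hs := sin_rescaled_lim _ _ _ hkp (cf_kap_lim d h (length per) k hd hl) hN).
  set (sm := fun m => sin (cf_kap d (h + m * length per + k) * cf_N d (h + m * length per + k) t)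
             / cf_kap d (h + m * length per + k)) in *.
  assert (hlim : is_lim_seq (fun m => (cf_C d (h + m * length per + k) / 2) * / sm m)
                   (lim_C per k / 2 * / (lim_C per k / 2 * u per k t))).
  { apply is_lim_seq_mult'.
    - apply (is_lim_seq_scal_r _ (/ 2) (lim_C per k)). exact hC.
    - apply (is_lim_seq_inv _ (lim_C per k / 2 * u per k t)); [exact hs|].
      intros E. injection E. intros E'. nra. }
  replace (lim_C per k / 2 * / (lim_C per k / 2 * u per k t)) with (/ u per k t) in hlim
    by (field; lra).
  assert (hsq := is_lim_seq_mult' _ _ _ _ hlim hlim).
  unfold inv_u_sqr. replace (/ u per k t ^ 2) with (/ u per k t * / u per k t) by (field; lra).
  eapply is_lim_seq_ext; [|exact hsq]. intros m. unfold sm, cf_xi. cbv beta.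
  unfold Rdiv. rewrite !Rinv_mult, !Rinv_inv, Rpow_mult_distr, <- pow_inv. ring.
Qed.

(** A signed square root of the limit of H_n. It carries no absolute value, so it is smooth
    everywhere, and G_k is a constant times its absolute value. *)
Definition limit_shape (per : list nat) (k : nat) (eps : R) : R :=
  (1 + eps / lim_C per k) * entire_prod (inv_u_sqr per k) ((1 + 2 * eps / lim_C per k) ^ 2).

Lemma smooth_limit_shape (d : nat -> nat) (h : nat) (per : list nat) (k : nat) :
  ev_digits d h per -> (1 <= k <= length per)%nat -> smooth (limit_shape per k).
Proof.
  intros hev hk. assert (hb := inv_u_sqr_bounded d h per k hev hk).
  assert (hC0 := lim_C_range d h per k hev ltac:(lia)).
  apply smooth_ext with (fun eps => / 2 * ((fun w => (1 + w) * entire_prod (inv_u_sqr per k) (w ^ 2))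
                          (2 / lim_C per k * eps + 1))).
  - intros eps. unfold limit_shape.
    replace (2 / lim_C per k * eps + 1) with (1 + 2 * eps / lim_C per k) by (unfold Rdiv; ring).
    cbv beta. field. lra.
  - apply smooth_scal. apply (smooth_comp_affine (fun w => (1 + w) * entire_prod (inv_u_sqr per k) (w ^ 2))).
    apply smooth_linear_mult_entire_prod with 64. exact hb.
Qed.

Lemma smooth_entire_prod (x : nat -> R) (M : R) :
  inv_sqr_bounded x M -> smooth (entire_prod x).
Proof.
  intros hb. apply smooth_PSeries. intros z. apply (ex_pseries_esym_lim x M z hb).
Qed.

(** The terms are symmetric under t -> q_n - t, so the product splits into two halves on which the
    domination holds. Both halves have the same limit, and this makes the total a square. *)
Lemma ucv_sudler_shape (d : nat -> nat) (h : nat) (per : list nat) (k : nat) :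
  ev_digits d h per -> (1 <= k <= length per)%nat ->
  ucv (fun m eps => sudler_shape d (h + m * length per + k) eps)
      (fun eps => limit_shape per k eps ^ 2).
Proof.
  intros hev hk. assert (hd := proj1 hev). assert (hl := proj1 (proj2 hev)).
  assert (hb := inv_u_sqr_bounded d h per k hev hk).
  assert (hC0 := lim_C_range d h per k hev ltac:(lia)).
  assert (hC := cf_C_lim d h per k hev ltac:(lia)).
  set (idx := fun m => (h + m * length per + k)%nat) in *. set (C := lim_C per k) in *.
  assert (hidx : forall m, (1 <= idx m)%nat) by (intros m; unfold idx; lia).
  assert (hkp : forall m, 0 < cf_kap d (idx m)) by (intros m; apply cf_kap_pos; auto).
  assert (hk0 : is_lim_seq (fun m => cf_kap d (idx m)) 0) by (apply cf_kap_lim; assumption).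
  assert (hCm : forall m, 0 < cf_C d (idx m)) by (intros m; apply cf_C_pos; auto).
  assert (bconst : forall c : R, bounded_on_bounded (fun _ => c))
    by (intros c; apply continuous_bounded; intros y; apply continuous_const).
  assert (baff : forall a b : R, bounded_on_bounded (fun y => a + b * y)).
  { intros a b. apply continuous_bounded. intros y.
    apply (ex_derive_continuous (V := R_NormedModule)). auto_derive. exact I. }
  (* One statement for both sine quotients: g = 1 is the unpaired factor, g = 1/2 the argument
     z_n(eps). *)
  assert (hsin : forall g : R,
      ucv (fun m eps => sin (cf_kap d (idx m) * (cf_C d (idx m) * g + eps)) / cf_kap d (idx m)
                        * / (cf_C d (idx m) * g)) (fun eps => (C * g + 1 * eps) * / (C * g)) \/ g = 0).
  { intros g. destruct (Req_dec g 0) as [g0|g0]; [right; exact g0|left].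
    apply ucv_mult; [apply baff|apply bconst| |].
    - apply (ucv_sin_rescaled (fun m => cf_kap d (idx m))
               (fun m eps => cf_C d (idx m) * g + eps)); auto.
      apply ucv_plus.
      + apply ucv_seq. apply (is_lim_seq_scal_r _ g C). exact hC.
      + apply ucv_ext with (fun _ y => y) (fun y => y); [reflexivity|intros y; ring|].
        apply ucv_const.
    - apply ucv_seq. apply (is_lim_seq_inv _ (C * g)).
      + apply (is_lim_seq_scal_r _ g C). exact hC.
      + intros E. injection E. intros E'. apply Rmult_integral in E'. lra. }
  assert (hsq : forall f g, bounded_on_bounded g -> ucv f g ->
                  ucv (fun m y => f m y ^ 2) (fun y => g y ^ 2)).
  { intros f g hbg hfg. apply ucv_ext with (fun m y => f m y * f m y) (fun y => g y * g y);
      [intros; ring|intros; ring|]. apply ucv_mult; assumption. }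
  assert (bmain : forall g : R, bounded_on_bounded (fun eps => (C * g + 1 * eps) * / (C * g))).
  { intros g. apply continuous_bounded. intros y.
    apply (ex_derive_continuous (V := R_NormedModule)). auto_derive. exact I. }
  assert (hmain := hsin 1). destruct hmain as [hmain|e]; [|lra].
  assert (harg := hsin (/ 2)). destruct harg as [harg|e]; [|lra].
  apply (hsq _ _ (bmain 1)) in hmain. apply (hsq _ _ (bmain (/ 2))) in harg.
  set (zg := fun eps => ((C * / 2 + 1 * eps) * / (C * / 2)) ^ 2) in *.
  assert (hzg : forall eps, zg eps = (1 + 2 * eps / C) ^ 2) by (intros eps; unfold zg; field; lra).
  assert (bzg : bounded_on_bounded zg).
  { apply continuous_bounded. intros y.
    apply (ex_derive_continuous (V := R_NormedModule)). unfold zg. auto_derive. exact I. }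
  assert (hargz : ucv (fun m eps => sudler_arg d (idx m) eps) zg).
  { eapply ucv_ext; [| |exact harg].
    - intros m y. reflexivity.
    - reflexivity. }
  assert (hqbig : exists m1, forall m, (m1 <= m)%nat -> (3 <= cf_q d (idx m))%nat).
  { exists 4%nat. intros m hm. assert (h1 := cf_q_ge d (idx m) hd). unfold idx in *. nia. }
  assert (hpart : forall J : nat -> nat,
     (forall m, J m <= cf_q d (idx m) / 2)%nat ->
     (forall K, exists m1, forall m, (m1 <= m)%nat -> (K <= J m)%nat) ->
     ucv (fun m eps => Rprod (seq 1 (J m)) (fun t => 1 - sudler_arg d (idx m) eps * cf_xi d (idx m) t))
         (fun eps => entire_prod (inv_u_sqr per k) (zg eps))).
  { intros J hJ1 hJ2. apply (ucv_partial_product (fun m t => cf_xi d (idx m) t) _ J 64); auto.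
    - destruct hqbig as [m1 hm1]. exists m1. intros m t hm ht.
      specialize (hJ1 m). apply cf_xi_bound; auto. lia.
    - intros t ht. apply cf_xi_lim; assumption. }
  assert (hJinf : forall i K, (i <= 1)%nat -> exists m1, forall m, (m1 <= m)%nat ->
                    (K <= (cf_q d (idx m) - i) / 2)%nat).
  { intros i K hi. exists (2 * K + 3)%nat. intros m hm.
    apply Nat.div_le_lower_bound; [lia|].
    assert (h1 := cf_q_ge d (idx m) hd). unfold idx in *. nia. }
  assert (hp1 := hpart (fun m => cf_q d (idx m) / 2)%nat (fun m => Nat.le_refl _)).
  assert (hp2 := hpart (fun m => (cf_q d (idx m) - 1) / 2)%nat).
  assert (hp1' := hp1 (fun K => ltac:(destruct (hJinf 0%nat K ltac:(lia)) as [m1 hm1]; exists m1;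
     intros m hm; specialize (hm1 m hm); rewrite Nat.sub_0_r in hm1; exact hm1))).
  assert (hp2' := hp2 (fun m => Nat.Div0.div_le_mono _ _ 2 (Nat.le_sub_l _ 1))
                      (fun K => hJinf 1%nat K (Nat.le_refl _))).
  clear hp1 hp2.
  assert (bW : bounded_on_bounded (fun eps => entire_prod (inv_u_sqr per k) (zg eps))).
  { apply continuous_bounded. intros y. apply continuous_comp.
    - apply (ex_derive_continuous (V := R_NormedModule)). unfold zg. auto_derive. exact I.
    - apply smooth_continuous. apply smooth_entire_prod with 64. exact hb. }
  assert (hprod := ucv_abs _ _ (ucv_mult _ _ _ _ bW bW hp1' hp2')).
  assert (hfin := fun b1 b2 => ucv_mult _ _ _ _ b1 b2 hmain hprod).
  eapply ucv_ext; [| |apply hfin].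
  - intros m y. cbv beta. unfold sudler_shape. rewrite !Rmult_1_r. unfold Rdiv. f_equal.
    rewrite (Rprod_symmetric (cf_q d (idx m))); [reflexivity|apply cf_q_pos; auto|].
    intros t ht. unfold cf_xi. rewrite sin_cf_N_sym; auto.
  - intros y. cbv beta. unfold limit_shape. fold C. rewrite <- hzg.
    rewrite Rabs_pos_eq; [|apply Rle_0_sqr]. field. lra.
  - apply continuous_bounded. intros y.
    apply (ex_derive_continuous (V := R_NormedModule)). auto_derive. exact I.
  - intros B. destruct (bW B) as [M hM]. exists (M * M). intros y hy. specialize (hM y hy).
    rewrite Rabs_Rabsolu, Rabs_mult. apply Rmult_le_compat; try apply Rabs_pos; assumption.
Qed.

(** * A logarithmic bound for the constants K_n *)

Lemma harmonic_le_ln (J q : nat) :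
  (1 <= q)%nat -> (J <= q)%nat -> Rsum (seq 1 J) (fun t => / INR t) <= 1 + ln (INR q).
Proof.
  intros hq hJ.
  assert (hln : forall y, 0 < y -> ln y <= y - 1).
  { intros y hy. assert (h := exp_ineq1_le (ln y)). rewrite exp_ln in h by exact hy. lra. }
  assert (hq1 : 1 <= INR q) by (apply (le_INR 1); exact hq).
  assert (hlnmono : forall y z, 0 < y -> y <= z -> ln y <= ln z).
  { intros y z hy [h|h]; [left; apply ln_increasing; assumption|rewrite h; lra]. }
  destruct J as [|J].
  - unfold Rsum. simpl. assert (h := hlnmono 1 (INR q) ltac:(lra) hq1). rewrite ln_1 in h. lra.
  - apply Rle_trans with (1 + ln (INR (S J))).
    + clear hJ. induction J as [|J IH].
      * unfold Rsum. simpl. rewrite ln_1. lra.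
      * rewrite Rsum_seq_S. change (1 + S J)%nat with (S (S J)).
        assert (h1 : 1 <= INR (S J)) by (apply (le_INR 1); lia).
        rewrite (S_INR (S J)). set (y := INR (S J)) in *.
        assert (h2 := hln (y / (y + 1)) ltac:(apply Rdiv_lt_0_compat; lra)).
        rewrite ln_div in h2 by lra.
        replace (y / (y + 1) - 1) with (- / (y + 1)) in h2 by (field; lra). lra.
    + apply Rplus_le_compat_l. apply hlnmono; [apply (lt_INR 0); lia|apply le_INR; exact hJ].
Qed.

Lemma sin_lipschitz (a b : R) : Rabs (sin a - sin b) <= Rabs (a - b).
Proof.
  rewrite form4, !Rabs_mult, (Rabs_pos_eq 2) by lra.
  assert (h1 : Rabs (cos ((a + b) / 2)) <= 1) by (apply Rabs_le, COS_bound).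
  assert (h2 : forall y, Rabs (sin y) <= Rabs y).
  { assert (hp : forall y, 0 < y -> Rabs (sin y) <= y).
    { intros y hy. apply Rabs_le. split; [|left; apply sin_lt_x; exact hy].
      destruct (Rle_lt_dec y 1) as [h|h].
      - assert (hpi := PI2_3_2). assert (hs := sin_ge_0 y ltac:(lra) ltac:(lra)). lra.
      - assert (hs := SIN_bound y). lra. }
    intros y. destruct (Rtotal_order y 0) as [h|[h|h]].
    - assert (h' := hp (- y) ltac:(lra)). rewrite sin_neg, Rabs_Ropp in h'.
      rewrite (Rabs_left y) by exact h. exact h'.
    - rewrite h, sin_0, !Rabs_R0. lra.
    - rewrite (Rabs_pos_eq y) by lra. apply hp; exact h. }
  specialize (h2 ((a - b) / 2)).
  replace (Rabs (a - b)) with (2 * Rabs ((a - b) / 2)).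
  - assert (p := Rabs_pos (sin ((a - b) / 2))). assert (p' := Rabs_pos (cos ((a + b) / 2))).
    nra.
  - unfold Rdiv. rewrite Rabs_mult, (Rabs_pos_eq (/ 2)) by lra. field.
Qed.

Lemma Rabs_ln_le (y e : R) : 0 < e -> 0 < y -> y - 1 <= e -> 1 - / y >= - e -> Rabs (ln y) <= e.
Proof.
  intros he hy h1 h2.
  assert (a := exp_ineq1_le (ln y)). rewrite exp_ln in a by exact hy.
  assert (b := exp_ineq1_le (- ln y)). rewrite exp_Ropp, exp_ln in b by exact hy.
  apply Rabs_le. lra.
Qed.

(** Replacing N by t moves the sine by at most half a step pi / q_n, while sin y >= 51/100 y. The
    ratio thus differs from 1 by at most (50/51)/t; that 50/51 < 1 keeps it away from 0 even for t =
    1. *)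
Lemma ln_sin_ratio_bound (d : nat -> nat) (n t : nat) :
  pos_digits d -> (1 <= n)%nat -> (1 <= t <= cf_q d n / 2)%nat ->
  (t <= cf_q d n - 1)%nat ->
  0 < sin (cf_kap d n * INR t) /\
  Rabs (ln (sin (cf_kap d n * cf_N d n t) ^ 2 / sin (cf_kap d n * INR t) ^ 2)) <= 100 * / INR t.
Proof.
  intros hd hn ht htq.
  assert (hk := cf_kap_pos d n hd hn). assert (hC := cf_C_range d n hd hn).
  assert (hN := cf_N_range d n t hd hn).
  assert (hsN := sin_cf_N_pos d n t hd hn ltac:(lia)).
  assert (h1 : 1 <= INR t) by (apply (le_INR 1); lia).
  assert (h2 : 2 * INR t <= INR (cf_q d n)).
  { change 2 with (INR 2). rewrite <- mult_INR. apply le_INR.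
    assert (h := Nat.div_mod_eq (cf_q d n) 2). lia. }
  set (K := cf_kap d n) in *. set (q := INR (cf_q d n)) in *. set (N := cf_N d n t) in *.
  set (y := K * INR t). assert (hy0 : 0 < y) by (unfold y; nra).
  assert (hy1 : y <= 17 / 10).
  { assert (hpi := PI_lt_17_5). assert (hpi0 := PI_RGT_0).
    apply Rle_trans with (PI / 2); [|lra].
    unfold y, K, cf_kap. fold q. apply Rmult_le_reg_r with q; [lra|].
    replace (PI / q * INR t * q) with (PI * INR t) by (field; lra). nra. }
  assert (hs : y * (51 / 100) <= sin y).
  { assert (h := proj1 (pre_sin_bound y 0 ltac:(lra) ltac:(lra))).
    unfold sin_approx, sin_term in h. simpl in h.
    assert (hyy : y * y <= 289 / 100) by nra.
    assert (y * (y * y) <= y * (289 / 100)) by (apply Rmult_le_compat_l; lra). lra. }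
  assert (hd1 : Rabs (sin (K * N) - sin y) <= K / 2).
  { eapply Rle_trans; [apply sin_lipschitz|].
    replace (K * N - y) with (K * (N - INR t)) by (unfold y; ring).
    rewrite Rabs_mult, (Rabs_pos_eq K) by lra.
    apply Rle_trans with (K * (cf_C d n / 2)); [apply Rmult_le_compat_l; lra|nra]. }
  assert (hsy : 0 < sin y) by lra. split; [exact hsy|].
  set (r := sin (K * N) / sin y).
  assert (hr0 : 0 < r) by (unfold r; apply Rdiv_lt_0_compat; assumption).
  assert (hti : 0 < / INR t <= 1).
  { split; [apply Rinv_0_lt_compat; lra|]. rewrite <- Rinv_1. apply Rinv_le_contravar; lra. }
  assert (hr : Rabs (r - 1) <= 50 / 51 * / INR t).
  { replace (r - 1) with ((sin (K * N) - sin y) * / sin y) by (unfold r; field; lra).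
    rewrite Rabs_mult, Rabs_inv, (Rabs_pos_eq (sin y)) by lra.
    apply Rmult_le_reg_r with (sin y); [exact hsy|].
    rewrite Rmult_assoc, Rinv_l, Rmult_1_r by lra.
    eapply Rle_trans; [exact hd1|].
    apply Rle_trans with (50 / 51 * / INR t * (y * (51 / 100))).
    - unfold y. right. field. lra.
    - apply Rmult_le_compat_l; [|exact hs]. lra. }
  apply Rabs_le_between in hr.
  assert (hr1 : 1 / 51 <= r) by lra.
  assert (hlnr : Rabs (ln r) <= 49 * / INR t + / INR t).
  { apply Rabs_ln_le; [lra|exact hr0|lra|].
    assert (hri : / r <= 51) by (replace 51 with (/ (1 / 51)) by field; apply Rinv_le_contravar; lra).
    assert (hri0 := Rinv_0_lt_compat r hr0).
    replace (1 - / r) with ((r - 1) * / r) by (field; lra).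
    assert (hq1 : - (50 / 51 * / INR t) * / r <= (r - 1) * / r) by (apply Rmult_le_compat_r; lra).
    assert (hq2 : (50 / 51 * / INR t) * / r <= (50 / 51 * / INR t) * 51)
      by (apply Rmult_le_compat_l; lra). lra. }
  replace (sin (K * N) ^ 2 / sin y ^ 2) with (r * r) by (unfold r; field; lra).
  rewrite ln_mult by exact hr0.
  apply Rabs_le_between in hlnr. apply Rabs_le. lra.
Qed.

Lemma cf_delta_progression (d : nat -> nat) (h : nat) (per : list nat) (k m : nat) :
  ev_digits d h per ->
  cf_delta d (h + k) = cst_a per ^ m * cf_delta d (h + m * length per + k).
Proof.
  intros hev. induction m as [|m IH].
  - simpl. rewrite Nat.add_0_r. ring.
  - rewrite IH, (cf_delta_growth d h h (h + m * length per + k) per hev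
      (ev_digits_periodic d h per hev)) by lia.
    replace (h + m * length per + k + length per)%nat with (h + S m * length per + k)%nat by lia.
    simpl. ring.
Qed.

Lemma Rabs_ln_le_linear (y c : R) : 0 < c -> c <= y -> Rabs (ln y) <= y + / c.
Proof.
  intros hc hy.
  assert (a := exp_ineq1_le (ln y)). rewrite exp_ln in a by lra.
  assert (b := exp_ineq1_le (- ln y)). rewrite exp_Ropp, exp_ln in b by lra.
  assert (/ y <= / c) by (apply Rinv_le_contravar; lra).
  assert (0 < / c) by (apply Rinv_0_lt_compat; lra). apply Rabs_le. lra.
Qed.

Lemma Rabs_Rsum_le (s : list nat) (f g : nat -> R) :
  (forall x, In x s -> Rabs (f x) <= g x) -> Rabs (Rsum s f) <= Rsum s g.
Proof.
  intros H. induction s as [|x s IH]; unfold Rsum in *; simpl; [rewrite Rabs_R0; lra|].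
  eapply Rle_trans; [apply Rabs_triang|]. apply Rplus_le_compat.
  - apply H. left. reflexivity.
  - apply IH. intros; apply H; right; assumption.
Qed.

(** With t in place of N the sine product is exactly q_n^2, which cancels the q_n^(-2) in front and
    leaves 4 pi^2 C_n^2. The ratios cost a harmonic sum on each half of the range. *)
Lemma ln_sudler_const_bound (d : nat -> nat) (n : nat) :
  pos_digits d -> (1 <= n)%nat ->
  Rabs (ln (sudler_const d n)) <=
  4 * PI ^ 2 + / (PI ^ 2 * cf_tail d n ^ 2) + 200 * (1 + ln (INR (cf_q d n))).
Proof.
  intros hd hn. assert (hk := cf_kap_pos d n hd hn). assert (hC := cf_C_range d n hd hn).
  assert (hT := cf_tail_pos d n hd hn).
  assert (hq1 := cf_q_pos d n hd hn). assert (hpi := PI_RGT_0).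
  set (q := cf_q d n) in *. assert (hq : 0 < INR q) by (apply (lt_INR 0); exact hq1).
  set (g := fun t => sin (cf_kap d n * cf_N d n t) ^ 2 / sin (cf_kap d n * INR t) ^ 2).
  assert (hsym : forall t, (1 <= t <= q - 1)%nat -> g (q - t)%nat = g t).
  { intros t ht. unfold g. rewrite sin_cf_N_sym by assumption. fold q.
    do 2 f_equal. rewrite minus_INR by lia.
    replace (cf_kap d n * (INR q - INR t)) with (PI - cf_kap d n * INR t)
      by (unfold cf_kap; fold q; field; lra).
    apply sin_PI_x. }
  assert (hhalf : forall t, (1 <= t <= q / 2)%nat -> (t <= q - 1)%nat ->
            0 < sin (cf_kap d n * INR t) /\ Rabs (ln (g t)) <= 100 * / INR t).
  { intros t ht htq. apply ln_sin_ratio_bound; assumption. }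
  assert (hsin : forall t, (1 <= t <= q - 1)%nat -> 0 < sin (cf_kap d n * INR t)).
  { intros t ht. unfold cf_kap. fold q.
    assert (h1 : 1 <= INR t) by (apply (le_INR 1); lia).
    assert (h2 : INR t < INR q) by (apply lt_INR; lia).
    apply sin_gt_0.
    - apply Rmult_lt_0_compat; [apply Rdiv_lt_0_compat; lra|lra].
    - apply Rmult_lt_reg_r with (INR q); [lra|].
      replace (PI / INR q * INR t * INR q) with (PI * INR t) by (field; lra).
      apply Rmult_lt_compat_l; lra. }
  assert (hgpos : forall t, (1 <= t <= q - 1)%nat -> 0 < g t).
  { intros t ht. unfold g. apply Rdiv_lt_0_compat; apply pow_lt;
      [apply sin_cf_N_pos|apply hsin]; assumption. }
  assert (hprod : sudler_const d n = 4 * PI ^ 2 * cf_C d n ^ 2 *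
                    (Rprod (seq 1 (q / 2)) g * Rprod (seq 1 ((q - 1) / 2)) g)).
  { rewrite <- Rprod_symmetric by assumption. unfold sudler_const. fold q.
    assert (h1 := prod_sin_sqr q hq1).
    transitivity (4 * (cf_kap d n * cf_C d n) ^ 2 * (INR q ^ 2 * Rprod (seq 1 (q - 1)) g)).
    - f_equal. rewrite <- h1, <- Rprod_mult. apply Rprod_ext. intros t ht. apply in_seq in ht.
      unfold g. assert (h2 := hsin t ltac:(lia)).
      replace (PI * INR t / INR q) with (cf_kap d n * INR t)
        by (unfold cf_kap; fold q; field; lra).
      field. lra.
    - unfold cf_kap. fold q. field. lra. }
  assert (hJ : forall J, (J <= q / 2)%nat -> (J <= q - 1)%nat ->
     0 < Rprod (seq 1 J) g /\ Rabs (ln (Rprod (seq 1 J) g)) <= 100 * (1 + ln (INR q))).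
  { intros J hJ1 hJ2. split.
    - apply Rprod_pos. intros t ht. apply in_seq in ht. apply hgpos. lia.
    - rewrite ln_Rprod by (intros t ht; apply in_seq in ht; apply hgpos; lia).
      eapply Rle_trans.
      + apply (Rabs_Rsum_le _ _ (fun t => 100 * / INR t)). intros t ht. apply in_seq in ht.
        apply hhalf; lia.
      + rewrite Rsum_scal. apply Rmult_le_compat_l; [lra|]. apply harmonic_le_ln; lia. }
  destruct (hJ (q / 2)%nat) as [p1 b1]; [lia| |].
  { assert (h := Nat.div_mod_eq q 2). lia. }
  destruct (hJ ((q - 1) / 2)%nat) as [p2 b2].
  { apply Nat.Div0.div_le_mono. lia. }
  { apply Nat.Div0.div_le_upper_bound. lia. }
  assert (hPI2 : 0 < PI ^ 2) by (apply pow_lt; lra).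
  assert (hC2 : 0 < cf_C d n ^ 2) by (apply pow_lt; lra).
  assert (hm : 0 < 4 * PI ^ 2 * cf_C d n ^ 2) by nra.
  rewrite hprod, ln_mult by (try exact hm; apply Rmult_lt_0_compat; assumption).
  rewrite (ln_mult (Rprod (seq 1 (q / 2)) g)) by assumption.
  assert (b0 : Rabs (ln (4 * PI ^ 2 * cf_C d n ^ 2)) <= 4 * PI ^ 2 + / (PI ^ 2 * cf_tail d n ^ 2)).
  { eapply Rle_trans; [apply (Rabs_ln_le_linear _ (PI ^ 2 * cf_tail d n ^ 2))|].
    + apply Rmult_lt_0_compat; apply pow_lt; lra.
    + assert (cf_tail d n ^ 2 <= (2 * cf_C d n) ^ 2) by (apply pow_incr; lra). nra.
    + assert (cf_C d n ^ 2 <= 1) by (simpl; nra). nra. }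
  apply Rabs_le_between in b0. apply Rabs_le_between in b1. apply Rabs_le_between in b2.
  apply Rabs_le. lra.
Qed.

(** From q_n delta_n < 1 and delta_n = D a^(-m) follows ln q_n <= m ln a - ln D, so the logarithm
    grows at most linearly in m. *)
Lemma ln_sudler_const_growth (d : nat -> nat) (h : nat) (per : list nat) (k : nat) :
  ev_digits d h per -> (1 <= k)%nat ->
  is_lim_seq (fun m => ln (sudler_const d (h + m * length per + k)) / cst_a per ^ m) 0.
Proof.
  intros hev hk. assert (hd := proj1 hev). assert (ha := cst_a_gt_1 d h per hev).
  set (D := cf_delta d (h + k)). assert (hD : 0 < D) by (apply cf_delta_pos; exact hd).
  set (A := 4 * PI ^ 2 + / (PI ^ 2 * fwd_tail per k ^ 2) + 200 * (1 - ln D)).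
  apply is_lim_seq_abs_0.
  apply (is_lim_seq_le_le (fun _ => 0) _ (fun m => (A + 200 * ln (cst_a per) * INR m) / cst_a per ^ m) 0).
  - intros m. split; [apply Rabs_pos|].
    assert (hp : 0 < cst_a per ^ m) by (apply pow_lt; lra).
    unfold Rdiv. rewrite Rabs_mult, Rabs_inv, (Rabs_pos_eq (cst_a per ^ m)) by lra.
    apply Rmult_le_compat_r; [left; apply Rinv_0_lt_compat; exact hp|].
    eapply Rle_trans; [apply ln_sudler_const_bound; [exact hd|lia]|].
    rewrite (fwd_tail_eq d h per k m hev hk).
    set (n := (h + m * length per + k)%nat).
    assert (hq : 0 < INR (cf_q d n)) by (apply (lt_INR 0), cf_q_pos; [exact hd|unfold n; lia]).
    assert (hq2 : ln (INR (cf_q d n)) <= - ln D + INR m * ln (cst_a per)).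
    { assert (hdp := cf_delta_pos d n hd).
      assert (hpr := cf_delta_progression d h per k m hev). fold n D in hpr.
      assert (hCr := cf_C_range d n hd ltac:(unfold n; lia)). unfold cf_C in hCr.
      assert (hle : INR (cf_q d n) <= / D * cst_a per ^ m).
      { rewrite hpr. rewrite Rinv_mult.
        replace (/ cst_a per ^ m * / cf_delta d n * cst_a per ^ m) with (/ cf_delta d n)
          by (field; lra).
        apply Rmult_le_reg_r with (cf_delta d n); [exact hdp|]. rewrite Rinv_l by lra. lra. }
      apply Rle_trans with (ln (/ D * cst_a per ^ m)).
      - destruct hle as [hlt|heq]; [left; apply ln_increasing; assumption|rewrite heq; lra].
      - rewrite ln_mult by (try exact hp; apply Rinv_0_lt_compat; exact hD).
        rewrite ln_Rinv by exact hD. rewrite ln_pow by lra. lra. }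
    unfold A. lra.
  - apply is_lim_seq_const.
  - apply linear_over_geom. exact ha.
Qed.

(** * Functional equations between Sudler products *)

Definition orbit_factor (d : nat -> nat) (r : nat) : R :=
  2 * Rabs (sin (PI * (INR r * cf d))).

Lemma Rprod_seq_shift (a M n : nat) (f : nat -> R) :
  Rprod (seq (a + M) n) f = Rprod (seq a n) (fun r => f (r + M)%nat).
Proof.
  induction n as [|n IH]; [reflexivity|]. rewrite !Rprod_seq_S, IH. do 2 f_equal. lia.
Qed.

(** A perturbation that agrees modulo 1 with M beta is a shift of the index: the perturbed product
    is a block of the unperturbed orbit that starts after M. *)
Lemma sudler_shift (d : nat -> nat) (n M : nat) (eps : R) (z : Z) :
  INR M * cf d = IZR z + (-1) ^ (n + 1) * (eps / INR (cf_q d n)) ->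
  sudler d n eps = Rprod (seq (1 + M) (cf_q d n)) (orbit_factor d).
Proof.
  intros H. rewrite Rprod_seq_shift. unfold sudler. apply Rprod_ext. intros r _.
  unfold orbit_factor. f_equal.
  rewrite <- (Rabs_sin_add_int z 0). f_equal. f_equal. f_equal.
  rewrite plus_INR, Rmult_plus_distr_r, H. simpl (_ ^ 0). ring.
Qed.

Lemma Rprod_blocks (M q c : nat) (f : nat -> R) :
  Rprod (seq 0 c) (fun s => Rprod (seq (1 + (M + s * q)) q) f) = Rprod (seq (1 + M) (c * q)) f.
Proof.
  induction c as [|c IH]; [reflexivity|].
  rewrite Rprod_seq_S, IH. replace (S c * q)%nat with (c * q + q)%nat by lia.
  rewrite seq_app, Rprod_app. reflexivity.
Qed.

Lemma cf_q_period_rec (d : nat -> nat) (h : nat) (per : list nat) (n : nat) :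
  ev_digits d h per -> (h <= n)%nat ->
  INR (cf_q d (n + 2 * length per)) =
    INR (cst_c per) * INR (cf_q d (n + length per)) - (-1) ^ length per * INR (cf_q d n).
Proof.
  intros hev hn. rewrite (ev_digits_root d h per hev).
  apply cf_q_periodic; [apply ev_digits_periodic, hev|exact hn].
Qed.

Lemma cf_C_delta_shift (d : nat -> nat) (h : nat) (per : list nat) (n : nat) :
  ev_digits d h per -> (h <= n)%nat ->
  INR (cf_q d (n + length per)) * cf_delta d n = cf_C d (n + length per) * cst_a per.
Proof.
  intros hev hn.
  rewrite (cf_delta_growth d h h n per hev (ev_digits_periodic d h per hev) hn).
  unfold cf_C. ring.
Qed.

Lemma sudler_multiple (d : nat -> nat) (n s : nat) :
  pos_digits d -> (1 <= n)%nat ->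
  sudler d n (cf_C d n * INR s) = Rprod (seq (1 + s * cf_q d n) (cf_q d n)) (orbit_factor d).
Proof.
  intros hd hn. assert (hq : 0 < INR (cf_q d n)) by (apply (lt_INR 0), cf_q_pos; assumption).
  apply (sudler_shift d n _ _ (Z.of_nat s * Z.of_nat (cf_p d n))).
  assert (H := cf_approx d n hd). rewrite mult_INR, mult_IZR, <- !INR_IZR_INZ.
  unfold cf_C. rewrite Rmult_assoc.
  replace (INR (cf_q d n) * cf d) with
    (INR (cf_p d n) + (-1) ^ (n + 1) * cf_delta d n) by lra. field. lra.
Qed.

(** The orbit up to q_n + q_(n+2l) = c q_(n+l) is cut in two ways: into c equal blocks, or after
    q_n. In the second cut the shift is delta_n = a^2 delta_(n+2l), hence the argument C_(n+2l)
    a^2. *)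
Lemma sudler_functional_even (d : nat -> nat) (h : nat) (per : list nat) (n : nat) :
  ev_digits d h per -> Nat.Even (length per) -> (h <= n)%nat -> (1 <= n)%nat ->
  let l := length per in
  sudler d n (cf_C d n * 0) * sudler d (n + 2 * l) (cf_C d (n + 2 * l) * cst_a per ^ 2) =
  Rprod (seq 0 (cst_c per)) (fun s => sudler d (n + l) (cf_C d (n + l) * INR s)).
Proof.
  intros hev hl hn hn1 l. assert (hd := proj1 hev).
  assert (hs : (-1) ^ l = 1) by (destruct hl as [l' e]; unfold l; rewrite e; apply pow_1_even).
  assert (hrec := cf_q_period_rec d h per n hev hn). fold l in hrec. rewrite hs in hrec.
  assert (hq : (cf_q d n + cf_q d (n + 2 * l) = cst_c per * cf_q d (n + l))%nat).
  { apply INR_eq. rewrite plus_INR, mult_INR. lra. }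
  rewrite (Rprod_ext (seq 0 (cst_c per)) _
    (fun s => Rprod (seq (1 + (0 + s * cf_q d (n + l))) (cf_q d (n + l))) (orbit_factor d)))
    by (intros s _; apply sudler_multiple; [exact hd|lia]).
  rewrite Rprod_blocks, <- hq, seq_app, Rprod_app. f_equal.
  - change 0 with (INR 0). rewrite sudler_multiple by assumption. reflexivity.
  - assert (hqp : 0 < INR (cf_q d (n + 2 * l)))
      by (apply (lt_INR 0), cf_q_pos; [exact hd|lia]).
    apply (sudler_shift d (n + 2 * l) (cf_q d n) _ (Z.of_nat (cf_p d n))).
    rewrite <- INR_IZR_INZ. assert (H := cf_approx d n hd).
    replace ((-1) ^ (n + 2 * l + 1)) with ((-1) ^ (n + 1)).
    + assert (hsh := cf_C_delta_shift d h per (n + l) hev ltac:(lia)). fold l in hsh.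
      replace (n + l + l)%nat with (n + 2 * l)%nat in hsh by lia.
      assert (hg := cf_delta_growth d h h n per hev (ev_digits_periodic d h per hev) hn).
      fold l in hg.
      replace (cf_C d (n + 2 * l) * cst_a per ^ 2 / INR (cf_q d (n + 2 * l))) with (cf_delta d n);
        [lra|].
      rewrite hg. apply Rmult_eq_reg_r with (INR (cf_q d (n + 2 * l))); [|lra].
      replace (cf_C d (n + 2 * l) * cst_a per ^ 2 / INR (cf_q d (n + 2 * l)) * INR (cf_q d (n + 2 * l)))
        with (cst_a per * (cf_C d (n + 2 * l) * cst_a per)) by (field; lra).
      rewrite <- hsh. ring.
    + replace (n + 2 * l + 1)%nat with (n + 1 + l + l)%nat by lia. rewrite !pow_add, hs. ring.
Qed.

(** Here q_(n+2l) = q_n + c q_(n+l), so c blocks follow the first q_n terms. For odd l the errors of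
    q_n and q_(n+l) have opposite signs, and the shift of block s is s delta_(n+l) - delta_n = (s -
    a) delta_(n+l). *)
Lemma sudler_functional_odd (d : nat -> nat) (h : nat) (per : list nat) (n : nat) :
  ev_digits d h per -> Nat.Odd (length per) -> (h <= n)%nat -> (1 <= n)%nat ->
  let l := length per in
  sudler d (n + 2 * l) (cf_C d (n + 2 * l) * 0) =
  sudler d n (cf_C d n * 0) *
  Rprod (seq 0 (cst_c per)) (fun s => sudler d (n + l) (cf_C d (n + l) * (INR s - cst_a per))).
Proof.
  intros hev hl hn hn1 l. assert (hd := proj1 hev).
  assert (hs : (-1) ^ l = -1).
  { destruct hl as [l' e]. unfold l. rewrite e, Nat.add_1_r. apply pow_1_odd. }
  assert (hrec := cf_q_period_rec d h per n hev hn). fold l in hrec. rewrite hs in hrec.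
  assert (hq : (cf_q d (n + 2 * l) = cf_q d n + cst_c per * cf_q d (n + l))%nat).
  { apply INR_eq. rewrite plus_INR, mult_INR. lra. }
  rewrite (Rprod_ext (seq 0 (cst_c per)) _
    (fun s => Rprod (seq (1 + (cf_q d n + s * cf_q d (n + l))) (cf_q d (n + l))) (orbit_factor d))).
  - rewrite Rprod_blocks. change 0 with (INR 0). rewrite !sudler_multiple by (try exact hd; lia).
    rewrite hq. simpl (0 * _)%nat. rewrite Nat.add_0_r, seq_app, Rprod_app. reflexivity.
  - intros s _.
    assert (hqp : 0 < INR (cf_q d (n + l))) by (apply (lt_INR 0), cf_q_pos; [exact hd|lia]).
    apply (sudler_shift d (n + l) _ _
      (Z.of_nat (cf_p d n) + Z.of_nat s * Z.of_nat (cf_p d (n + l)))).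
    rewrite plus_INR, mult_INR, plus_IZR, mult_IZR, <- !INR_IZR_INZ.
    assert (H := cf_approx d n hd). assert (H' := cf_approx d (n + l) hd).
    assert (hsh := cf_C_delta_shift d h per n hev hn). fold l in hsh.
    replace ((-1) ^ (n + 1)) with (- (-1) ^ (n + l + 1)) in H.
    + set (sg := (-1) ^ (n + l + 1)) in *.
      replace (cf_C d (n + l) * (INR s - cst_a per) / INR (cf_q d (n + l))) with
        (INR s * cf_delta d (n + l) - cf_delta d n).
      * rewrite Rmult_plus_distr_r, Rmult_assoc.
        replace (INR (cf_q d n) * cf d) with (INR (cf_p d n) - sg * cf_delta d n) by lra.
        replace (INR (cf_q d (n + l)) * cf d) with
          (INR (cf_p d (n + l)) + sg * cf_delta d (n + l)) by lra. ring.
      * apply Rmult_eq_reg_r with (INR (cf_q d (n + l))); [|lra].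
        replace (cf_C d (n + l) * (INR s - cst_a per) / INR (cf_q d (n + l)) * INR (cf_q d (n + l)))
          with (cf_C d (n + l) * INR s - cf_C d (n + l) * cst_a per) by (field; lra).
        rewrite <- hsh. unfold cf_C. ring.
    + replace (n + l + 1)%nat with (n + 1 + l)%nat by lia. rewrite (pow_add _ (n + 1) l), hs. ring.
Qed.

(** * The constant and the limit function *)

Definition shape_prod (per : list nat) (k : nat) (y : R) : R :=
  entire_prod (inv_u_sqr per k) ((1 + 2 * y) ^ 2).

(** In the normalized variable y = eps / C this says that no factor of the limit function vanishes,
    so that its logarithm is meaningful. *)
Definition admissible (per : list nat) (k : nat) (y : R) : Prop :=
  1 + y <> 0 /\ forall t, (1 <= t)%nat -> (1 + 2 * y) ^ 2 <> u per k t ^ 2.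

Lemma factor_neq_0 (d : nat -> nat) (h : nat) (per : list nat) (k t : nat) (y : R) :
  ev_digits d h per -> (1 <= k <= length per)%nat -> (1 <= t)%nat ->
  (1 + 2 * y) ^ 2 <> u per k t ^ 2 -> 1 - (1 + 2 * y) ^ 2 * inv_u_sqr per k t <> 0.
Proof.
  intros hev hk ht hy E. apply hy. unfold inv_u_sqr in E.
  assert (hu := u_ge d h per k t hev hk ht).
  assert (ht1 : 1 <= INR t) by (apply (le_INR 1); exact ht).
  assert (hp : 0 < u per k t ^ 2) by (apply pow_lt; lra).
  apply Rmult_eq_reg_r with (/ u per k t ^ 2); [|apply Rinv_neq_0_compat; lra].
  rewrite Rinv_r by lra. lra.
Qed.

Lemma shape_prod_neq_0 (d : nat -> nat) (h : nat) (per : list nat) (k : nat) (y : R) :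
  ev_digits d h per -> (1 <= k <= length per)%nat -> admissible per k y -> shape_prod per k y <> 0.
Proof.
  intros hev hk (_ & hy).
  apply entire_prod_neq_0 with 64; [apply (inv_u_sqr_bounded d h); assumption|].
  intros t ht. apply (factor_neq_0 d h); auto.
Qed.

Definition log_shape (per : list nat) (k : nat) (y : R) : R :=
  ln (Rabs (1 + y)) + ln (Rabs (shape_prod per k y)).

Lemma limit_shape_at (d : nat -> nat) (h : nat) (per : list nat) (k : nat) (y : R) :
  ev_digits d h per -> (1 <= k <= length per)%nat ->
  limit_shape per k (lim_C per k * y) = (1 + y) * shape_prod per k y.
Proof.
  intros hev hk. assert (hC0 := lim_C_range d h per k hev ltac:(lia)).
  unfold limit_shape, shape_prod.
  replace (lim_C per k * y / lim_C per k) with y by (field; lra).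
  replace (2 * (lim_C per k * y) / lim_C per k) with (2 * y) by (field; lra). reflexivity.
Qed.

Lemma is_lim_seq_ln (f : nat -> R) (L : R) :
  0 < L -> is_lim_seq f L -> is_lim_seq (fun m => ln (f m)) (ln L).
Proof.
  intros hL hf. apply (is_lim_seq_continuous ln f L); [|exact hf].
  apply derivable_continuous_pt. exists (/ L). apply derivable_pt_lim_ln, hL.
Qed.

Lemma is_lim_seq_eventually_pos (f : nat -> R) (L : R) :
  0 < L -> is_lim_seq f L -> eventually (fun m => 0 < f m).
Proof.
  intros hL hf. apply is_lim_seq_spec in hf. destruct (hf (mkposreal L hL)) as [N hN].
  exists N. intros m hm. specialize (hN m hm). simpl in hN. apply Rabs_def2 in hN. lra.
Qed.

Lemma sudler_shape_log_lim (d : nat -> nat) (h : nat) (per : list nat) (k : nat) (y : R) :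
  ev_digits d h per -> (1 <= k <= length per)%nat -> admissible per k y ->
  let S m := sudler_shape d (h + m * length per + k)
               (cf_C d (h + m * length per + k) * y) in
  is_lim_seq (fun m => ln (S m)) (2 * log_shape per k y) /\ eventually (fun m => 0 < S m).
Proof.
  intros hev hk hy S. assert (hW := shape_prod_neq_0 d h per k y hev hk hy).
  assert (h1 := proj1 hy).
  assert (hcont : continuous (fun eps => limit_shape per k eps ^ 2) (lim_C per k * y)).
  { apply (continuous_comp (limit_shape per k) (fun z => z ^ 2)).
    - apply smooth_continuous, (smooth_limit_shape d h); assumption.
    - apply (ex_derive_continuous (V := R_NormedModule)). auto_derive. exact I. }
  assert (hl : is_lim_seq S (limit_shape per k (lim_C per k * y) ^ 2)).
  { apply (ucv_point (fun m eps => sudler_shape d (h + m * length per + k) eps)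
             (fun eps => limit_shape per k eps ^ 2)
             (fun m => cf_C d (h + m * length per + k) * y)).
    - apply ucv_sudler_shape; assumption.
    - exact hcont.
    - apply (is_lim_seq_scal_r _ y (lim_C per k)). apply cf_C_lim; [exact hev|lia]. }
  rewrite (limit_shape_at d h) in hl by assumption.
  assert (hne : (1 + y) * shape_prod per k y <> 0) by (apply Rmult_integral_contrapositive; auto).
  assert (hpos : 0 < ((1 + y) * shape_prod per k y) ^ 2).
  { rewrite <- pow2_abs. apply pow_lt, Rabs_pos_lt, hne. }
  split; [|apply (is_lim_seq_eventually_pos S _ hpos hl)].
  replace (2 * log_shape per k y) with (ln (((1 + y) * shape_prod per k y) ^ 2)).
  - apply is_lim_seq_ln; assumption.
  - rewrite <- pow2_abs, ln_pow by (apply Rabs_pos_lt, hne). rewrite Rabs_mult, ln_mult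
      by (apply Rabs_pos_lt; assumption). unfold log_shape. simpl. ring.
Qed.

Lemma is_lim_seq_Rsum (s : list nat) (f : nat -> nat -> R) (g : nat -> R) :
  (forall x, In x s -> is_lim_seq (fun m => f m x) (g x)) ->
  is_lim_seq (fun m => Rsum s (f m)) (Rsum s g).
Proof.
  intros H. induction s as [|x s IH]; unfold Rsum in *; simpl; [apply is_lim_seq_const|].
  apply is_lim_seq_plus'; [apply H; left; reflexivity|].
  apply IH. intros; apply H; right; assumption.
Qed.

Lemma eventually_forall_in (s : list nat) (P : nat -> nat -> Prop) :
  (forall x, In x s -> eventually (fun m => P m x)) ->
  eventually (fun m => forall x, In x s -> P m x).
Proof.
  intros H. induction s as [|x s IH].
  - exists 0%nat. intros m _ x hx. destruct hx.
  - destruct (H x (or_introl eq_refl)) as [N1 h1].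
    destruct IH as [N2 h2]; [intros; apply H; right; assumption|].
    exists (N1 + N2)%nat. intros m hm y [<-|hy]; [apply h1; lia|apply h2; [lia|exact hy]].
Qed.

Lemma Rprod_pow (s : list nat) (f : nat -> R) (n : nat) :
  Rprod s f ^ n = Rprod s (fun x => f x ^ n).
Proof.
  induction s as [|x s IH]; unfold Rprod in *; simpl; [apply pow1|].
  rewrite Rpow_mult_distr, IH. reflexivity.
Qed.

Lemma Rsum_const (s : list nat) (c : R) : Rsum s (fun _ => c) = INR (length s) * c.
Proof.
  induction s as [|x s IH]; [unfold Rsum; simpl; ring|].
  change (Rsum (x :: s) (fun _ => c)) with (c + Rsum s (fun _ => c)).
  rewrite IH. change (length (x :: s)) with (S (length s)). rewrite S_INR. ring.
Qed.

Lemma admissible_nat (d : nat -> nat) (h : nat) (per : list nat) (k s : nat) :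
  ev_digits d h per -> (1 <= k <= length per)%nat -> admissible per k (INR s).
Proof.
  intros hev hk. split.
  - assert (h0 := pos_INR s). lra.
  - intros t ht. rewrite INR_IZR_INZ. apply (u_ne_int d h); assumption.
Qed.

Lemma admissible_cst_a_sqr (d : nat -> nat) (h : nat) (per : list nat) (k : nat) :
  ev_digits d h per -> (1 <= k <= length per)%nat -> Nat.Even (length per) ->
  admissible per k (cst_a per ^ 2).
Proof.
  intros hev hk hl. split.
  - assert (h0 := pow2_ge_0 (cst_a per)). lra.
  - intros t ht. apply (u_ne_cst_a_sqr d h); assumption.
Qed.

Lemma admissible_sub_cst_a (d : nat -> nat) (h : nat) (per : list nat) (k s : nat) :
  ev_digits d h per -> (1 <= k <= length per)%nat -> Nat.Odd (length per) ->
  admissible per k (INR s - cst_a per).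
Proof.
  intros hev hk hl. split.
  - intros E. apply (cst_a_irrational d h per (Z.of_nat s + 1) hev).
    rewrite plus_IZR, <- INR_IZR_INZ. lra.
  - intros t ht. apply (u_ne_sub_cst_a d h); assumption.
Qed.

Lemma sudler_sqr_log_lim (d : nat -> nat) (h : nat) (per : list nat) (k : nat) (y : R) :
  ev_digits d h per -> (1 <= k <= length per)%nat -> admissible per k y ->
  let n m := (h + m * length per + k)%nat in
  let P m := sudler d (n m) (cf_C d (n m) * y) ^ 2 in
  is_lim_seq (fun m => ln (P m) - ln (sudler_const d (n m))) (2 * log_shape per k y) /\
  eventually (fun m => 0 < P m).
Proof.
  intros hev hk hy n P. assert (hd := proj1 hev).
  destruct (sudler_shape_log_lim d h per k y hev hk hy) as [hl [N hN]].
  assert (hc : forall m, 0 < sudler_const d (n m))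
    by (intros m; apply sudler_const_pos; [exact hd|unfold n; lia]).
  assert (hP : forall m, P m = sudler_const d (n m) * sudler_shape d (n m) (cf_C d (n m) * y))
    by (intros m; apply sudler_sqr_eq; [exact hd|unfold n; lia]).
  split.
  - eapply is_lim_seq_ext_loc; [|exact hl]. exists N. intros m hm.
    rewrite hP, ln_mult by (try apply hc; apply (hN m hm)). unfold n. ring.
  - exists N. intros m hm. rewrite hP. apply Rmult_lt_0_compat; [apply hc|apply (hN m hm)].
Qed.

(* The last hypothesis is the logarithm of the functional equation, in a form
   that covers both parities of l. *)
Lemma ln_sudler_const_lim (d : nat -> nat) (h : nat) (per : list nat) (k : nat)
    (y : R) (ys : nat -> R) :
  ev_digits d h per -> (1 <= k <= length per)%nat ->
  admissible per k 0 -> admissible per k y -> (forall s, admissible per k (ys s)) ->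
  let n m := (h + m * length per + k)%nat in
  let P m x := sudler d (n m) (cf_C d (n m) * x) ^ 2 in
  (forall m, 0 < P m 0 -> 0 < P (m + 2)%nat y ->
     (forall s, In s (seq 0 (cst_c per)) -> 0 < P (m + 1)%nat (ys s)) ->
     ln (P (m + 2)%nat y) + (-1) ^ length per * ln (P m 0) =
     Rsum (seq 0 (cst_c per)) (fun s => ln (P (m + 1)%nat (ys s)))) ->
  is_lim_seq (fun m => ln (sudler_const d (n m)))
    (2 * ((Rsum (seq 0 (cst_c per)) (fun s => log_shape per k (ys s))
           - log_shape per k y - (-1) ^ length per * log_shape per k 0)
          / ((1 - cst_a per) * (1 - cst_b per)))).
Proof.
  intros hev hk h0 hy hys n P F.
  assert (ha1 := cst_a_gt_1 d h per hev). assert (hb := cst_b_eq d h per hev).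
  assert (hc := cst_c_eq d h per hev).
  set (x := fun m => ln (sudler_const d (n m))).
  destruct (sudler_sqr_log_lim d h per k 0 hev hk h0) as [l0 [N0 p0]].
  destruct (sudler_sqr_log_lim d h per k y hev hk hy) as [ly [Ny py]].
  assert (hsum : is_lim_seq
            (fun m => Rsum (seq 0 (cst_c per)) (fun s => ln (P m (ys s)) - x m))
            (Rsum (seq 0 (cst_c per)) (fun s => 2 * log_shape per k (ys s)))).
  { apply is_lim_seq_Rsum. intros s _. apply (sudler_sqr_log_lim d h per k _ hev hk (hys s)). }
  destruct (eventually_forall_in (seq 0 (cst_c per)) (fun m s => 0 < P m (ys s))) as [Ns ps].
  { intros s _. apply (sudler_sqr_log_lim d h per k _ hev hk (hys s)). }
  rewrite Rmult_div_assoc. apply (unstable_recurrence x).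
  - exact ha1.
  - rewrite hb. unfold Rdiv. rewrite Rabs_mult, pow_1_abs, Rmult_1_l, Rabs_pos_eq.
    + rewrite <- Rinv_1. apply Rinv_lt_contravar; lra.
    + left. apply Rinv_0_lt_compat; lra.
  - apply ln_sudler_const_growth; [exact hev|lia].
  - apply is_lim_seq_ext_loc with (fun m =>
      Rsum (seq 0 (cst_c per)) (fun s => ln (P (m + 1)%nat (ys s)) - x (m + 1)%nat)
      - (ln (P (m + 2)%nat y) - x (m + 2)%nat)
      - (-1) ^ length per * (ln (P m 0) - x m)).
    + exists (N0 + Ny + Ns)%nat. intros m hm.
      specialize (F m (p0 m ltac:(lia)) (py (m + 2)%nat ltac:(lia)) (ps (m + 1)%nat ltac:(lia))).
      (* Normalizing each of the c products at m + 1 subtracts ln K, altogether c = a + b times; the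
         remaining coefficient (-1)^l is a b. *)
      unfold Rminus at 3. rewrite Rsum_plus, Rsum_const, length_seq, <- F.
      replace (S (S m)) with (m + 2)%nat by lia. replace (S m) with (m + 1)%nat by lia.
      replace (cst_a per + cst_b per) with (INR (cst_c per)) by lra.
      replace (cst_a per * cst_b per) with ((-1) ^ length per) by (rewrite hb; field; lra). ring.
    + replace (2 * (Rsum (seq 0 (cst_c per)) (fun s => log_shape per k (ys s))
          - log_shape per k y - (-1) ^ length per * log_shape per k 0)) with
        (Rsum (seq 0 (cst_c per)) (fun s => 2 * log_shape per k (ys s))
          - 2 * log_shape per k y - (-1) ^ length per * (2 * log_shape per k 0))
        by (rewrite Rsum_scal; ring).
      apply is_lim_seq_minus'; [apply is_lim_seq_minus'|].
      * apply (is_lim_seq_incr_n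
          (fun m => Rsum (seq 0 (cst_c per)) (fun s => ln (P m (ys s)) - x m)) 1).
        exact hsum.
      * apply (is_lim_seq_incr_n (fun m => ln (P m y) - x m) 2). exact ly.
      * apply (is_lim_seq_scal_l _ ((-1) ^ length per) (2 * log_shape per k 0)). exact l0.
Qed.

Lemma ln_sudler_const_lim_even (d : nat -> nat) (h : nat) (per : list nat) (k : nat) :
  ev_digits d h per -> (1 <= k <= length per)%nat -> Nat.Even (length per) ->
  is_lim_seq (fun m => ln (sudler_const d (h + m * length per + k)))
    (2 * ((Rsum (seq 0 (cst_c per)) (fun s => log_shape per k (INR s))
           - log_shape per k (cst_a per ^ 2) - log_shape per k 0)
          / ((1 - cst_a per) * (1 - cst_b per)))).
Proof.
  intros hev hk hl.
  assert (hsg : (-1) ^ length per = 1) by (destruct hl as [l' e]; rewrite e; apply pow_1_even).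
  assert (H := ln_sudler_const_lim d h per k (cst_a per ^ 2) INR hev hk
    (admissible_nat d h per k 0 hev hk) (admissible_cst_a_sqr d h per k hev hk hl)
    (fun s => admissible_nat d h per k s hev hk)).
  rewrite hsg, Rmult_1_l in H. apply H. clear H.
  intros m p0 p2 ps. rewrite Rmult_1_l.
  rewrite <- ln_Rprod, <- ln_mult, <- Rprod_pow, <- Rpow_mult_distr by assumption.
  assert (F := sudler_functional_even d h per (h + m * length per + k) hev hl
                 ltac:(lia) ltac:(lia)). cbv zeta in F.
  replace (h + m * length per + k + 2 * length per)%nat
    with (h + (m + 2) * length per + k)%nat in F by lia.
  replace (h + m * length per + k + length per)%nat
    with (h + (m + 1) * length per + k)%nat in F by lia.
  rewrite <- F, Rmult_comm. reflexivity.
Qed.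

Lemma ln_sudler_const_lim_odd (d : nat -> nat) (h : nat) (per : list nat) (k : nat) :
  ev_digits d h per -> (1 <= k <= length per)%nat -> Nat.Odd (length per) ->
  is_lim_seq (fun m => ln (sudler_const d (h + m * length per + k)))
    (2 * (Rsum (seq 0 (cst_c per)) (fun s => log_shape per k (INR s - cst_a per))
          / ((1 - cst_a per) * (1 - cst_b per)))).
Proof.
  intros hev hk hl.
  assert (hsg : (-1) ^ length per = -1)
    by (destruct hl as [l' e]; rewrite e, Nat.add_1_r; apply pow_1_odd).
  assert (a0 := admissible_nat d h per k 0 hev hk).
  assert (H := ln_sudler_const_lim d h per k 0 (fun s => INR s - cst_a per) hev hk a0 a0
    (fun s => admissible_sub_cst_a d h per k s hev hk hl)).
  rewrite hsg in H. cbv zeta in H.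
  (* With y = 0 and sign -1 the two terms [log_shape per k 0] cancel. *)
  match type of H with _ -> is_lim_seq _ (Finite (2 * (?A / _))) =>
    replace A with (Rsum (seq 0 (cst_c per)) (fun s => log_shape per k (INR s - cst_a per)))
      in H by ring end.
  apply H. clear H. intros m p0 p2 ps.
  assert (hP := Rprod_pos _ _ ps).
  rewrite <- ln_Rprod by exact ps.
  assert (F := sudler_functional_odd d h per (h + m * length per + k) hev hl
                 ltac:(lia) ltac:(lia)). cbv zeta in F.
  replace (h + m * length per + k + 2 * length per)%nat
    with (h + (m + 2) * length per + k)%nat in F by lia.
  replace (h + m * length per + k + length per)%nat
    with (h + (m + 1) * length per + k)%nat in F by lia.
  rewrite F, Rpow_mult_distr, Rprod_pow, ln_mult by assumption. ring.
Qed.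

(** * Identification with the product formulas *)

Lemma is_infprod_mult (f g : nat -> R) (a b : R) :
  is_infprod f a -> is_infprod g b -> is_infprod (fun t => f t * g t) (a * b).
Proof.
  intros hf hg. unfold is_infprod.
  apply is_lim_seq_ext with (fun N => Rprod (seq 1 N) f * Rprod (seq 1 N) g).
  - intros N. symmetry. apply Rprod_mult.
  - apply is_lim_seq_mult'; assumption.
Qed.

Lemma is_infprod_ext (f g : nat -> R) (a : R) :
  (forall t, (1 <= t)%nat -> f t = g t) -> is_infprod f a -> is_infprod g a.
Proof.
  intros H hf. eapply is_lim_seq_ext; [|exact hf]. intros N. apply Rprod_ext.
  intros t ht. apply in_seq in ht. apply H. lia.
Qed.

Lemma is_infprod_Rprod (s : list nat) (f : nat -> nat -> R) (g : nat -> R) :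
  (forall i, In i s -> is_infprod (f i) (g i)) ->
  is_infprod (fun t => Rprod s (fun i => f i t)) (Rprod s g).
Proof.
  intros H. induction s as [|i s IH].
  - unfold is_infprod. apply is_lim_seq_ext with (fun _ => 1); [|apply is_lim_seq_const].
    intros N. symmetry. apply Rprod_const_1. reflexivity.
  - change (Rprod (i :: s) g) with (g i * Rprod s g).
    apply (is_infprod_mult (f i) (fun t => Rprod s (fun i => f i t))).
    + apply H. left. reflexivity.
    + apply IH. intros; apply H; right; assumption.
Qed.

Lemma is_infprod_abs (x : nat -> R) (M z : R) :
  inv_sqr_bounded x M ->
  is_infprod (fun t => Rabs (1 - z * x t)) (Rabs (entire_prod x z)).
Proof.
  intros hb. assert (hl := entire_prod_lim x M z hb).
  apply is_lim_seq_ext with (fun N => Rabs (part_prod x N z)).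
  - intros N. apply Rprod_abs.
  - apply (is_lim_seq_abs _ (entire_prod x z)). exact hl.
Qed.

(** The power is exp(r ln), so both the factors and the full product must be nonzero; for a negative
    exponent the limit would not exist otherwise. *)
Lemma is_infprod_abspow (x : nat -> R) (M z r : R) :
  inv_sqr_bounded x M -> (forall t, (1 <= t)%nat -> 1 - z * x t <> 0) ->
  is_infprod (fun t => abspow (1 - z * x t) r) (abspow (entire_prod x z) r).
Proof.
  intros hb hz. assert (hne := entire_prod_neq_0 x M z hb hz).
  assert (hl := is_infprod_abs x M z hb). unfold is_infprod in *.
  apply is_lim_seq_ext with (fun N => exp (r * ln (Rprod (seq 1 N) (fun t => Rabs (1 - z * x t))))).
  - intros N. unfold abspow, Rpower.
    rewrite ln_Rprod by (intros t ht; apply in_seq in ht; apply Rabs_pos_lt, hz; lia).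
    rewrite <- Rsum_scal. generalize (seq 1 N). intros s. induction s as [|t s IH].
    + unfold Rsum, Rprod. simpl. apply exp_0.
    + unfold Rsum, Rprod in *. simpl. rewrite exp_plus, IH. reflexivity.
  - unfold abspow, Rpower.
    apply (is_lim_seq_continuous exp _ (r * ln (Rabs (entire_prod x z)))).
    + apply derivable_continuous_pt, derivable_pt_exp.
    + apply (is_lim_seq_scal_l _ r (ln (Rabs (entire_prod x z)))).
      apply is_lim_seq_ln; [apply Rabs_pos_lt, hne|exact hl].
Qed.

Lemma Rprod_exp (s : list nat) (f : nat -> R) :
  Rprod s (fun x => exp (f x)) = exp (Rsum s f).
Proof.
  induction s as [|x s IH]; unfold Rprod, Rsum in *; simpl; [symmetry; apply exp_0|].
  rewrite exp_plus, IH. reflexivity.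
Qed.

Lemma ln_fact (c : nat) :
  Rsum (seq 1 (c - 1)) (fun s => ln (Rabs (1 + INR s))) = ln (INR (fact c)).
Proof.
  induction c as [|[|c] IH]; [unfold Rsum; simpl; symmetry; apply ln_1|
                              unfold Rsum; simpl; symmetry; apply ln_1|].
  replace (S (S c) - 1)%nat with (S (S c - 1)) by lia.
  rewrite Rsum_seq_S, IH, (fact_simpl (S c)), mult_INR, ln_mult;
    try (apply (lt_INR 0); try apply lt_O_fact; lia).
  replace (1 + (S c - 1))%nat with (S c) by lia.
  rewrite Rabs_pos_eq by (assert (h := pos_INR (S c)); lra).
  rewrite (S_INR (S c)), (Rplus_comm 1). ring.
Qed.

(** Since a b = 1, the denominator (1 - a)(1 - b) is - (c - 2), and c - 2 = (a - 1)^2 / a > 0.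
    Splitting [log_shape] separates the linear factors 1 + s, with product c!, and 1 + a^2 = 1 +
    1/|b|^2 from the infinite products. *)
Lemma infprod_even_value (d : nat -> nat) (h : nat) (per : list nat) (k : nat) (eps : R) :
  ev_digits d h per -> (1 <= k <= length per)%nat -> Nat.Even (length per) ->
  exists L, is_infprod (factor_even per k eps) L /\
    exp ((Rsum (seq 0 (cst_c per)) (fun s => log_shape per k (INR s))
          - log_shape per k (cst_a per ^ 2) - log_shape per k 0)
         / ((1 - cst_a per) * (1 - cst_b per))) * Rabs (limit_shape per k eps)
    = prefactor_even per k eps * L.
Proof.
  intros hev hk hl.
  assert (ha1 := cst_a_gt_1 d h per hev). assert (hb := cst_b_eq d h per hev).
  assert (hcc := cst_c_eq d h per hev).
  assert (hsg : (-1) ^ length per = 1) by (destruct hl as [l' e]; rewrite e; apply pow_1_even).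
  rewrite hsg in hb, hcc.
  assert (hbd := inv_u_sqr_bounded d h per k hev hk).
  assert (hC := lim_C_range d h per k hev ltac:(lia)).
  assert (hbb : 1 / Rabs (cst_b per) ^ 2 = cst_a per ^ 2).
  { rewrite pow2_abs, hb. field. lra. }
  set (c := cst_c per) in *. set (a := cst_a per) in *. set (r := 1 / (INR c - 2)).
  assert (hc2 : 0 < INR c - 2).
  { rewrite hcc. replace (a + 1 / a - 2) with ((a - 1) ^ 2 / a) by (field; lra).
    apply Rdiv_lt_0_compat; [apply pow_lt|]; lra. }
  set (W := fun y => shape_prod per k y).
  exists (Rabs (entire_prod (inv_u_sqr per k) ((1 + 2 * eps / lim_C per k) ^ 2))
          * abspow (W (a ^ 2)) r * Rprod (seq 1 (c - 1)) (fun s => abspow (W (INR s)) (- r))).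
  split.
  - assert (hfac : forall y s, admissible per k y ->
      is_infprod (fun t => abspow (1 - (1 + 2 * y) ^ 2 / u per k t ^ 2) s) (abspow (W y) s)).
    { intros y s hy. apply (is_infprod_abspow (inv_u_sqr per k) 64); [exact hbd|].
      intros t ht. apply (factor_neq_0 d h); auto. apply hy; exact ht. }
    apply is_infprod_mult; [apply is_infprod_mult|].
    + rewrite (abs_ec_eq d h) by assumption.
      apply (is_infprod_abs (inv_u_sqr per k) 64). exact hbd.
    + apply is_infprod_ext with (fun t => abspow (1 - (1 + 2 * a ^ 2) ^ 2 / u per k t ^ 2) r).
      * intros t ht. replace (2 / Rabs (cst_b per) ^ 2) with (2 * a ^ 2); [reflexivity|].
        rewrite <- hbb. unfold Rdiv. ring.
      * apply hfac. apply (admissible_cst_a_sqr d h); assumption.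
    + apply is_infprod_Rprod. intros s _. apply hfac. apply (admissible_nat d h); assumption.
  - unfold prefactor_even. fold c. fold r. rewrite (abs_ec_eq d h) by assumption.
    rewrite hbb. unfold limit_shape. rewrite Rabs_mult.
    set (E := Rabs (1 + eps / lim_C per k)).
    set (F := Rabs (entire_prod _ _)). unfold abspow, Rpower. rewrite Rprod_exp.
    unfold Rdiv at 2. rewrite Rmult_1_l, <- exp_Ropp.
    set (X := Rsum (seq 1 (c - 1)) (fun s => - r * ln (Rabs (W (INR s))))).
    transitivity (E * F * exp (r * ln (1 + a ^ 2) + - (r * ln (INR (fact c)))
       + r * ln (Rabs (W (a ^ 2))) + X)); [|rewrite !exp_plus; ring].
    rewrite Rmult_comm. f_equal. f_equal.
    replace ((1 - a) * (1 - cst_b per)) with (- (INR c - 2)) by (rewrite hb, hcc; field; lra).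
    assert (hcpos : (1 <= c)%nat).
    { apply INR_le. simpl. lra. }
    (* The term s = 0 cancels against [log_shape per k 0]; this is why the product in the theorem
       starts at s = 1. *)
    replace (seq 0 c) with ([0%nat] ++ seq 1 (c - 1)).
    2:{ destruct c as [|c']; [lia|]. simpl. rewrite Nat.sub_0_r. reflexivity. }
    rewrite Rsum_app. unfold Rsum at 1. simpl (map _ _). simpl (fold_right _ _ _).
    unfold log_shape. rewrite Rsum_plus, ln_fact. unfold X. rewrite Rsum_scal.
    rewrite (Rabs_pos_eq (1 + a ^ 2)) by (assert (h0 := pow2_ge_0 a); lra).
    unfold W, r. field. lra.
Qed.

(** Now a b = -1, so (1 - a)(1 - b) = - c and 1/|b| = a. The linear factors 1 + (s - a) for 0 <= s <
    c are the numbers s - a for 1 <= s <= c, whence the different ranges of s in the two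
    products. *)
Lemma infprod_odd_value (d : nat -> nat) (h : nat) (per : list nat) (k : nat) (eps : R) :
  ev_digits d h per -> (1 <= k <= length per)%nat -> Nat.Odd (length per) ->
  exists L, is_infprod (factor_odd per k eps) L /\
    exp (Rsum (seq 0 (cst_c per)) (fun s => log_shape per k (INR s - cst_a per))
         / ((1 - cst_a per) * (1 - cst_b per))) * Rabs (limit_shape per k eps)
    = prefactor_odd per k eps * L.
Proof.
  intros hev hk hl.
  assert (ha1 := cst_a_gt_1 d h per hev). assert (hb := cst_b_eq d h per hev).
  assert (hcc := cst_c_eq d h per hev).
  assert (hsg : (-1) ^ length per = -1)
    by (destruct hl as [l' e]; rewrite e, Nat.add_1_r; apply pow_1_odd).
  rewrite hsg in hb, hcc.
  assert (hbd := inv_u_sqr_bounded d h per k hev hk).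
  assert (hC := lim_C_range d h per k hev ltac:(lia)).
  assert (hbb : 1 / Rabs (cst_b per) = cst_a per).
  { rewrite hb. replace (-1 / cst_a per) with (- / cst_a per) by (field; lra).
    rewrite Rabs_Ropp, Rabs_pos_eq; [field; lra|left; apply Rinv_0_lt_compat; lra]. }
  set (c := cst_c per) in *. set (a := cst_a per) in *. set (r := 1 / INR c).
  assert (hc2 : 0 < INR c).
  { rewrite hcc. replace (a + -1 / a) with ((a - 1) * (a + 1) / a) by (field; lra).
    apply Rdiv_lt_0_compat; nra. }
  set (W := fun y => shape_prod per k y).
  exists (Rabs (entire_prod (inv_u_sqr per k) ((1 + 2 * eps / lim_C per k) ^ 2))
          * Rprod (seq 0 c) (fun s => abspow (W (INR s - a)) (- r))).
  split.
  - apply is_infprod_mult.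
    + rewrite (abs_ec_eq d h) by assumption.
      apply (is_infprod_abs (inv_u_sqr per k) 64). exact hbd.
    + rewrite hbb. apply is_infprod_Rprod. intros s _.
      apply (is_infprod_abspow (inv_u_sqr per k) 64); [exact hbd|].
      intros t ht. apply (factor_neq_0 d h); auto. apply (u_ne_sub_cst_a d h); assumption.
  - unfold prefactor_odd. fold c. fold a. fold r. rewrite (abs_ec_eq d h) by assumption.
    unfold limit_shape. rewrite Rabs_mult.
    set (E := Rabs (1 + eps / lim_C per k)).
    set (F := Rabs (entire_prod _ _)). unfold abspow, Rpower. rewrite !Rprod_exp.
    unfold Rdiv at 2. rewrite <- exp_Ropp.
    rewrite (Rsum_scal (seq 1 c)), (Rsum_scal (seq 0 c)).
    transitivity (E * F * exp (- (r * Rsum (seq 1 c) (fun s => ln (Rabs (INR s - a))))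
       + - r * Rsum (seq 0 c) (fun s => ln (Rabs (W (INR s - a)))))); [|rewrite exp_plus; ring].
    rewrite Rmult_comm. f_equal. f_equal.
    replace ((1 - a) * (1 - cst_b per)) with (- INR c) by (rewrite hb, hcc; field; lra).
    unfold log_shape. rewrite Rsum_plus.
    replace (Rsum (seq 1 c) (fun s => ln (Rabs (INR s - a)))) with
      (Rsum (seq 0 c) (fun s => ln (Rabs (1 + (INR s - a))))).
    + unfold W, r. field. lra.
    + rewrite <- seq_shift. unfold Rsum. rewrite map_map. f_equal. apply map_ext. intros s.
      rewrite S_INR. do 2 f_equal. ring.
Qed.

Lemma sudler_ucv (d : nat -> nat) (h : nat) (per : list nat) (k : nat) (X : R) :
  ev_digits d h per -> (1 <= k <= length per)%nat ->
  is_lim_seq (fun m => ln (sudler_const d (h + m * length per + k))) (2 * X) ->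
  ucv (fun m eps => sudler d (h + m * length per + k) eps)
      (fun eps => exp X * Rabs (limit_shape per k eps)).
Proof.
  intros hev hk hX. assert (hd := proj1 hev).
  assert (hsm := smooth_limit_shape d h per k hev hk).
  apply ucv_of_sqr.
  - intros m y. unfold sudler, Rprod.
    generalize (seq 1 (cf_q d (h + m * length per + k))). intros s.
    induction s as [|t s IH]; simpl; [lra|].
    apply Rmult_le_pos; [|exact IH]. apply Rmult_le_pos; [lra|apply Rabs_pos].
  - intros y. apply Rmult_le_pos; [left; apply exp_pos|apply Rabs_pos].
  - apply ucv_ext with
      (fun m y => sudler_const d (h + m * length per + k) * sudler_shape d (h + m * length per + k) y)
      (fun y => exp (2 * X) * limit_shape per k y ^ 2).
    + intros m y. symmetry. apply sudler_sqr_eq; [exact hd|lia].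
    + intros y. rewrite Rpow_mult_distr, pow2_abs. f_equal.
      replace (2 * X) with (X + X) by ring. rewrite exp_plus. ring.
    + apply ucv_mult.
      * apply continuous_bounded. intros y. apply continuous_const.
      * apply continuous_bounded. intros y.
        apply (continuous_comp (limit_shape per k) (fun z => z ^ 2)).
        -- apply smooth_continuous, hsm.
        -- apply (ex_derive_continuous (V := R_NormedModule)). auto_derive. exact I.
      * apply ucv_seq.
        apply is_lim_seq_ext with (fun m => exp (ln (sudler_const d (h + m * length per + k)))).
        -- intros m. apply exp_ln, sudler_const_pos; [exact hd|lia].
        -- apply (is_lim_seq_continuous exp _ (2 * X)); [|exact hX].
           apply derivable_continuous_pt, derivable_pt_exp.
      * apply ucv_sudler_shape; assumption.
Qed.

Lemma ev_digits_digits (pre per : list nat) :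
  (1 <= length per)%nat ->
  (forall x : nat, In x pre -> (1 <= x)%nat) ->
  (forall x : nat, In x per -> (1 <= x)%nat) ->
  ev_digits (digits pre per) (length pre) per.
Proof.
  intros hl hpre hper. split; [|split; [exact hl|]].
  - intros i hi. unfold digits. destruct (Nat.leb_spec i (length pre)).
    + apply hpre, nth_In. lia.
    + apply hper, nth_In, Nat.mod_upper_bound. lia.
  - intros i hi. unfold digits. destruct (Nat.leb_spec (length pre + i) (length pre)); [lia|].
    do 2 f_equal. lia.
Qed.

Theorem theorem1 (h l : nat) (pre per : list nat)
  (hpre : length pre = h) (hper : length per = l) (hl : (1 <= l)%nat)
  (pre_pos : forall x : nat, In x pre -> (1 <= x)%nat)
  (per_pos : forall x : nat, In x per -> (1 <= x)%nat) :
  forall k : nat, (1 <= k <= l)%nat ->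
  exists G : R -> R,
    (forall x : R, exists r : posreal,
       CVU (fun (m : nat) (eps : R) => sudler (digits pre per) (h + m * l + k) eps)
           G x r) /\
    (Nat.Even l -> forall eps : R, exists L : R,
       is_infprod (factor_even per k eps) L /\
       G eps = prefactor_even per k eps * L) /\
    (Nat.Odd l -> forall eps : R, exists L : R,
       is_infprod (factor_odd per k eps) L /\
       G eps = prefactor_odd per k eps * L) /\
    (forall x : R, continuous G x) /\
    (forall I : R -> Prop, is_interval I -> (forall x : R, I x -> G x <> 0) ->
       forall (n : nat) (x : R), I x -> ex_derive_n G n x).
Proof.
  intros k hk. subst h l.
  assert (hev := ev_digits_digits pre per hl pre_pos per_pos).
  set (d := digits pre per) in *.
  assert (hsm := smooth_limit_shape d (length pre) per k hev hk).
  set (Xe := (Rsum (seq 0 (cst_c per)) (fun s => log_shape per k (INR s))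
          - log_shape per k (cst_a per ^ 2) - log_shape per k 0)
         / ((1 - cst_a per) * (1 - cst_b per))).
  set (Xo := Rsum (seq 0 (cst_c per)) (fun s => log_shape per k (INR s - cst_a per))
         / ((1 - cst_a per) * (1 - cst_b per))).
  (* G must be given before the parity of l is known, so X is introduced with one identification for
     each parity. *)
  assert (hX : exists X,
    is_lim_seq (fun m => ln (sudler_const d (length pre + m * length per + k))) (2 * X) /\
    (Nat.Even (length per) -> X = Xe) /\ (Nat.Odd (length per) -> X = Xo)).
  { destruct (Nat.Even_or_Odd (length per)) as [he|ho].
    - exists Xe. split; [apply ln_sudler_const_lim_even; assumption|split; [reflexivity|]].
      intros ho. exfalso. exact (Nat.Even_Odd_False _ he ho).
    - exists Xo. split; [apply ln_sudler_const_lim_odd; assumption|split; [|reflexivity]].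
      intros he. exfalso. exact (Nat.Even_Odd_False _ he ho). }
  destruct hX as (X & hlim & hXe & hXo).
  exists (fun eps => exp X * Rabs (limit_shape per k eps)).
  split; [|split; [|split; [|split]]].
  (* Any radius would do, as convergence is uniform on every bounded set. *)
  - intros x. exists (mkposreal 1 Rlt_0_1). apply ucv_CVU.
    apply sudler_ucv; assumption.
  - intros he eps. rewrite (hXe he).
    apply (infprod_even_value d (length pre)); assumption.
  - intros ho eps. rewrite (hXo ho).
    apply (infprod_odd_value d (length pre)); assumption.
  - intros x. apply (continuous_mult (fun _ => exp X)); [apply continuous_const|].
    apply (continuous_comp (limit_shape per k) Rabs); [apply smooth_continuous, hsm|].
    apply continuous_Rabs.
  - intros I _ hI n x hx. apply ex_derive_n_scal_l. apply ex_derive_n_Rabs; [exact hsm|].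
    intros E. apply (hI x hx). rewrite E, Rabs_R0. ring.
Qed.
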